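(* Let $(P,\gamma)$ be an $n$-dimensional adS-Reissner-Nordstr\''om manifold, $n\ge 3$, with horizon $\partial P=\{s_0\}\times S$ and warping function $\lambda$. Let $\Sigma$ be a smooth, closed, embedded, star-shaped and strictly mean convex hypersurface in $(P,\gamma)$, and let $\Omega$ denote the region bounded by $\Sigma$ and the horizon $\partial P$. Then $$\int_\Sigma\lambda\,d\Sigma\;\ge\;\int_\Omega\lambda'\,d\Omega+\frac{n-1}{n}\,\vartheta_{n-1}\left(\frac{|\Sigma|}{\vartheta_{n-1}}\right)^{\frac{n}{n-1}}+\frac{s_0}{n}\,|\partial P|,$$ where $\vartheta_{n-1}=|S|$ is the volume of $(S,h_S)$. Moreover, equality holds if and only if $\Sigma$ is a slice, that is, $\Sigma=\{s\}\times S$ for some $s\in[s_0,\infty)$.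
   Context: Let $(S^{n-1},h_S)$ be a closed space form of constant sectional curvature $\epsilon\in\{-1,0,1\}$. Let $m,q,\kappa$ be real numbers with $q<m<\infty$, $q<\kappa<\infty$ and $\kappa>0$, such that the equation $$\epsilon+\kappa^2s^2-2ms^{2-n}+q^2s^{4-2n}=0$$ has positive real roots, and let $s_0$ be the largest root. The adS-Reissner-Nordstr\''om manifold of mass $m$ and charge $q$ is $P=(s_0,\infty)\times S$ with the metric $$\gamma=\frac{ds^2}{\epsilon+\kappa^2s^2-2ms^{2-n}+q^2s^{4-2n}}+s^2h_S.$$ Its boundary $\partial P=\{s_0\}\times S$ is called the horizon; areas ($|\Sigma|$, $|\partial P|$) are $(n-1)$-dimensional volumes, so $|\partial P|=s_0^{n-1}|S|$. After a change of variable $s=\lambda(r)$, the metric is written as $$\gamma=dr^2+\lambda^2(r)h_S,$$ where $\lambda:[0,\infty)\to\mathbb{R}$ satisfies $\lambda(0)=s_0$ (so that the horizon corresponds to $r=0$) and $$\lambda'(r)=\sqrt{\epsilon+\kappa^2\lambda^2-2m\lambda^{2-n}+q^2\lambda^{4-2n}}.$$ The functions $\lambda$ and $\lambda'$ are regarded as functions on $P$ through the coordinate $r$. A hypersurface $\Sigma$ in $P$ is star-shaped if it is the graph of some function defined on the horizon, i.e. $\Sigma=\{(u(\theta),\theta):\theta\in S\}$. It is strictly mean convex if its mean curvature (sum of principal curvatures, with respect to the unit normal pointing away from the horizon, with the convention that slices $\{s\}\times S$ with $s>s_0$ have positive mean curvature) is positive everywhere. *)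

(* Defs.v *)
From HB Require Import structures.
From mathcomp Require Import all_boot all_order all_algebra.
From mathcomp Require Import all_classical all_reals all_analysis.

Set Implicit Arguments.
Unset Strict Implicit.
Unset Printing Implicit Defensive.

Import Order.TTheory GRing.Theory Num.Theory.
Import numFieldNormedType.Exports.

Local Open Scope classical_set_scope.
Local Open Scope ring_scope.

Definition partial (R : realType) (d : nat) (i : 'I_d)
    (f : 'rV[R]_d -> R) (x : 'rV[R]_d) : R :=
  'D_(delta_mx 0 i : 'rV[R]_d) f x.

Fixpoint Ck (R : realType) (d k : nat) (U : set 'rV[R]_d)
    (f : 'rV[R]_d -> R) : Prop :=
  (forall x, U x -> {for x, continuous f}) /\
  if k is k'.+1 then
    forall i : 'I_d,
      (forall x, U x -> derivable f x (delta_mx 0 i : 'rV[R]_d)) /\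
      Ck k' U (partial i f)
  else True.

Definition smooth_on (R : realType) (d : nat) (U : set 'rV[R]_d)
    (f : 'rV[R]_d -> R) : Prop :=
  forall k, Ck k U f.

(* Lebesgue integral of a nonnegative Borel function on R^d, written (Tonelli)
   as an iterated one-dimensional integral, first coordinate outermost. *)
Fixpoint lebesgue_int (R : realType) (d : nat) :
    ('rV[R]_d -> \bar R) -> \bar R :=
  match d with
  | 0 => fun f => f 0
  | d'.+1 => fun f =>
      (\int[@lebesgue_measure R]_t
         lebesgue_int (fun y : 'rV[R]_d' => f (row_mx (t%:M : 'rV[R]_1) y)))%E
  end.

(* A chart is [chart_map i] on [chart_dom i], with inverse [chart_inv i] on
   [chart_image i]; outside these sets the two functions take junk values. *)
Record atlas (R : realType) (d : nat) (T : Type) := Atlas {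
  chart : Type;
  chart_dom : chart -> set T;
  chart_map : chart -> T -> 'rV[R]_d;
  chart_inv : chart -> 'rV[R]_d -> T }.

Definition chart_image (R : realType) (d : nat) (T : Type) (A : atlas R d T)
    (i : chart A) : set 'rV[R]_d :=
  chart_map i @` chart_dom i.

Definition overlap (R : realType) (d : nat) (T : Type) (A : atlas R d T)
    (i j : chart A) : set 'rV[R]_d :=
  chart_map i @` (chart_dom i `&` chart_dom j).

Definition transition (R : realType) (d : nat) (T : Type) (A : atlas R d T)
    (i j : chart A) (x : 'rV[R]_d) : 'rV[R]_d :=
  chart_map j (chart_inv i x).

Definition smooth_atlas (R : realType) (d : nat) (T : topologicalType)
    (A : atlas R d T) : Prop :=
  \bigcup_(i in [set: chart A]) chart_dom i = [set: T] /\
  (forall i : chart A,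
     [/\ open (chart_dom i), open (chart_image i),
         {within chart_dom i, continuous (chart_map i)},
         {within chart_image i, continuous (chart_inv i)} &
         forall p, chart_dom i p -> chart_inv i (chart_map i p) = p]) /\
  (forall (i j : chart A) (a : 'I_d),
     smooth_on (overlap i j) (fun x => transition i j x 0 a)).

Definition smooth_function (R : realType) (d : nat) (T : topologicalType)
    (A : atlas R d T) (f : T -> R) : Prop :=
  forall i : chart A, smooth_on (chart_image i) (fun x => f (chart_inv i x)).

Definition inner (R : realType) (d : nat) (G : 'M[R]_d) (X Y : 'rV[R]_d) : R :=
  (X *m G *m Y^T) 0 0.

(* A metric is given by its matrix in each chart; the matrices are related by
   the transformation law of covariant 2-tensors. *)
Definition riemannian_metric (R : realType) (d : nat) (T : topologicalType)
    (A : atlas R d T) (g : chart A -> 'rV[R]_d -> 'M[R]_d) : Prop :=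
  (forall i : chart A,
     [/\ forall a b : 'I_d, smooth_on (chart_image i) (fun x => g i x a b),
         forall x, chart_image i x -> (g i x)^T = g i x &
         forall x, chart_image i x ->
           forall X, X != 0 -> 0 < inner (g i x) X X]) /\
  (forall (i j : chart A) x, overlap i j x ->
     g i x = 'J (transition i j) x *m g j (transition i j x)
               *m ('J (transition i j) x)^T).

(* [christoffel g l i j x] is Gamma^l_{ij}. *)
Definition christoffel (R : realType) (d : nat) (g : 'rV[R]_d -> 'M[R]_d)
    (l i j : 'I_d) (x : 'rV[R]_d) : R :=
  2^-1 * \sum_(k < d) invmx (g x) l k *
    (partial i (fun y => g y j k) x + partial j (fun y => g y i k) x
     - partial k (fun y => g y i j) x).

(* [riemann g l k i j x] is the l-th component of R(d_i, d_j) d_k, where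
   R(X,Y) = nabla_X nabla_Y - nabla_Y nabla_X - nabla_[X,Y]. *)
Definition riemann (R : realType) (d : nat) (g : 'rV[R]_d -> 'M[R]_d)
    (l k i j : 'I_d) (x : 'rV[R]_d) : R :=
  partial i (christoffel g l j k) x - partial j (christoffel g l i k) x
  + \sum_(p < d) (christoffel g l i p x * christoffel g p j k x
                  - christoffel g l j p x * christoffel g p i k x).

Definition curvature_op (R : realType) (d : nat) (g : 'rV[R]_d -> 'M[R]_d)
    (x X Y Z : 'rV[R]_d) : 'rV[R]_d :=
  \row_l \sum_(k < d) \sum_(i < d) \sum_(j < d)
    riemann g l k i j x * X 0 i * Y 0 j * Z 0 k.

Definition sectional_curvature (R : realType) (d : nat)
    (g : 'rV[R]_d -> 'M[R]_d) (x X Y : 'rV[R]_d) : R :=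
  inner (g x) (curvature_op g x X Y Y) X /
  (inner (g x) X X * inner (g x) Y Y - inner (g x) X Y ^+ 2).

Definition closed_space_form (R : realType) (d : nat) (S : topologicalType)
    (A : atlas R d S) (h : chart A -> 'rV[R]_d -> 'M[R]_d) (eps : R) : Prop :=
  [/\ hausdorff_space S, compact [set: S] & connected [set: S]] /\
  [/\ smooth_atlas A, riemannian_metric h &
      forall (i : chart A) x, chart_image i x ->
      forall X Y : 'rV[R]_d, row_free (col_mx X Y) ->
        sectional_curvature (h i) x X Y = eps].

Notation borel T := (g_sigma_algebraType (@open T)).

(* [mu] is the Riemannian volume of [g]: in every chart it has density
   sqrt(det g) with respect to Lebesgue measure.  On a second countable
   manifold exactly one Borel measure has this property. *)
Definition riemannian_volume (R : realType) (d : nat) (disp : measure_display)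
    (T : measurableType disp) (mu : {measure set T -> \bar R})
    (A : atlas R d T) (g : chart A -> 'rV[R]_d -> 'M[R]_d) : Prop :=
  forall (i : chart A) (B : set T), measurable B -> B `<=` chart_dom i ->
    mu B = lebesgue_int
      ((fun x => (Num.sqrt (\det (g i x)))%:E) \_ (chart_map i @` B)).

(* Below, [F] is a local parametrization of a hypersurface of R^(1+d) with the
   metric [G]; row [i] of ['J F x] is the tangent vector d_i F. *)
Definition induced_metric (R : realType) (d : nat)
    (G : 'rV[R]_(1 + d) -> 'M[R]_(1 + d)) (F : 'rV[R]_d -> 'rV[R]_(1 + d))
    (x : 'rV[R]_d) : 'M[R]_d :=
  'J F x *m G (F x) *m ('J F x)^T.

Definition unit_normal (R : realType) (d : nat)
    (G : 'rV[R]_(1 + d) -> 'M[R]_(1 + d)) (F : 'rV[R]_d -> 'rV[R]_(1 + d))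
    (x : 'rV[R]_d) (N : 'rV[R]_(1 + d)) : Prop :=
  (forall i : 'I_d, inner (G (F x)) (row i ('J F x)) N = 0) /\
  inner (G (F x)) N N = 1.

(* The ambient covariant derivative of d_j F in the direction d_i F. *)
Definition cov_deriv (R : realType) (d : nat)
    (G : 'rV[R]_(1 + d) -> 'M[R]_(1 + d)) (F : 'rV[R]_d -> 'rV[R]_(1 + d))
    (x : 'rV[R]_d) (i j : 'I_d) : 'rV[R]_(1 + d) :=
  \row_a (partial i (fun y => 'J F y j a) x +
          \sum_b \sum_c christoffel G a b c (F x) * 'J F x i b * 'J F x j c).

(* The sign makes spheres have positive curvature for the outward normal. *)
Definition second_fundamental_form (R : realType) (d : nat)
    (G : 'rV[R]_(1 + d) -> 'M[R]_(1 + d)) (F : 'rV[R]_d -> 'rV[R]_(1 + d))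
    (x : 'rV[R]_d) (N : 'rV[R]_(1 + d)) : 'M[R]_d :=
  \matrix_(i, j) - inner (G (F x)) (cov_deriv G F x i j) N.

(* The trace of the shape operator, i.e. the sum of the principal curvatures. *)
Definition mean_curvature (R : realType) (d : nat)
    (G : 'rV[R]_(1 + d) -> 'M[R]_(1 + d)) (F : 'rV[R]_d -> 'rV[R]_(1 + d))
    (x : 'rV[R]_d) (N : 'rV[R]_(1 + d)) : R :=
  \tr (invmx (induced_metric G F x) *m second_fundamental_form G F x N).

(* The function of s whose positive square root is lam' at lam = s. *)
Definition adsRN_potential (R : realType) (n : nat) (eps m q kappa s : R) : R :=
  eps + kappa ^+ 2 * s ^+ 2 - 2 * m * s ^ (2%:Z - n%:Z)
  + q ^+ 2 * s ^ (4%:Z - 2%:Z * n%:Z).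

Definition largest_positive_root (R : realType) (V : R -> R) (s0 : R) : Prop :=
  [/\ 0 < s0, V s0 = 0 & forall s, 0 < s -> V s = 0 -> s <= s0].

(* The bijectivity clause says that s = lam(r) is a change of variable; it
   excludes the constant solution lam = s0 of the differential equation. *)
Definition warping_function (R : realType) (V : R -> R) (s0 : R)
    (lam : R -> R) : Prop :=
  [/\ lam 0 = s0,
      set_bij `[0, +oo[%classic `[s0, +oo[%classic lam,
      {within `[0, +oo[%classic, continuous lam} &
      forall r, 0 < r -> is_derive (r : R) 1 lam (Num.sqrt (V (lam r)))].

(* P = (0, oo) x S in the coordinates (r, theta), with the metric
   dr^2 + lam(r)^2 h; the coordinate s is lam(r). *)
Definition cylinder (R : realType) (d : nat) (S : Type) (A : atlas R d S) :
    atlas R (1 + d) (R * S) :=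
  {| chart := chart A;
     chart_dom := fun i => `]0, +oo[%classic `*` chart_dom i;
     chart_map := fun i p => row_mx (p.1%:M : 'rV[R]_1) (chart_map i p.2);
     chart_inv := fun i y => (lsubmx y 0 0, chart_inv i (rsubmx y)) |}.

Definition warped_metric (R : realType) (d : nat) (S : Type) (A : atlas R d S)
    (h : chart A -> 'rV[R]_d -> 'M[R]_d) (lam : R -> R)
    (i : chart (cylinder A)) (y : 'rV[R]_(1 + d)) : 'M[R]_(1 + d) :=
  block_mx (1%:M : 'M[R]_1) 0
           0                (lam (lsubmx y 0 0) ^+ 2 *: h i (rsubmx y)).

(* A graph is parametrized by S through theta |-> (u theta, theta): its area
   measure is the Riemannian volume on S of the induced metric, and functions
   on it are integrated over S after pull-back. *)

Definition graph_of (R : realType) (S : Type) (u : S -> R) : set (R * S) :=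
  [set (u t, t) | t in [set: S]].

Definition inner_region (R : realType) (S : Type) (u : S -> R) : set (R * S) :=
  [set p | 0 < p.1 < u p.2].

Definition graph_chart (R : realType) (d : nat) (S : Type) (A : atlas R d S)
    (u : S -> R) (i : chart A) (x : 'rV[R]_d) : 'rV[R]_(1 + d) :=
  row_mx ((u (chart_inv i x))%:M : 'rV[R]_1) x.

Definition graph_metric (R : realType) (d : nat) (S : Type) (A : atlas R d S)
    (h : chart A -> 'rV[R]_d -> 'M[R]_d) (lam : R -> R) (u : S -> R)
    (i : chart A) (x : 'rV[R]_d) : 'M[R]_d :=
  induced_metric (warped_metric h lam i) (graph_chart u i) x.

(* "Pointing away from the horizon" is positivity of the d/dr component. *)
Definition strictly_mean_convex (R : realType) (d : nat) (S : Type)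
    (A : atlas R d S) (h : chart A -> 'rV[R]_d -> 'M[R]_d) (lam : R -> R)
    (u : S -> R) : Prop :=
  forall (i : chart A) x, chart_image i x ->
  forall N, unit_normal (warped_metric h lam i) (graph_chart u i) x N ->
    0 < lsubmx N 0 0 ->
    0 < mean_curvature (warped_metric h lam i) (graph_chart u i) x N.

(* Sigma = {s} x S in the coordinates (s, theta), s = lam(r). *)
Definition is_slice (R : realType) (S : Type) (lam : R -> R) (s : R)
    (Sigma : set (R * S)) : Prop :=
  [set (lam p.1, p.2) | p in Sigma] = [set s] `*` [set: S].

(* Main.v *)
(** Write [Sigma] as the graph of [u] over [S], put [lam = lam(u)],
    [w = |Du|^2_h] and [Q = sqrt(lam^2 + w)]; the area element of [Sigma] is
    [lam^(n-2) Q] times that of [S].  On [S], [lam H] is the function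
    [(n-1) lam' lam / Q] minus the divergence of [Du / Q], so mean convexity gives
    [int_S ((n-1) psi lam' lam + <Dpsi, Du>) / Q >= 0] for every [psi >= 0], with
    strict inequality unless [psi = 0].

    Let [lam = a] be the slice with the same area as [Sigma], and take
    [psi = F(u)] where [F' = - (a - lam)_+ lam^(n-2)] and [F = 0] where [lam >= a].
    The potential [V] is a convex function of [s^(2-n)] which is nonnegative on
    [[s0, oo)] and vanishes at [s0]; hence it is nondecreasing there, and so is
    [lam'].  This yields
    [(n-1) F lam' <= (a^n - lam^n)/n - (a - lam) lam^(n-1)] where [lam < a].
    Since [lam <= Q], the integrand above is then at most
    [E = (lam - a) lam^(n-2) Q + (a^n - lam^n)/n] at every point; where
    [lam >= a] it is [0], and [E >= 0] is Young's inequality.  Finally [int_S E] is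
    the difference of the two sides of the inequality.  Equality forces
    [lam = a]: [F(u) > 0] where [lam < a], and Young's inequality is strict where
    [lam > a]. *)
From HB Require Import structures.
Require Import Defs.
From mathcomp Require Import all_boot all_order all_algebra.
From mathcomp Require Import all_classical all_reals all_analysis.
From mathcomp Require Import measurable_realfun zify ring lra.

Set Implicit Arguments.
Unset Strict Implicit.
Unset Printing Implicit Defensive.

Import Order.TTheory GRing.Theory Num.Theory.
Import numFieldNormedType.Exports.

Local Open Scope classical_set_scope.
Local Open Scope ring_scope.

(** * Lebesgue measure on R^d *)

Section borel_measurability.
Context {T : ptopologicalType}.

Lemma borel_open (O : set T) : open O -> measurable (O : set (borel T)).
Proof. by move=> oO; exact: sub_sigma_algebra. Qed.

Lemma measurable_fun_to_borel d (U : measurableType d) (D : set U)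
    (f : U -> borel T) :
  (forall O : set T, open O -> measurable (D `&` f @^-1` O)) ->
  measurable_fun D f.
Proof.
move=> H; apply: (@measurability _ _ _ _ _ _ (@open T : set (set (borel T)))) => // _ [V oV <-].
exact: H.
Qed.

Lemma borel_continuous_on {R : realType} (D : set T) (f : T -> R) :
  open D -> (forall x, D x -> {for x, continuous f}) ->
  measurable_fun (D : set (borel T)) (f : borel T -> R).
Proof.
move=> oD cf.
apply: (@measurability _ _ _ _ _ _ (@RGenOpens.G R)).
  exact: RGenOpens.measurableE.
move=> _ [V [a [b ->]] <-]; apply: borel_open.
rewrite openE => x [Dx fx]; rewrite /interior.
apply: filterI; first exact: open_nbhs_nbhs.
by apply: (cf x Dx); apply: open_nbhs_nbhs; split => //; exact: interval_open.
Qed.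

Lemma borel_continuous {R : realType} (f : T -> R) :
  continuous f -> measurable_fun setT (f : borel T -> R).
Proof. by move=> cf; exact: (@borel_continuous_on _ setT f openT (fun x _ => cf x)). Qed.

End borel_measurability.

Lemma borel_continuous_map {T U : ptopologicalType} (f : T -> U) :
  continuous f -> measurable_fun setT (f : borel T -> borel U).
Proof.
move=> /continuousP cf; apply: measurable_fun_to_borel => O oO.
by rewrite setTI; apply: borel_open; exact: cf.
Qed.

Section lebesgue_rV.
Context {R : realType}.

Lemma open_bigcup_rat_ball d (U : set 'rV[R]_d) : open U ->
  U = \bigcup_(p in [set p : 'rV[rat]_d * nat |
        ball (map_mx ratr p.1 : 'rV[R]_d) (p.2.+1%:R^-1) `<=` U])
        ball (map_mx ratr p.1 : 'rV[R]_d) (p.2.+1%:R^-1).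
Proof.
move=> oU; apply/seteqP; split=> [x Ux|x [p pU px]]; last exact: pU.
have /nbhs_ballP[e /= e0 eU] : nbhs x U by exact: open_nbhs_nbhs.
pose k := Num.truncn (2 / e).
have kE : k.+1%:R^-1 < e / 2 :> R.
  rewrite invf_plt ?posrE ?divr_gt0//.
  by rewrite invf_div; exact: Num.Theory.truncnS_gt.
have k0 : 0 < k.+1%:R^-1 :> R by rewrite invr_gt0.
have H (i : 'I_d) : exists q : rat, `|x 0 i - ratr q| < k.+1%:R^-1.
  have [] := @dense_rat R (ball (x 0 i) k.+1%:R^-1).
  - by exists (x 0 i); exact: ballxx.
  - exact: ball_open.
  by move=> y [xy [q _ qy]]; exists q; rewrite qy.
pose c : 'rV[rat]_d := \row_i xchoose (H i).
have cx : ball (map_mx ratr c : 'rV[R]_d) k.+1%:R^-1 x.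
  split=> // i j; rewrite !mxE ord1 /ball /= distrC.
  exact: (xchooseP (H j)).
exists (c, k) => //= y cy; apply: eU.
rewrite [e]splitr; apply: (@ball_triangle _ _ (map_mx ratr c : 'rV[R]_d)).
  by apply: le_ball (ltW kE) _ _; apply: ball_sym.
exact: le_ball (ltW kE) _ cy.
Qed.

Definition row_cons d (p : R * 'rV[R]_d) : 'rV[R]_d.+1 :=
  row_mx (p.1%:M : 'rV[R]_1) p.2.

Lemma row_consE0 d (p : R * 'rV[R]_d) : row_cons p 0 (lshift d (ord0 : 'I_1)) = p.1.
Proof. by rewrite /row_cons (row_mxEl (p.1%:M : 'rV_1)) mxE eqxx. Qed.

Lemma row_consES d (p : R * 'rV[R]_d) i : row_cons p 0 (rshift 1 i) = p.2 0 i.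
Proof. by rewrite /row_cons (row_mxEr (p.1%:M : 'rV_1)). Qed.

Definition row_uncons d (x : 'rV[R]_d.+1) : R * 'rV[R]_d :=
  (lsubmx (x : 'rV_(1 + d)) 0 0, rsubmx (x : 'rV_(1 + d))).

Lemma row_consK d : cancel (@row_cons d) (@row_uncons d).
Proof.
by case=> t y; rewrite /row_uncons /row_cons row_mxKl row_mxKr mxE eqxx.
Qed.

Lemma row_unconsK d : cancel (@row_uncons d) (@row_cons d).
Proof.
move=> x; rewrite /row_uncons /row_cons /=.
by rewrite -mx11_scalar (@hsubmxK _ 1 1 d x).
Qed.

Lemma ball_row_cons d (p q : R * 'rV[R]_d) e :
  ball (row_cons p) e (row_cons q) <-> ball p.1 e q.1 /\ ball p.2 e q.2.
Proof.
split=> [[e0 H]|[H1 [e0 H2]]].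
  split; first by have := H 0 (lshift d (ord0 : 'I_1)); rewrite !row_consE0.
  by split=> // i j; have := H i (rshift 1 j); rewrite ord1 !row_consES.
split=> // i j; rewrite ord1 -(splitK (j : 'I_(1 + d))).
case: (fintype.split _) => k /=.
  by rewrite (ord1 k) !row_consE0.
by rewrite !row_consES.
Qed.

Lemma measurable_row_cons d : measurable_fun setT
  (@row_cons d : measurableTypeR R * borel 'rV[R]_d -> borel 'rV[R]_d.+1).
Proof.
apply: measurable_fun_to_borel => O oO; rewrite setTI.
rewrite (open_bigcup_rat_ball oO) preimage_bigcup bigcup_mkcond.
apply: countable_bigcupT_measurable; first exact: countableP.
move=> p; case: ifPn => // _.
set c := map_mx _ _; set e := _^-1.
rewrite [X in measurable X](_ : _ =
  ball (row_uncons c).1 e `*` (ball (row_uncons c).2 e : set (borel 'rV_d))).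
  apply: measurableX; first exact: measurable_ball.
  by apply: borel_open; apply: ball_open; rewrite invr_gt0.
apply/seteqP; split=> q /=.
  by rewrite -{1}[c]row_unconsK ball_row_cons.
by rewrite -{3}[c]row_unconsK ball_row_cons.
Qed.

Lemma measurable_row_uncons d : measurable_fun setT
  (@row_uncons d : borel 'rV[R]_d.+1 -> measurableTypeR R * borel 'rV[R]_d).
Proof.
apply/measurable_fun_pair => /=.
  apply: borel_continuous => x.
  rewrite (_ : (fun x0 : 'rV_d.+1 => _) = fun x : 'rV_d.+1 => x 0 (lshift d (ord0 : 'I_1))).
    exact: coord_continuous.
  by apply/funext=> y; rewrite mxE.
apply: borel_continuous_map; exact: (@continuous_rsubmx _ 1 1 d).
Qed.

Section lebesgue_step.
Context {d : nat} (mu : {sigma_finite_measure set (borel 'rV[R]_d) -> \bar R}).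

Let m1 : {sigma_finite_measure set (measurableTypeR R) -> \bar R} :=
  @lebesgue_measure R.
Let pm : {measure set (measurableTypeR R * borel 'rV[R]_d)%type -> \bar R} :=
  (m1 \x mu)%E.
Let m : {measure set (borel 'rV[R]_d.+1) -> \bar R} :=
  measure_function_pushforward__canonical__measure_function_Measure pm (@measurable_row_cons d).

Definition lebesgue_step : set (borel 'rV[R]_d.+1) -> \bar R := m.

HB.instance Definition _ := Measure.on lebesgue_step.

Lemma lebesgue_stepE (A : set (borel 'rV[R]_d.+1)) :
  lebesgue_step A = pm (@row_cons d @^-1` A).
Proof. by []. Qed.

Let lebesgue_step_sigma_finite : sigma_finite setT lebesgue_step.
Proof.
have /sigma_finiteP[F [TF ndF Foo]] := sigma_finiteT m1.
have /sigma_finiteP[G [TG ndG Goo]] := sigma_finiteT mu.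
have FT : [set: measurableTypeR R * borel 'rV[R]_d] =
    \bigcup_n (F n `*` G n).
  rewrite -setXTT TF TG predeqE => -[x y]; split.
    move=> [/= [n _ Fnx] [k _ Gky]]; exists (maxn n k) => //; split.
    - by move: x Fnx; exact/subsetPset/ndF/leq_maxl.
    - by move: y Gky; exact/subsetPset/ndG/leq_maxr.
  by move=> [n _ []/= ? ?]; split; exists n.
have mF n : measurable (F n `*` G n) /\ (pm (F n `*` G n) < +oo)%E.
  have [? ?] := Foo n; have [? ?] := Goo n; split; first exact: measurableX.
  by rewrite /pm/= product_measure1E// lte_mul_pinfty// ge0_fin_numE.
exists (fun n => @row_uncons d @^-1` (F n `*` G n)).
  by rewrite -preimage_bigcup -FT.
move=> n; have [mFn Fn] := mF n; split.
  by rewrite -[X in measurable X]setTI; exact: measurable_row_uncons.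
rewrite lebesgue_stepE; rewrite (_ : _ @^-1` _ = F n `*` G n)//.
by apply/seteqP; split => x; rewrite /preimage /mkset row_consK.
Qed.

HB.instance Definition _ := Measure_isSigmaFinite.Build _ _ _ lebesgue_step
  lebesgue_step_sigma_finite.

Lemma ge0_integral_lebesgue_step (f : borel 'rV[R]_d.+1 -> \bar R) :
  measurable_fun setT f -> (forall x, 0 <= f x)%E ->
  (\int[lebesgue_step]_x f x =
   \int[lebesgue_measure]_t \int[mu]_y f (@row_cons d (t, y)))%E.
Proof.
move=> mf f0.
rewrite (@ge0_integral_pushforward _ _ _ _ _ _ (@measurable_row_cons d) pm)//.
rewrite preimage_setT (@fubini_tonelli1 _ _ (measurableTypeR R) (borel 'rV[R]_d) _ _ _
  (f \o @row_cons d)) => // [|x]; last exact: f0.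
by apply: measurableT_comp => //; exact: measurable_row_cons.
Qed.

Lemma integral_lebesgue_step (f : borel 'rV[R]_d.+1 -> \bar R) :
  measurable_fun setT f ->
  pm.-integrable setT (f \o @row_cons d) ->
  (\int[lebesgue_step]_x f x = \int[pm]_x f (@row_cons d x))%E.
Proof.
move=> mf intf.
exact: (@integral_pushforward _ _ (measurableTypeR R * borel 'rV[R]_d)%type
  (borel 'rV[R]_d.+1) _ _ (@measurable_row_cons d) pm _ _ mf intf measurableT).
Qed.

End lebesgue_step.

Fixpoint lebesgue_rV d : {sigma_finite_measure set (borel 'rV[R]_d) -> \bar R} :=
  match d with
  | 0 => (\d_(0 : borel 'rV[R]_0))%R
  | d'.+1 => @lebesgue_step d' (lebesgue_rV d')
  end.

Lemma lebesgue_intE d (f : borel 'rV[R]_d -> \bar R) :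
  measurable_fun setT f -> (forall x, 0 <= f x)%E ->
  lebesgue_int f = (\int[lebesgue_rV d]_x f x)%E.
Proof.
elim: d f => [|d IH] f mf f0.
  by rewrite integral_dirac//= diracT mul1e.
rewrite [RHS]ge0_integral_lebesgue_step//=.
apply: eq_integral => t _; rewrite IH//.
apply: (@measurableT_comp _ _ _ (borel 'rV[R]_d) (borel 'rV[R]_d.+1)) => //.
exact: (measurableT_comp (@measurable_row_cons d)
  (@measurable_pair1 _ _ (measurableTypeR R) (borel 'rV[R]_d) t)).
Qed.

Lemma lebesgue_rV_ball d (x : 'rV[R]_d) e : 0 < e ->
  lebesgue_rV d (ball x e) = ((e *+ 2) ^+ d)%:E.
Proof.
move=> e0; elim: d x => [|d IH] x /=.
  rewrite diracE (_ : _ \in _)// inE; split=> //.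
  by move=> i; case.
rewrite lebesgue_stepE.
rewrite (_ : _ @^-1` _ = ball (row_uncons x).1 e `*` ball (row_uncons x).2 e).
  rewrite [LHS](@product_measure1E _ _ (measurableTypeR R) (borel 'rV[R]_d))//=.
  - by rewrite lebesgue_measure_ball ?ltW// IH exprS EFinM.
  - exact: measurable_ball.
  - by apply: borel_open; exact: ball_open.
by apply/seteqP; split=> p /=;
  have [h1 h2] := ball_row_cons (row_uncons x) p e; rewrite row_unconsK in h1 h2.
Qed.

End lebesgue_rV.

Section integral_density.
Local Open Scope ereal_scope.
Context d1 d2 (X : measurableType d1) (T : measurableType d2) (R : realType).
Variables (nu : {measure set X -> \bar R}) (mu : {measure set T -> \bar R}).
Variables (phi : X -> T) (rho : X -> R) (D : set T).
Hypotheses (mphi : measurable_fun setT phi) (mrho : measurable_fun setT rho).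
Hypotheses (rho0 : forall x, (0 <= rho x)%R) (mD : measurable D).
Hypothesis muE : forall B, measurable B -> B `<=` D ->
  mu B = \int[nu]_x ((rho x)%:E * (\1_B (phi x))%:E).

Import HBNNSimple.

Let mindic (B : set T) : measurable B ->
  measurable_fun setT (fun x => (\1_B (phi x))%:E : \bar R).
Proof.
move=> mB; apply/measurable_EFinP.
by apply: (measurableT_comp _ mphi); exact: measurable_indic.
Qed.

Let density_nnsfun (g : {nnsfun T >-> R}) :
  \int[mu]_(t in D) (g t)%:E =
  \int[nu]_x ((rho x)%:E * ((g (phi x))%:E * (\1_D (phi x))%:E)).
Proof.
have mg r : measurable (g @^-1` [set r] `&` D) by exact: measurableI.
transitivity (\sum_(k \in range g) k%:E * mu (g @^-1` [set k] `&` D)).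
  under eq_integral do rewrite fimfunE -fsumEFin//.
  rewrite ge0_integral_fsum//; last 2 first.
  - by move=> y; exact/measurable_EFinP/measurable_funM.
  - by move=> y x _; rewrite nnfun_muleindic_ge0.
  by apply: eq_fsbigr => r _; rewrite integralZl_indic_nnsfun// integral_indic//=.
have E k : k%:E * mu (g @^-1` [set k] `&` D) =
    \int[nu]_x (k%:E * ((rho x)%:E * (\1_(g @^-1` [set k] `&` D) (phi x))%:E)).
  have [k0|k0] := leP 0%R k.
    rewrite ge0_integralZl//.
    - by rewrite -muE//; exact: subIsetr.
    - by apply: emeasurable_funM; [exact/measurable_EFinP|exact: mindic].
    - by move=> x _; rewrite -EFinM lee_fin mulr_ge0.
  rewrite preimage_nnfun0// set0I measure0 mule0 integral0_eq// => x _.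
  by rewrite indicE in_set0 !mule0.
under eq_fsbigr do rewrite E.
rewrite -ge0_integral_fsum//; last 2 first.
- move=> k; apply: emeasurable_funM => //.
  by apply: emeasurable_funM; [exact/measurable_EFinP|exact: mindic].
- move=> k x _; have [k0|k0] := leP 0%R k.
    by rewrite -!EFinM lee_fin !mulr_ge0.
  by rewrite preimage_nnfun0// set0I indicE in_set0 !mule0.
apply: eq_integral => x _.
have [xD|xD] := boolP (phi x \in D); last first.
  rewrite !indicE (negbTE xD) !mule0 fsbig1// => k _.
  by rewrite indicE in_setI (negbTE xD) andbF !mule0.
rewrite indicE xD mule1 [g (phi x)]fimfunE -fsumEFin// ge0_mule_fsumr.
  apply: eq_fsbigr => k _.
  by rewrite !indicE in_setI xD andbT EFinM muleCA.
by move=> k; rewrite nnfun_muleindic_ge0.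
Qed.

Lemma ge0_integral_density (f : T -> \bar R) :
  measurable_fun setT f -> (forall t, 0 <= f t) ->
  \int[mu]_(t in D) f t =
  \int[nu]_x ((rho x)%:E * (f (phi x) * (\1_D (phi x))%:E)).
Proof.
move=> mf f0; pose g := nnsfun_approx measurableT mf.
transitivity (limn (fun n => \int[mu]_(x in D) (g n x)%:E)).
  rewrite -monotone_convergence//.
  - apply: eq_integral => y /[!inE] yD; apply/esym/cvg_lim => //.
    exact: cvg_nnsfun_approx.
  - by move=> n; exact/measurable_EFinP/measurable_funTS.
  - by move=> n y _; rewrite lee_fin.
  - by move=> y _ m n mn; rewrite lee_fin; exact/lefP/nd_nnsfun_approx.
under eq_fun do rewrite density_nnsfun.
rewrite -monotone_convergence//; last 3 first.
- move=> n; apply: emeasurable_funM; first exact/measurable_EFinP.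
  apply: emeasurable_funM; last exact: mindic.
  by apply/measurable_EFinP; exact: measurableT_comp.
- by move=> n x _; rewrite -!EFinM lee_fin !mulr_ge0.
- move=> x _ m n mn; rewrite -!EFinM lee_fin.
  apply: ler_wpM2l => //; apply: ler_wpM2r => //.
  exact/lefP/nd_nnsfun_approx.
apply: eq_integral => x _; apply/cvg_lim => //.
have gf := cvg_nnsfun_approx measurableT mf (fun t _ => f0 t) (I : setT (phi x)).
rewrite indicE; case: (_ \in _); last first.
  under eq_fun do rewrite !mule0.
  by rewrite !mule0; exact: cvg_cst.
rewrite mule1; under eq_fun do rewrite mule1.
exact: cvgeZl.
Qed.

End integral_density.

(** * Functions of class C^1 *)

Section line.
Context {R : realType} {V : normedModType R}.

Lemma is_derive_line (f : V -> R) (x v : V) (t : R) (l : R) :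
  is_derive (t *: v + x) v f l <->
  is_derive (t : R) 1 (fun s : R => f (s *: v + x)) l.
Proof.
have E : (fun h : R => h^-1 *: (f (h *: v + (t *: v + x)) - f (t *: v + x))) =
    (fun h : R => h^-1 *: (f ((h *: 1 + t) *: v + x) - f (t *: v + x))).
  by apply/funext => h; rewrite /= addrA -scalerDl [h *: 1]mulr1.
have E1 : derivable f (t *: v + x) v =
    derivable (fun s : R => f (s *: v + x)) t 1 by rewrite /derivable E.
have E2 : 'D_v f (t *: v + x) = 'D_1 (fun s : R => f (s *: v + x)) t.
  by rewrite /derive E.
by split=> -[h1 h2]; apply: DeriveDef; [rewrite -E1|rewrite -E2|rewrite E1|rewrite E2].
Qed.

Lemma is_derive_line0 (f : V -> R) (x v : V) (l : R) :
  is_derive x v f l <->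
  is_derive (0 : R) 1 (fun s : R => f (s *: v + x)) l.
Proof. by have := is_derive_line f x v 0 l; rewrite scale0r add0r. Qed.

Lemma is_derive_comp1 (f : V -> R) (g : R -> R) (x v : V) (df dg : R) :
  is_derive x v f df -> is_derive (f x) 1 g dg ->
  is_derive x v (g \o f) (dg * df).
Proof.
move=> /is_derive_line0 h1 h2; apply/is_derive_line0.
apply: (@is_derive1_comp _ g (fun s : R => f (s *: v + x))).
by rewrite scale0r add0r.
Qed.

Lemma MVT_line (f : V -> R) (x v : V) (a : R) :
  (forall t, `|t| <= `|a| -> derivable f (t *: v + x) v) ->
  exists2 c, `|c| <= `|a| & f (a *: v + x) - f x = 'D_v f (c *: v + x) * a.
Proof.
move=> df; pose phi s := f (s *: v + x).
have dphi t : `|t| <= `|a| -> is_derive (t : R) 1 phi ('D_v f (t *: v + x)).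
  by move=> ta; apply/is_derive_line; exact/derivableP/df.
have cphi t : `|t| <= `|a| -> {for t, continuous phi}.
  move=> ta; apply: differentiable_continuous; apply/derivable1_diffP.
  by have [] := dphi t ta.
have -> : f x = phi 0 by rewrite /phi scale0r add0r.
rewrite -[f (a *: v + x)]/(phi a).
have [a0|a0] := leP 0 a.
  have [| |c] := @MVT_segment R phi (fun t => 'D_v f (t *: v + x)) 0 a a0.
  - move=> t; rewrite in_itv/= => /andP[t0 ta]; apply: dphi.
    by rewrite !ger0_norm// ltW.
  - apply: continuous_in_subspaceT => t; rewrite inE/= in_itv/= => /andP[t0 ta].
    by apply: cphi; rewrite !ger0_norm.
  rewrite in_itv/= => /andP[c0 ca] ->; exists c; last by rewrite subr0.
  by rewrite !ger0_norm.
have [| |c] := @MVT_segment R phi (fun t => 'D_v f (t *: v + x)) a 0 (ltW a0).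
- move=> t; rewrite in_itv/= => /andP[t0 ta]; apply: dphi.
  by rewrite (ltr0_norm ta) (ltr0_norm a0) lerN2 ltW.
- apply: continuous_in_subspaceT => t; rewrite inE/= in_itv/= => /andP[t0 ta].
  by apply: cphi; rewrite (ler0_norm ta) (ltr0_norm a0) lerN2.
rewrite in_itv/= => /andP[c0 ca] E; exists c.
  by rewrite (ler0_norm ca) (ltr0_norm a0) lerN2.
by rewrite -opprB E sub0r mulrN opprK.
Qed.

End line.

Lemma near_eq_continuous {T U : topologicalType} (f g : T -> U) (x : T) :
  {near x, f =1 g} -> {for x, continuous f} -> {for x, continuous g}.
Proof.
move=> fg; rewrite /prop_for /continuous_at -(nbhs_singleton fg) => cf.
exact: cvg_trans (near_eq_cvg fg) cf.
Qed.

Lemma continuous_bigsum {R : realType} {T : topologicalType} (I : Type)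
    (r : seq I) (P : pred I) (f : I -> T -> R) (x : T) :
  (forall i, P i -> {for x, continuous (f i)}) ->
  {for x, continuous (fun y => \sum_(i <- r | P i) f i y)}.
Proof.
move=> cf; elim: r => [|i r IH].
  rewrite (_ : (fun y => _) = fun=> 0); first exact: cst_continuous.
  by apply/funext => y; rewrite big_nil.
case Pi : (P i); last first.
  rewrite (_ : (fun y => _) = fun y => \sum_(j <- r | P j) f j y)//.
  by apply/funext => y; rewrite big_cons Pi.
rewrite (_ : (fun y => _) = fun y => f i y + \sum_(j <- r | P j) f j y).
  by apply: continuousD IH; exact: cf.
by apply/funext => y; rewrite big_cons Pi.
Qed.

Section C1.
Context {R : realType} {d : nat}.
Implicit Types (f g : 'rV[R]_d -> R) (U : set 'rV[R]_d) (x : 'rV[R]_d).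
Local Notation e_ i := (delta_mx 0 i : 'rV[R]_d).

Definition C1 U f := forall x, U x ->
  [/\ {for x, continuous f}, forall i : 'I_d, derivable f x (e_ i) &
      forall i : 'I_d, {for x, continuous (partial i f)}].

Lemma C1P U f : C1 U f <-> forall x, U x ->
  [/\ {for x, continuous f}, forall i : 'I_d, derivable f x (e_ i) &
      forall i : 'I_d, {for x, continuous (partial i f)}].
Proof. by []. Qed.

Lemma C1_at U f x : C1 U f -> U x ->
  [/\ {for x, continuous f}, forall i : 'I_d, derivable f x (e_ i) &
      forall i : 'I_d, {for x, continuous (partial i f)}].
Proof. by move=> cf /cf. Qed.

Lemma C1_continuous U f x : C1 U f -> U x -> {for x, continuous f}.
Proof. by move=> cf /cf[]. Qed.

Lemma C1_derivable U f x i : C1 U f -> U x -> derivable f x (e_ i).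
Proof. by move=> cf /cf[]. Qed.

Lemma C1_partial_continuous U f x i :
  C1 U f -> U x -> {for x, continuous (partial i f)}.
Proof. by move=> cf /cf[]. Qed.

Lemma C1_is_derive U f x i : C1 U f -> U x -> is_derive x (e_ i) f (partial i f x).
Proof. by move=> cf Ux; apply: DeriveDef => //; exact: C1_derivable cf Ux. Qed.

Arguments C1_derivable {U f x} i.
Arguments C1_partial_continuous {U f x} i.
Arguments C1_is_derive {U f x} i.

Lemma Ck_C1 U f k : Ck k.+1 U f -> C1 U f.
Proof.
move=> [cf pf] x Ux; split; first exact: cf.
- by move=> i; have [+ _] := pf i; exact.
- by move=> i; have [_] := pf i; case: k {pf} => [|k] [+ _]; exact.
Qed.

Lemma Ck_partial_C1 U f k i : Ck k.+2 U f -> C1 U (partial i f).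
Proof. by move=> [_ /(_ i)[_]]; exact: Ck_C1. Qed.

Lemma smooth_C1 U f : smooth_on U f -> C1 U f.
Proof. by move=> /(_ 1%N); exact: Ck_C1. Qed.

Lemma smooth_partial_C1 U f i : smooth_on U f -> C1 U (partial i f).
Proof. by move=> /(_ 2%N); exact: Ck_partial_C1. Qed.

Lemma C1_of_is_derive U f (df : 'I_d -> 'rV[R]_d -> R) : open U ->
  (forall x, U x -> {for x, continuous f}) ->
  (forall i x, U x -> is_derive x (e_ i) f (df i x)) ->
  (forall i x, U x -> {for x, continuous (df i)}) -> C1 U f.
Proof.
move=> oU cf Df cdf x Ux; split; first exact: cf.
  by move=> i; have [] := Df i x Ux.
move=> i; have E : {near x, df i =1 partial i f}.
  apply: filterS (open_nbhs_nbhs (conj oU Ux)) => y Uy.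
  by have [_ <-] := Df i y Uy.
exact: near_eq_continuous E (cdf i x Ux).
Qed.

Lemma C1_eq U f g : open U -> (forall x, U x -> f x = g x) -> C1 U f -> C1 U g.
Proof.
move=> oU fg cf.
have nfg x : U x -> {near x, f =1 g}.
  by move=> Ux; apply: filterS (open_nbhs_nbhs (conj oU Ux)) => y /fg.
apply: (C1_of_is_derive (df := fun i => partial i f)) => //.
- by move=> x Ux; exact: near_eq_continuous (nfg x Ux) (C1_continuous cf Ux).
- move=> i x Ux; apply: (near_eq_is_derive (nfg x Ux)).
  exact: C1_is_derive _ cf Ux.
- by move=> i x Ux; exact: C1_partial_continuous _ cf Ux.
Qed.

Lemma partial_eq U f g x i : open U -> (forall x, U x -> f x = g x) -> U x ->
  partial i f x = partial i g x.
Proof.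
move=> oU fg Ux; apply: near_eq_derive.
by apply: filterS (open_nbhs_nbhs (conj oU Ux)) => y /fg.
Qed.

Lemma C1_cst U (a : R) : open U -> C1 U (fun=> a).
Proof.
move=> oU; apply: (C1_of_is_derive (df := fun i => fun=> 0)) => //.
- by move=> x Ux; exact: cst_continuous.
- by move=> i x Ux; exact: cst_continuous.
Qed.

Lemma C1D U f g : open U -> C1 U f -> C1 U g -> C1 U (fun x => f x + g x).
Proof.
move=> oU cf cg.
apply: (C1_of_is_derive (df := fun i x => partial i f x + partial i g x)) => //.
- by move=> x Ux; apply: continuousD; [exact: C1_continuous cf Ux|exact: C1_continuous cg Ux].
- move=> i x Ux.
  exact: (is_deriveD (C1_is_derive _ cf Ux) (C1_is_derive _ cg Ux)).
- move=> i x Ux; apply: continuousD; [exact: C1_partial_continuous _ cf Ux|exact: C1_partial_continuous _ cg Ux].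
Qed.

Lemma C1M U f g : open U -> C1 U f -> C1 U g -> C1 U (fun x => f x * g x).
Proof.
move=> oU cf cg.
apply: (C1_of_is_derive
    (df := fun i x => f x * partial i g x + g x * partial i f x)) => //.
- by move=> x Ux; exact: continuousM (C1_continuous cf Ux) (C1_continuous cg Ux).
- move=> i x Ux.
  exact: (is_deriveM (C1_is_derive _ cf Ux) (C1_is_derive _ cg Ux)).
- move=> i x Ux; apply: continuousD.
    exact: continuousM (C1_continuous cf Ux) (C1_partial_continuous _ cg Ux).
  exact: continuousM (C1_continuous cg Ux) (C1_partial_continuous _ cf Ux).
Qed.

Lemma C1_comp1 U f (g : R -> R) : open U -> C1 U f ->
  (forall x, U x -> derivable g (f x) 1) ->
  (forall x, U x -> {for f x, continuous (derive1 g)}) ->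
  C1 U (fun x => g (f x)).
Proof.
move=> oU cf dg cg.
apply: (C1_of_is_derive (df := fun i x => derive1 g (f x) * partial i f x)) => //.
- move=> x Ux; apply: continuous_comp; first exact: C1_continuous cf Ux.
  by apply: differentiable_continuous; apply/derivable1_diffP; exact: dg.
- move=> i x Ux; apply: is_derive_comp1; first exact: C1_is_derive _ cf Ux.
  by rewrite derive1E; apply/derivableP; exact: dg.
- move=> i x Ux; apply: continuousM; last exact: C1_partial_continuous _ cf Ux.
  by apply: continuous_comp; [exact: C1_continuous cf Ux|exact: cg].
Qed.

Lemma C1N U f : open U -> C1 U f -> C1 U (fun x => - f x).
Proof.
move=> oU cf; apply: (C1_eq oU (f := fun x => (-1) * f x)).
  by move=> x _; rewrite mulN1r.
exact: (C1M oU (C1_cst _ oU) cf).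
Qed.

Lemma C1V U f : open U -> (forall x, U x -> f x != 0) -> C1 U f ->
  C1 U (fun x => (f x)^-1).
Proof.
move=> oU f0 cf.
apply: (C1_of_is_derive (df := fun i x => - (f x ^- 2) * partial i f x)) => //.
- by move=> x Ux; apply: continuousV; [exact: f0|exact: C1_continuous cf Ux].
- move=> i x Ux; have h := C1_derivable _ cf Ux; apply: DeriveDef.
    by apply: derivableV => //; exact: f0.
  by rewrite deriveV//; exact: f0.
- move=> i x Ux; apply: continuousM; last exact: C1_partial_continuous _ cf Ux.
  apply: continuousN; apply: continuousV; first by rewrite expf_neq0// f0.
  exact: continuous_comp (C1_continuous cf Ux) (@exprn_continuous _ _ _).
Qed.

Lemma C1_sum (I : Type) (r : seq I) (P : pred I) U (f : I -> 'rV[R]_d -> R) :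
  open U -> (forall i, P i -> C1 U (f i)) -> C1 U (fun x => \sum_(i <- r | P i) f i x).
Proof.
move=> oU cf; elim: r => [|i r IH].
  by apply: C1_eq oU _ (C1_cst 0 oU) => x _; rewrite big_nil.
case Pi : (P i); last first.
  by apply: C1_eq oU _ IH => x _; rewrite big_cons Pi.
apply: C1_eq oU _ (C1D oU (cf i Pi) IH) => x _.
by rewrite big_cons Pi.
Qed.

Lemma C1_prod (I : Type) (r : seq I) (P : pred I) U (f : I -> 'rV[R]_d -> R) :
  open U -> (forall i, P i -> C1 U (f i)) -> C1 U (fun x => \prod_(i <- r | P i) f i x).
Proof.
move=> oU cf; elim: r => [|i r IH].
  by apply: C1_eq oU _ (C1_cst 1 oU) => x _; rewrite big_nil.
case Pi : (P i); last first.
  by apply: C1_eq oU _ IH => x _; rewrite big_cons Pi.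
apply: C1_eq oU _ (C1M oU (cf i Pi) IH) => x _.
by rewrite big_cons Pi.
Qed.

Lemma is_derive_coord x (i j : 'I_d) :
  is_derive x (e_ i) (fun y : 'rV[R]_d => y 0 j) (i == j)%:R.
Proof.
apply/is_derive_line0.
rewrite (_ : (fun s : R => _) = (fun s : R => s * (i == j)%:R + x 0 j)).
  by apply: is_derive_eq; rewrite addr0 scaler0 add0r [_ *: 1]mulr1.
by apply/funext => s; rewrite !mxE eqxx/= eq_sym.
Qed.

Lemma C1_coord U (j : 'I_d) : open U -> C1 U (fun y : 'rV[R]_d => y 0 j).
Proof.
move=> oU; apply: (C1_of_is_derive (df := fun i => fun=> (i == j)%:R)) => //.
- by move=> x Ux; exact: coord_continuous.
- by move=> i x _; exact: is_derive_coord.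
- by move=> i x Ux; exact: cst_continuous.
Qed.

Let trunc (h : 'rV[R]_d) k : 'rV[R]_d := \row_j (if (j < k)%N then h 0 j else 0).

Let truncS h (k : 'I_d) : trunc h k.+1 = h 0 k *: e_ k + trunc h k.
Proof.
apply/rowP => j; rewrite !mxE eqxx/= ltnS leq_eqVlt.
have [->|jk] := eqVneq j k; first by rewrite eqxx ltnn mulr1 addr0.
by rewrite -val_eqE/= in jk; rewrite (negbTE jk) mulr0 add0r.
Qed.

Let gradlin f x (h : 'rV[R]_d) : R^o := \sum_i h 0 i * partial i f x.

Let gradlin_linear f x : linear (gradlin f x).
Proof.
move=> a u v; rewrite /gradlin scaler_sumr -big_split/=.
by apply: eq_bigr => i _; rewrite !mxE mulrDl -mulrA.
Qed.

HB.instance Definition _ f x := GRing.isLinear.Build R 'rV[R]_d R^o _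
  (gradlin f x) (gradlin_linear f x).

Let gradlin_continuous f x : continuous (gradlin f x).
Proof.
move=> h; apply: continuous_bigsum => i _.
apply: continuousM; [exact: coord_continuous|exact: cst_continuous].
Qed.

Lemma C1_diff_expansion U f x : open U -> C1 U f -> U x ->
  forall e, 0 < e -> \forall h \near (0 : 'rV[R]_d),
    `|f (h + x) - (f x + gradlin f x h)| <= e * `|h|.
Proof.
move=> oU cf Ux e e0.
pose e' := e / d.+1%:R; have e'0 : 0 < e' by rewrite divr_gt0.
have /nbhs_ballP[r /= r0 rU] : nbhs x (fun y => U y /\
    forall i : 'I_d, `|partial i f x - partial i f y| <= e').
  apply: filterI; first exact: open_nbhs_nbhs.
  apply: (@filter_forall _ _
    (fun (i : 'I_d) y => `|partial i f x - partial i f y| <= e') (nbhs x) _) => i.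
  have /cvgrPdist_le := C1_partial_continuous i cf Ux.
  by move=> /(_ _ e'0).
near=> h => /=.
have hr : `|h| < r.
  near: h; apply/nbhs_ballP; exists r => // y.
  by rewrite -ball_normE/= sub0r normrN.
have hi i : `|h 0 i| <= `|h|.
  by rewrite [leRHS]/Num.Def.normr/= mx_normrE; exact: (le_bigmax _ _ (0, i)).
have tr k : ball x r (trunc h k + x).
  rewrite -ball_normE/= opprD addrCA subrr addr0 normrN.
  apply: le_lt_trans hr; rewrite [leLHS]/Num.Def.normr/= mx_normrE.
  apply: bigmax_le => // -[a j] _ /=; rewrite (ord1 a) !mxE.
  by case: ifPn => // _; rewrite normr0.
have tele : f (h + x) - f x =
    \sum_(k < d) (f (trunc h k.+1 + x) - f (trunc h k + x)).
  rewrite -(big_mkord xpredT (fun k => f (trunc h k.+1 + x) - f (trunc h k + x))).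
  rewrite telescope_sumr//; congr (f (_ + x) - f _).
    by apply/rowP => j; rewrite mxE ltn_ord.
  by apply/rowP => j; rewrite !mxE add0r.
rewrite [X in `|X|](_ : _ = \sum_(k < d)
   (f (trunc h k.+1 + x) - f (trunc h k + x) - h 0 k * partial k f x)); last first.
  by rewrite sumrB -tele opprD addrA.
have step (k : 'I_d) :
    `|f (trunc h k.+1 + x) - f (trunc h k + x) - h 0 k * partial k f x| <= e' * `|h|.
  have inb t : `|t| <= `|h 0 k| -> ball x r (t *: e_ k + (trunc h k + x)).
    move=> th; rewrite -ball_normE/= addrA opprD addrCA subrr addr0 normrN.
    apply: le_lt_trans hr; rewrite [leLHS]/Num.Def.normr/= mx_normrE.
    apply: bigmax_le => // -[a j] _ /=; rewrite (ord1 a) !mxE eqxx/=.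
    have [->|jk] := eqVneq j k.
      by rewrite ltnn addr0 mulr1 (le_trans th).
    by rewrite mulr0 add0r; case: ifPn => // _; rewrite normr0.
  have [|c ch E] := @MVT_line R _ f (trunc h k + x) (e_ k) (h 0 k).
    by move=> t th; apply: (C1_derivable _ cf); have [] := rU _ (inb t th).
  rewrite truncS -[h 0 k *: _ + _ + x]addrA E [X in `|_ - X|]mulrC -mulrBl normrM.
  apply: ler_pM => //.
  by have [_ /(_ k)] := rU _ (inb c ch); rewrite distrC.
apply: (le_trans (ler_norm_sum _ _ _)).
apply: (@le_trans _ _ (\sum_(k < d) e' * `|h|)).
  by apply: ler_sum => k _; exact: step.
rewrite sumr_const card_ord -mulrnAl ler_wpM2r//.
rewrite -mulr_natr /e' -mulrA -[leRHS]mulr1 ler_pM2l// mulrC.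
by rewrite ler_pdivrMr// mul1r ler_nat.
Unshelve. all: by end_near. Qed.

Lemma C1_differentiable U f x : open U -> C1 U f -> U x -> differentiable f x.
Proof.
move=> oU cf Ux.
have E : 'd f x = gradlin f x :> (_ -> _).
  apply: diff_unique; first exact: gradlin_continuous.
  exact/eqaddoP/(C1_diff_expansion oU cf Ux).
apply/diff_locallyP; rewrite E; split; first exact: gradlin_continuous.
exact/eqaddoP/(C1_diff_expansion oU cf Ux).
Qed.

Lemma C1_deriveE U f x v : open U -> C1 U f -> U x ->
  'D_v f x = \sum_i v 0 i * partial i f x.
Proof.
move=> oU cf Ux; rewrite deriveE; last exact: C1_differentiable cf Ux.
rewrite (_ : 'd f x = gradlin f x :> (_ -> _))//.
apply: diff_unique; first exact: gradlin_continuous.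
exact/eqaddoP/(C1_diff_expansion oU cf Ux).
Qed.

End C1.

Section C1_comp.
Context {R : realType} {d e : nat}.
Variables (U : set 'rV[R]_d) (W : set 'rV[R]_e) (T : 'rV[R]_d -> 'rV[R]_e).
Hypotheses (oU : open U) (oW : open W).
Hypothesis cT : forall a : 'I_e, C1 U (fun x => T x 0 a).

Lemma C1_rV_differentiable x : U x -> differentiable T x.
Proof.
move=> Ux; rewrite (_ : T =
    \sum_(a < e) (fun y => T y 0 a *: (delta_mx 0 a : 'rV[R]_e))); last first.
  by apply/funext => y; rewrite fct_sumE [LHS]row_sum_delta.
apply: differentiable_sum => a; apply: differentiableZl.
exact: C1_differentiable oU (cT a) Ux.
Qed.

Lemma C1_rV_continuous x : U x -> {for x, continuous T}.
Proof. by move=> Ux; apply: differentiable_continuous; exact: C1_rV_differentiable. Qed.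

Lemma C1_jacobianE x i a : U x -> 'J T x i a = partial i (fun y => T y 0 a) x.
Proof.
move=> Ux; have dT := C1_rV_differentiable Ux.
have <- : ((delta_mx 0 i : 'rV[R]_d) *m 'J T x) 0 a = 'J T x i a.
  by rewrite -rowE mxE.
rewrite -deriveEjacobian// derive_mx ?mxE//.
exact: diff_derivable.
Qed.

Lemma partial_comp (f : 'rV[R]_e -> R) x (i : 'I_d) : C1 W f -> U x -> W (T x) ->
  partial i (f \o T) x = \sum_a 'J T x i a * partial a f (T x).
Proof.
move=> cf Ux WTx; have dT := C1_rV_differentiable Ux.
have df := C1_differentiable oW cf WTx.
rewrite /partial deriveE; last exact: differentiable_comp.
rewrite diff_comp//= -deriveE//.
rewrite (C1_deriveE _ oW cf WTx); apply: eq_bigr => a _; congr (_ * _).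
rewrite -deriveE// deriveEjacobian//.
by rewrite -rowE mxE.
Qed.

Lemma C1_comp (f : 'rV[R]_e -> R) : C1 W f -> (forall x, U x -> W (T x)) ->
  C1 U (f \o T).
Proof.
move=> cf TW.
apply: (C1_of_is_derive (df := fun i x =>
   \sum_a partial i (fun y => T y 0 a) x * partial a f (T x))) => //.
- move=> x Ux; apply: continuous_comp; first exact: C1_rV_continuous.
  by apply: (C1_continuous cf); exact: TW.
- move=> i x Ux; have dT := C1_rV_differentiable Ux.
  have df := C1_differentiable oW cf (TW x Ux).
  have -> : \sum_a partial i (fun y => T y 0 a) x * partial a f (T x) =
      partial i (f \o T) x.
    rewrite (partial_comp _ cf)//; last exact: TW.
    by apply: eq_bigr => a _; rewrite C1_jacobianE.
  by apply: DeriveDef => //; apply: diff_derivable; exact: differentiable_comp.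
- move=> i x Ux; apply: continuous_bigsum => a _; apply: continuousM.
    by have [_ _] := cT a Ux; exact.
  apply: (@continuous_comp _ _ _ T (partial a f)); first exact: C1_rV_continuous.
  by have [_ _] := cf _ (TW x Ux); exact.
Qed.

End C1_comp.

Section C1_sqrt.
Context {R : realType} {d : nat}.

Lemma C1_sqrt (U : set 'rV[R]_d) (f : 'rV[R]_d -> R) : open U ->
  (forall x, U x -> 0 < f x) -> C1 U f -> C1 U (fun x => Num.sqrt (f x)).
Proof.
move=> oU f0 cf; apply: C1_comp1 => //.
  by move=> x Ux; have [] := is_derive1_sqrt (f0 x Ux).
move=> x Ux; have fx0 := f0 x Ux.
apply: (@near_eq_continuous _ _ (fun y : R => (2 * Num.sqrt y)^-1)).
  near=> y; rewrite derive1E.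
  have y0 : 0 < y by near: y; exact: (open_nbhs_nbhs (conj (@open_gt _ 0) fx0)).
  by have [_ ->] := is_derive1_sqrt y0.
apply: continuousV; first by rewrite mulf_neq0// sqrtr_eq0 -ltNge.
by apply: continuousM; [exact: cst_continuous|exact: sqrt_continuous].
Unshelve. all: by end_near. Qed.

Lemma partial_sqrt (f : 'rV[R]_d -> R) x (i : 'I_d) :
  derivable f x (delta_mx 0 i : 'rV[R]_d) -> 0 < f x ->
  partial i (fun y => Num.sqrt (f y)) x = partial i f x / (2 * Num.sqrt (f x)).
Proof.
move=> df f0.
have := is_derive_comp1 (derivableP df) (is_derive1_sqrt f0).
by rewrite mulrC => -[_ <-].
Qed.

End C1_sqrt.

(* Otherwise [done] unfolds [C1] and tries the costly continuity hints. *)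
Global Opaque C1.

(** * Integrals of partial derivatives *)

Section integral_partial.
Context {R : realType}.

Section fubini_rV.
Local Open Scope ereal_scope.
Context {d : nat} (f : borel 'rV[R]_d.+1 -> \bar R).
Hypothesis intf : (@lebesgue_rV R d.+1).-integrable setT f.

Let m1 : {sigma_finite_measure set (measurableTypeR R) -> \bar R} :=
  @lebesgue_measure R.
Let m2 : {sigma_finite_measure set (borel 'rV[R]_d) -> \bar R} := lebesgue_rV d.

Let mf : measurable_fun setT f.
Proof. by case/integrableP : intf. Qed.

Let mfc : measurable_fun setT
  (f \o @row_cons R d : measurableTypeR R * borel 'rV[R]_d -> \bar R).
Proof. by apply: measurableT_comp => //; exact: measurable_row_cons. Qed.

Let intfc : (m1 \x m2).-integrable setT
  (f \o @row_cons R d : measurableTypeR R * borel 'rV[R]_d -> \bar R).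
Proof.
apply/(integrable12ltyP m1 m2) => //.
case/integrableP : intf => _.
rewrite ge0_integral_lebesgue_step//.
exact: measurableT_comp.
Qed.

Lemma integral_lebesgue_rVS :
  \int[lebesgue_rV d.+1]_x f x =
  \int[lebesgue_measure]_t \int[lebesgue_rV d]_y f (row_cons (t, y)).
Proof.
rewrite [LHS]integral_lebesgue_step//.
exact: (esym (integral12_prod_meas1 (m1 := m1) (m2 := m2) intfc)).
Qed.

Lemma integral_lebesgue_rVS_swap :
  \int[lebesgue_rV d.+1]_x f x =
  \int[lebesgue_rV d]_y \int[lebesgue_measure]_t f (row_cons (t, y)).
Proof.
rewrite [LHS]integral_lebesgue_step//.
exact: (esym (integral21_prod_meas1 (m1 := m1) (m2 := m2) intfc)).
Qed.

End fubini_rV.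

Lemma vanish_bounded d (f : 'rV[R]_d -> R) (M : R) : continuous f ->
  (forall x, M <= `|x| -> f x = 0) -> exists C, forall x, `|f x| <= C.
Proof.
move=> cf f0; pose A := [set x : 'rV[R]_d | `|x| <= `|M|].
have cA : compact A.
  apply: bounded_closed_compact.
    exists `|M|; split; first exact: num_real.
    by move=> N MN x /= xM; exact: le_trans xM (ltW MN).
  apply: (@closed_comp _ _ (fun x : 'rV[R]_d => `|x|) [set r : R | r <= `|M|]).
    by move=> x _; exact: norm_continuous.
  exact: closed_le.
have A0 : A !=set0 by exists 0; rewrite /A /= normr0.
have [|c _ H] := @EVT_max_rV R d (fun x => `|f x|) A A0 cA.
  apply: continuous_subspaceT => x.
  by apply: (@continuous_comp _ _ _ f (fun y : R => `|y|)) (cf x) _; exact: norm_continuous.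
exists `|f c| => x; have [xM|Mx] := leP `|x| `|M|; first by apply: H; rewrite inE.
by rewrite f0 ?normr0// (le_trans (ler_norm M))// ltW.
Qed.

Lemma vanish_integrable d (f : 'rV[R]_d -> R) (M : R) : continuous f ->
  (forall x, M <= `|x| -> f x = 0) ->
  (lebesgue_rV d).-integrable setT (EFin \o f).
Proof.
move=> cf f0; have [C fC] := vanish_bounded cf f0.
pose B := ball (0 : 'rV[R]_d) (`|M| + 1).
have mB : measurable (B : set (borel 'rV[R]_d)).
  by apply: borel_open; apply: ball_open; exact: ltr_wpDl.
have mf : measurable_fun setT (f : borel 'rV[R]_d -> R) by exact: borel_continuous.
have : (lebesgue_rV d).-integrable (B : set (borel 'rV[R]_d)) (EFin \o f).
  apply: measurable_bounded_integrable => //.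
  - have := ltry (((`|M| + 1) *+ 2) ^+ d).
    by rewrite -(lebesgue_rV_ball (0 : 'rV[R]_d) (ltr_wpDl (normr_ge0 M) ltr01)).
  - exact: measurable_funTS.
  - exists C; split; first exact: num_real.
    by move=> N CN x /= _; exact: le_trans (fC x) (ltW CN).
move/(integrable_mkcond _ mB); congr (_.-integrable _ _).
apply/funext => x; rewrite patchE; case: ifPn => // xB.
rewrite /= f0//; case: (leP M `|x|) => // xM; move/negP: xB; case.
rewrite inE /B -ball_normE/= sub0r normrN.
by rewrite (lt_le_trans xM)// (le_trans (ler_norm M))// lerDl.
Qed.

Lemma integral_derive_eq0 (f : R -> R) (M : R) :
  (forall x, derivable f x 1) -> continuous (derive1 f) ->
  (forall x, M <= `|x| -> f x = 0) ->
  (\int[lebesgue_measure]_x (derive1 f x)%:E = 0)%E.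
Proof.
move=> df cdf f0; pose N := `|M| + 1.
have N0 : 0 < N by exact: ltr_wpDl.
have MN : M < N by rewrite (le_lt_trans (ler_norm M))// ltrDl.
have d0 x : N <= `|x| -> derive1 f x = 0.
  move=> Nx; rewrite derive1E -(@derive_cst R R R 0 x 1).
  apply: near_eq_derive; near=> y; rewrite f0//.
  have : `|x - y| < 1 by near: y; exact: (@cvgr_dist_lt _ R^o _ (nbhs x) _ id x (@cvg_id _ _) 1).
  move=> xy; have := ler_normD (x - y) y; rewrite subrK => h.
  rewrite (le_trans (ler_norm M))// -(lerD2l 1) addrC (le_trans Nx)//.
  by rewrite (le_trans h)// lerD2r ltW.
rewrite (_ : (fun x => _) = (EFin \o derive1 f) \_ `[-N, N]).
  rewrite -integral_mkcond.
  have NN : - N < N by rewrite gtrN.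
  have cf : continuous f.
    by move=> x; apply: differentiable_continuous; apply/derivable1_diffP.
  have dfN : derivable_oo_LRcontinuous f (- N) N.
    split.
    + by move=> x _; exact: df.
    + by apply: cvg_at_right_filter; exact: cf.
    + by apply: cvg_at_left_filter; exact: cf.
  apply: (etrans (continuous_FTC2 NN (continuous_subspaceT cdf) dfN _)) => //.
  by rewrite !f0 ?subee// ?normrN ger0_norm ?ltW.
apply/funext => x; rewrite patchE; case: ifPn => //.
rewrite notin_setE/= in_itv/= => /negP; rewrite -ler_norml -ltNge => xN.
by rewrite d0// ltW.
Unshelve. all: by end_near. Qed.

Lemma shift_row_consS d (h t : R) y (k : 'I_d) :
  h *: delta_mx 0 (rshift 1 k : 'I_d.+1) + row_cons (t, y) =
  row_cons (t, h *: delta_mx 0 k + y) :> 'rV[R]_d.+1.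
Proof.
apply/rowP => j; rewrite mxE -(splitK (j : 'I_(1 + d))).
case: (fintype.split _) => l /=.
  by rewrite (ord1 l) !row_consE0 !mxE /= mulr0 add0r.
have E : (rshift 1 l == rshift 1 k :> 'I_d.+1) = (l == k) 
  by apply/idP/idP => [/eqP/(congr1 val)/= /addnI/val_inj ->|/eqP ->].
by rewrite !row_consES !mxE E.
Qed.

Lemma shift_row_cons0 d (h t : R) (y : 'rV[R]_d) :
  h *: delta_mx 0 (lshift d (ord0 : 'I_1) : 'I_d.+1) + row_cons (t, y) =
  row_cons (h *: 1 + t, y) :> 'rV[R]_d.+1.
Proof.
apply/rowP => j; rewrite mxE -(splitK (j : 'I_(1 + d))).
case: (fintype.split _) => l /=.
  by rewrite (ord1 l) !row_consE0 !mxE /= mulr1 [_%:A]mulr1.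
have E : (rshift 1 l == lshift d (ord0 : 'I_1) :> 'I_d.+1) = false.
  by apply/negP => /eqP/(congr1 val).
by rewrite !row_consES !mxE E mulr0 add0r.
Qed.

Lemma partial_row_consS d (f : 'rV[R]_d.+1 -> R) t y (k : 'I_d) :
  partial (rshift 1 k : 'I_d.+1) f (row_cons (t, y)) =
  partial k (fun z => f (row_cons (t, z))) y.
Proof.
rewrite /partial /derive; set a := (fun h => _); set b := (fun h => _).
suff -> : a = b by [].
by apply/funext => h; rewrite /a/= shift_row_consS.
Qed.

Lemma partial_row_cons0 d (f : 'rV[R]_d.+1 -> R) t y :
  partial (lshift d (ord0 : 'I_1) : 'I_d.+1) f (row_cons (t, y)) =
  derive1 (fun s => f (row_cons (s, y))) t.
Proof.
rewrite derive1E /partial /derive; set a := (fun h => _); set b := (fun h => _).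
suff -> : a = b by [].
by apply/funext => h; rewrite /a/= shift_row_cons0.
Qed.

Lemma C1_row_cons d (f : 'rV[R]_d.+1 -> R) t : C1 setT f ->
  C1 setT (fun y => f (row_cons (t, y))).
Proof.
move=> cf; apply: (@C1_comp R d d.+1 setT setT (fun y => row_cons (t, y))) => //.
- exact: openT.
- exact: openT.
move=> a; rewrite -(splitK (a : 'I_(1 + d))).
case: (fintype.split _) => l /=.
  rewrite (_ : (fun y => _) = fun=> t); first exact/C1_cst/openT.
  by apply/funext => y; rewrite (ord1 l) (row_consE0 (t, y)).
rewrite (_ : (fun y => _) = fun y : 'rV_d => y 0 l); first exact/C1_coord/openT.
by apply/funext => y; rewrite (row_consES (t, y)).
Qed.

Lemma norm_row_cons d (t : R) (y : 'rV[R]_d) :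
  `|t| <= `|row_cons (t, y)| /\ `|y| <= `|row_cons (t, y)|.
Proof.
have H (x : 'rV[R]_d.+1) j : `|x 0 j| <= `|x|.
  by rewrite [leRHS]/Num.Def.normr/= mx_normrE; exact: (le_bigmax _ _ (0, j)).
split; first by have := H (row_cons (t, y)) (lshift d (ord0 : 'I_1)); rewrite row_consE0.
rewrite [leLHS]/Num.Def.normr/= mx_normrE; apply: bigmax_le => // -[a j] _ /=.
by have := H (row_cons (t, y)) (rshift 1 j); rewrite (ord1 a) row_consES.
Qed.

Lemma vanish_partial d (f : 'rV[R]_d -> R) (M : R) (i : 'I_d) :
  (forall x, M <= `|x| -> f x = 0) ->
  forall x, M + 1 <= `|x| -> partial i f x = 0.
Proof.
move=> f0 x Mx; rewrite /partial -(@derive_cst R 'rV[R]_d R 0 x (delta_mx 0 i)).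
apply: near_eq_derive; apply/nbhs_ballP; exists 1 => //= y.
rewrite -ball_normE/= => xy; rewrite f0//.
have := ler_normD (x - y) y; rewrite subrK => h.
by rewrite -(lerD2l 1) addrC (le_trans Mx)// (le_trans h)// lerD2r ltW.
Qed.

Lemma integral_partial_eq0 d (f : 'rV[R]_d -> R) (M : R) (i : 'I_d) :
  C1 setT f -> (forall x, M <= `|x| -> f x = 0) ->
  (\int[lebesgue_rV d]_x (partial i f x)%:E = 0)%E.
Proof.
elim: d f i => [|d IH] f i cf f0; first by case: i.
have cp : continuous (partial i f).
  by move=> x; have [_ _] := C1_at cf (I : setT x); exact.
have intp := vanish_integrable cp (vanish_partial i f0).
case: (fintype.splitP (i : 'I_(1 + d))) => k ik.
  have -> : i = lshift d (ord0 : 'I_1) by apply/val_inj; rewrite /= ik (ord1 k).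
  rewrite integral_lebesgue_rVS_swap; last first.
    by rewrite (_ : lshift d (ord0 : 'I_1) = i)//; apply/val_inj; rewrite /= ik (ord1 k).
  apply: integral0_eq => y _; under eq_integral do rewrite partial_row_cons0.
  apply: (integral_derive_eq0 (M := M)).
  - move=> t; have [_ /(_ (lshift d (ord0 : 'I_1))) + _] := C1_at cf (I : setT (row_cons (t, y))).
    rewrite /derivable; set a := (fun h => _); set b := (fun h => _).
    suff -> : a = b by [].
    by apply/funext => h; rewrite /a/= shift_row_cons0.
  - rewrite (_ : derive1 _ = partial (lshift d (ord0 : 'I_1) : 'I_d.+1) f \o (fun s => row_cons (s, y))).
      move=> t; apply: continuous_comp.
        move=> A /nbhs_ballP[e /= e0 eA]; apply/nbhs_ballP; exists e => // s ts.
        by apply: eA; apply/ball_row_cons; split => //; exact: ballxx.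
      by have [_ _] := C1_at cf (I : setT (row_cons (t, y))); exact.
    by apply/funext => t /=; rewrite partial_row_cons0.
  - by move=> t Mt; apply: f0; exact: le_trans Mt (norm_row_cons t y).1.
have {ik}ik : i = rshift 1 k by apply/val_inj; rewrite /= ik.
rewrite integral_lebesgue_rVS//; apply: integral0_eq => t _.
rewrite ik; under eq_integral do rewrite partial_row_consS.
apply: IH; first exact: C1_row_cons.
by move=> y My; apply: f0; exact: le_trans My (norm_row_cons t y).2.
Qed.

End integral_partial.

(** * Determinants and inverses of matrix-valued functions *)

Section matrix_facts.
Context {R : realType}.

Lemma det_1_add_col_row d (c : 'cV[R]_d) (r : 'rV[R]_d) :
  \det (1%:M + c *m r) = 1 + (r *m c) 0 0.
Proof.
have E1 : (block_mx 1%:M 0 c 1%:M) *m (block_mx 1%:M (- r) 0 (1%:M + c *m r)) =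
    block_mx (1%:M : 'M[R]_1) (- r) c (1%:M).
  rewrite mulmx_block !mulmx0 !mul0mx !mul1mx !mulmx1 !addr0.
  by rewrite mulmxN addrC addrK.
have E2 : (block_mx (1%:M + r *m c) (- r) 0 (1%:M)) *m (block_mx 1%:M 0 c (1%:M)) =
    block_mx (1%:M : 'M[R]_1) (- r) c (1%:M).
  rewrite mulmx_block !mulmx0 !mul0mx !mul1mx !mulmx1 !add0r.
  by rewrite mulNmx addrK.
have := congr1 determinant (etrans E1 (esym E2)).
rewrite !det_mulmx !det_lblock !det_ublock !det1 !mul1r !mulr1 => ->.
by rewrite det_mx11 !mxE.
Qed.

Definition posdef d (H : 'M[R]_d) : Prop :=
  H^T = H /\ forall X : 'rV[R]_d, X != 0 -> 0 < inner H X X.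

Lemma posdef_unit d (H : 'M[R]_d) : posdef H -> H \in unitmx.
Proof.
move=> [_ H0]; rewrite -row_free_unit -kermx_eq0; apply/eqP/row_matrixP => i.
apply/eqP; rewrite row0; apply/negPn/negP => /H0.
by rewrite /inner -row_mul mulmx_ker row0 mul0mx mxE ltxx.
Qed.

Lemma posdef_det_gt0 d (H : 'M[R]_d) : posdef H -> 0 < \det H.
Proof.
move=> pH.
have pt (t : R) : 0 <= t <= 1 -> \det (t *: H + (1 - t)%:M) != 0.
  move=> /andP[t0 t1]; rewrite -unitfE -unitmxE; apply: posdef_unit.
  have [HT H0] := pH; split; first by rewrite linearD linearZ /= tr_scalar_mx HT.
  move=> X X0; rewrite /inner mulmxDr mulmxDl -scalemxAr -scalemxAl.
  rewrite mul_mx_scalar -scalemxAl !mxE.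
  have XX : 0 < \sum_j X 0 j * X^T j 0.
    have [j Xj] : exists j, X 0 j != 0.
      apply/existsP; apply: contraNT X0; rewrite negb_exists => /forallP X0.
      by apply/eqP/rowP => j; rewrite mxE; apply/eqP; rewrite -[_ == _]negbK.
    rewrite (bigD1 j)//= mxE ltr_pwDl//.
      by rewrite -expr2 exprn_even_gt0//= orbT.
    by apply: sumr_ge0 => k _; rewrite mxE -expr2 sqr_ge0.
  have := H0 X X0; rewrite /inner mxE.
  set a := \sum_(_ < _) _; set b := \sum_(_ < _) _ in XX * => a0.
  have [->|t'] := eqVneq t 0; first by rewrite mul0r add0r subr0 mul1r.
  have tp : 0 < t by rewrite lt_def t'.
  by rewrite ltr_pwDl ?mulr_gt0// mulr_ge0 ?subr_ge0// ltW.
pose P := 'X *: map_mx polyC H + (1 - 'X)%:M : 'M[{poly R}]_d.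
have PE t : (\det P).[t] = \det (t *: H + (1 - t)%:M).
  rewrite -[LHS]/(horner_eval t (\det P)) -det_map_mx; congr (\det _).
  apply/matrixP => i j; rewrite /P !mxE.
  rewrite /= /horner_eval hornerD hornerM hornerX hornerC.
  by rewrite hornerMn hornerD hornerN hornerX hornerC.
rewrite ltNge; apply/negP => dH.
have [||t t01 /rootP] := @poly_ivt R (- \det P) 0 1 => //.
  rewrite !hornerN !PE scale0r add0r subr0 det1 scale1r subrr.
  by rewrite (_ : 0%:M = 0) ?addr0 ?lerN10 ?oppr_ge0//; apply/matrixP => i j; rewrite !mxE mul0rn.
rewrite hornerN PE => /eqP; rewrite oppr_eq0; apply/negP.
exact: pt.
Qed.

End matrix_facts.

Section C1_calculus.
Context {R : realType} {d : nat}.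
Variables (U : set 'rV[R]_d) (x : 'rV[R]_d) (i : 'I_d).
Hypotheses (oU : open U) (Ux : U x).

Lemma partial_cst (a : R) : partial i (fun=> a) x = 0.
Proof. exact: derive_cst. Qed.

Lemma partialM (f g : 'rV[R]_d -> R) : C1 U f -> C1 U g ->
  partial i (fun y => f y * g y) x = f x * partial i g x + g x * partial i f x.
Proof.
move=> cf cg.
have [_ <-] := is_deriveM (C1_is_derive i cf Ux) (C1_is_derive i cg Ux).
by [].
Qed.

Lemma partialD (f g : 'rV[R]_d -> R) : C1 U f -> C1 U g ->
  partial i (fun y => f y + g y) x = partial i f x + partial i g x.
Proof.
move=> cf cg.
have [_ <-] := is_deriveD (C1_is_derive i cf Ux) (C1_is_derive i cg Ux).
by [].
Qed.

Lemma partialV (f : 'rV[R]_d -> R) : C1 U f -> f x != 0 ->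
  partial i (fun y => (f y)^-1) x = - (f x ^- 2) * partial i f x.
Proof. by move=> cf f0; rewrite [LHS]deriveV//; have [] := C1_is_derive i cf Ux. Qed.

Lemma partial_sum (I : Type) (r : seq I) (P : pred I) (f : I -> 'rV[R]_d -> R) :
  (forall j, P j -> C1 U (f j)) ->
  partial i (fun y => \sum_(j <- r | P j) f j y) x =
  \sum_(j <- r | P j) partial i (f j) x.
Proof.
move=> cf; elim: r => [|j r IH].
  rewrite big_nil -[RHS](partial_cst 0); congr (partial _ _ _).
  by apply/funext => y; rewrite big_nil.
rewrite big_cons; case: ifPn => Pj; last first.
  rewrite -IH; congr (partial _ _ _).
  by apply/funext => y; rewrite big_cons (negbTE Pj).
rewrite -IH -(partialD (cf j Pj)); last exact: C1_sum.
by congr (partial _ _ _); apply/funext => y; rewrite big_cons Pj.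
Qed.

Lemma partial_prod (I : eqType) (r : seq I) (f : I -> 'rV[R]_d -> R) :
  (forall j, C1 U (f j)) -> uniq r ->
  partial i (fun y => \prod_(j <- r) f j y) x =
  \sum_(k <- r) partial i (f k) x * \prod_(j <- r | j != k) f j x.
Proof.
move=> cf; elim: r => [_|j r IH /= /andP[jr ur]].
  rewrite big_nil -[RHS](partial_cst 1); congr (partial _ _ _).
  by apply/funext => y; rewrite big_nil.
rewrite (_ : (fun y => _) = fun y => f j y * \prod_(k <- r) f k y); last first.
  by apply/funext => y; rewrite big_cons.
rewrite partialM//; last by apply: C1_prod.
rewrite IH// big_cons addrC; congr (_ + _).
  rewrite big_cons eqxx/= mulrC; congr (_ * _).
  rewrite big_seq [in RHS]big_seq_cond; apply: eq_bigl => k.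
  by have [->|_] := eqVneq k j; rewrite ?(negbTE jr)// andbT.
rewrite mulr_sumr; apply: eq_big_seq => k kr.
rewrite big_cons; case: ifPn => [jk|]; first by rewrite mulrCA.
by rewrite negbK => /eqP jk; rewrite jk kr in jr.
Qed.

End C1_calculus.

Section C1_matrix.
Context {R : realType} {d : nat}.
Variables (U : set 'rV[R]_d).
Hypotheses (oU : open U).

Lemma C1_det n (H : 'rV[R]_d -> 'M[R]_n) :
  (forall a b, C1 U (fun y => H y a b)) -> C1 U (fun y => \det (H y)).
Proof.
move=> cH; rewrite /determinant; apply: C1_sum => // s _.
by apply: C1M => //; [exact: C1_cst|exact: C1_prod].
Qed.

Lemma C1_cofactor n (H : 'rV[R]_d -> 'M[R]_n) a b :
  (forall a b, C1 U (fun y => H y a b)) -> C1 U (fun y => cofactor (H y) a b).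
Proof.
move=> cH; rewrite /cofactor; apply: C1M => //; first exact: C1_cst.
apply: C1_det => k l; rewrite (_ : (fun y => _) = fun y => H y (lift a k) (lift b l))//.
by apply/funext => y; rewrite !mxE.
Qed.

Lemma C1_invmx n (H : 'rV[R]_d -> 'M[R]_n) a b :
  (forall y, U y -> H y \in unitmx) ->
  (forall a b, C1 U (fun y => H y a b)) -> C1 U (fun y => invmx (H y) a b).
Proof.
move=> uH cH.
apply: (C1_eq (f := fun y => (\det (H y))^-1 * cofactor (H y) b a)) => //.
  by move=> y Uy; rewrite /invmx uH// !mxE.
apply: C1M => //; last exact: C1_cofactor.
apply: C1V => //; last exact: C1_det.
by move=> y Uy; rewrite -unitfE -unitmxE; exact: uH.
Qed.

Lemma partial_det n (H : 'rV[R]_d -> 'M[R]_n) x (i : 'I_d) : U x ->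
  (forall a b, C1 U (fun y => H y a b)) ->
  partial i (fun y => \det (H y)) x =
  \sum_a \sum_b partial i (fun y => H y a b) x * cofactor (H x) a b.
Proof.
move=> Ux cH; rewrite /determinant (partial_sum _ oU Ux); last first.
  by move=> s _; apply: C1M => //; [exact: C1_cst|exact: C1_prod].
under eq_bigr => s _.
  rewrite (partialM _ Ux); [|exact: C1_cst|exact: C1_prod].
  rewrite partial_cst mulr0 addr0 (partial_prod _ oU Ux) ?index_enum_uniq//.
  rewrite mulr_sumr.
  over.
rewrite exchange_big/=; apply: eq_bigr => a _.
pose B := \matrix_(k, l) if k == a then partial i (fun y => H y a l) x else H x k l.
transitivity (\det B).
  rewrite /determinant; apply: eq_bigr => s _; congr (_ * _).
  rewrite [RHS](bigD1 a)//= mxE eqxx; congr (_ * _).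
  by apply: eq_bigr => k ka; rewrite mxE (negbTE ka).
rewrite (expand_det_row _ a); apply: eq_bigr => b _; rewrite mxE eqxx; congr (_ * _).
rewrite /cofactor; congr (_ * \det _); apply/matrixP => k l; rewrite !mxE.
by rewrite eq_sym (negbTE (neq_lift _ _)).
Qed.

Lemma partial_sqrt_det n (H : 'rV[R]_d -> 'M[R]_n) x (i : 'I_d) : U x ->
  (forall y, U y -> 0 < \det (H y)) ->
  (forall a b, C1 U (fun y => H y a b)) ->
  partial i (fun y => Num.sqrt (\det (H y))) x =
  Num.sqrt (\det (H x)) / 2 *
  \sum_a \sum_b invmx (H x) b a * partial i (fun y => H y a b) x.
Proof.
move=> Ux H0 cH; have Hx := H0 x Ux.
have uH : H x \in unitmx by rewrite unitmxE unitfE gt_eqF.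
rewrite partial_sqrt//; last by have [] := C1_is_derive i (C1_det cH) Ux.
rewrite partial_det//.
have -> : \sum_a \sum_b partial i (fun y => H y a b) x * cofactor (H x) a b =
    \det (H x) * \sum_a \sum_b invmx (H x) b a * partial i (fun y => H y a b) x.
  rewrite mulr_sumr; apply: eq_bigr => a _; rewrite mulr_sumr; apply: eq_bigr => b _.
  by rewrite /invmx uH !mxE; field; rewrite gt_eqF.
set S := \sum_a _; set s := Num.sqrt _.
have s0 : s != 0 by rewrite gt_eqF// sqrtr_gt0.
by rewrite -[\det _](@sqr_sqrtr _ _ (ltW Hx)) -/s; field.
Qed.

Lemma partial_invmx n (H : 'rV[R]_d -> 'M[R]_n) x (i : 'I_d) a b : U x ->
  (forall y, U y -> H y \in unitmx) ->
  (forall a b, C1 U (fun y => H y a b)) ->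
  partial i (fun y => invmx (H y) a b) x =
  - (invmx (H x) *m (\matrix_(k, l) partial i (fun y => H y k l) x) *m invmx (H x)) a b.
Proof.
move=> Ux uH cH; set K := invmx (H x); set D := \matrix_(k, l) _.
pose DK := \matrix_(k, l) partial i (fun y => invmx (H y) k l) x.
have cK k l : C1 U (fun y => invmx (H y) k l) by exact: C1_invmx.
have E : DK *m H x + K *m D = 0.
  apply/matrixP => k l; rewrite !mxE -big_split/=.
  transitivity (partial i (fun y => \sum_j invmx (H y) k j * H y j l) x).
    rewrite (partial_sum _ oU Ux); last by move=> j _; exact: C1M.
    apply: eq_bigr => j _; rewrite (partialM _ Ux)// !mxE addrC.
    by rewrite [X in _ = _ + X]mulrC.
  rewrite (partial_eq (U := U) (g := fun=> (k == l)%:R))//.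
    exact: partial_cst.
  move=> y Uy; have := mulVmx (uH y Uy) => /matrixP/(_ k l).
  by rewrite !mxE.
have -> : partial i (fun y => invmx (H y) a b) x = DK a b by rewrite mxE.
suff -> : DK = - (K *m D *m K) by rewrite !mxE.
rewrite -[DK](mulmxK (uH x Ux)) -/K.
by move/eqP: E; rewrite addr_eq0 => /eqP ->; rewrite mulNmx.
Qed.

End C1_matrix.

(** * Graphs in a warped product *)

Section graph_geometry.
Context {R : realType} {d : nat}.
Variables (U : set 'rV[R]_d) (h : 'rV[R]_d -> 'M[R]_d) (u : 'rV[R]_d -> R).
Variables (lam : R -> R).
Hypotheses (oU : open U) (ch : forall a b, C1 U (fun y => h y a b)).
Hypothesis ph : forall y, U y -> posdef (h y).
Hypotheses (cu : C1 U u) (cdu : forall a, C1 U (partial a u)).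
Hypothesis lam0 : forall y, U y -> 0 < lam (u y).
Hypothesis dlam : forall y, U y -> derivable lam (u y) 1.
Hypothesis clam : forall y, U y -> {for u y, continuous (derive1 lam)}.

Definition gradrow (y : 'rV[R]_d) : 'rV[R]_d := \row_a partial a u y.
(* As [h] is symmetric, this is the transpose of the gradient of [u]. *)
Definition grad (y : 'rV[R]_d) : 'rV[R]_d := gradrow y *m invmx (h y).
Definition normsq (y : 'rV[R]_d) : R := (grad y *m (gradrow y)^T) 0 0.
(* [qfac = lam * v], where [v] is the area distortion of the graph. *)
Definition qfac (y : 'rV[R]_d) : R := Num.sqrt (lam (u y) ^+ 2 + normsq y).
Definition vol_density (y : 'rV[R]_d) : R := Num.sqrt (\det (h y)).

Definition local_warped (y : 'rV[R]_(1 + d)) : 'M[R]_(1 + d) :=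
  block_mx (1%:M : 'M[R]_1) 0 0 (lam (lsubmx y 0 0) ^+ 2 *: h (rsubmx y)).
Definition local_graph (y : 'rV[R]_d) : 'rV[R]_(1 + d) :=
  row_mx ((u y)%:M : 'rV[R]_1) y.

Lemma h_unit y : U y -> h y \in unitmx.
Proof. by move=> /ph; exact: posdef_unit. Qed.

Lemma invmx_sym y : U y -> (invmx (h y))^T = invmx (h y).
Proof. by move=> Uy; rewrite trmx_inv; have [->] := ph Uy. Qed.

Lemma normsq_ge0 y : U y -> 0 <= normsq y.
Proof.
move=> Uy; have [hT h0] := ph Uy.
have E : normsq y = inner (h y) (grad y) (grad y).
  rewrite /inner /normsq /grad trmx_mul invmx_sym// -!mulmxA.
  by rewrite [h y *m _]mulmxA mulmxV ?h_unit// mul1mx.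
rewrite E; have [->|/h0/ltW//] := eqVneq (grad y) 0.
by rewrite /inner mul0mx mul0mx mxE.
Qed.

Lemma qfac_sqr y : U y -> qfac y ^+ 2 = lam (u y) ^+ 2 + normsq y.
Proof. by move=> Uy; rewrite sqr_sqrtr// addr_ge0 ?sqr_ge0// normsq_ge0. Qed.

Lemma qfac_gt0 y : U y -> 0 < qfac y.
Proof.
move=> Uy; rewrite sqrtr_gt0 ltr_pwDl ?exprn_gt0 ?lam0//.
exact: normsq_ge0.
Qed.

Lemma vol_density_gt0 y : U y -> 0 < vol_density y.
Proof. by move=> /ph/posdef_det_gt0; rewrite sqrtr_gt0. Qed.

Lemma local_graph_jacobian y : U y -> 'J local_graph y = row_mx (gradrow y)^T 1%:M.
Proof.
move=> Uy; apply/matrixP => i a.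
rewrite (C1_jacobianE oU)//; last first.
  move=> b; case: (fintype.splitP b) => k bk.
    rewrite (_ : (fun z => _) = u)//; apply/funext => z.
    have -> : b = lshift d k by exact: val_inj.
    by rewrite row_mxEl (ord1 k) mxE eqxx.
  rewrite (_ : (fun z => _) = fun z : 'rV_d => z 0 k); first exact: C1_coord.
  apply/funext => z; have -> : b = rshift 1 k by exact: val_inj.
  by rewrite row_mxEr.
case: (fintype.splitP a) => k ak.
  have -> : a = lshift d k by exact: val_inj.
  rewrite row_mxEl !mxE; congr (partial _ _ _); apply/funext => z.
  by rewrite row_mxEl (ord1 k) mxE eqxx.
have -> : a = rshift 1 k by exact: val_inj.
transitivity (partial i (fun z : 'rV[R]_d => z 0 k) y).
  congr (partial i _ y); apply/funext => z; rewrite /local_graph.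
  exact: (row_mxEr ((u z)%:M : 'M[R]_1)).
rewrite row_mxEr [RHS]mxE; have [_ H] := is_derive_coord y i k; exact: H.
Qed.

Lemma local_warped_graph y : local_warped (local_graph y) =
  block_mx (1%:M : 'M[R]_1) 0 0 (lam (u y) ^+ 2 *: h y).
Proof. by rewrite /local_warped /local_graph row_mxKl row_mxKr mxE eqxx. Qed.

Lemma induced_metricE y : U y ->
  induced_metric local_warped local_graph y =
  (gradrow y)^T *m gradrow y + lam (u y) ^+ 2 *: h y.
Proof.
move=> Uy; rewrite /induced_metric local_graph_jacobian// local_warped_graph.
rewrite mul_row_block !mulmx0 mulmx1 addr0 add0r tr_row_mx trmxK trmx1.
by rewrite mul_row_col mul1mx mulmx1.
Qed.

Lemma grad_h y : U y -> h y *m (grad y)^T = (gradrow y)^T.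
Proof.
move=> Uy; rewrite /grad trmx_mul invmx_sym// mulmxA mulmxV ?h_unit//.
by rewrite mul1mx.
Qed.

Lemma gradrow_grad y : U y -> gradrow y *m (grad y)^T = (normsq y)%:M.
Proof.
move=> Uy; rewrite [LHS]mx11_scalar; congr (_ %:M).
have E : grad y *m (gradrow y)^T = (gradrow y *m (grad y)^T)^T.
  by rewrite trmx_mul trmxK.
by rewrite /normsq E [RHS]mxE.
Qed.

Lemma sqrt_det_induced_metric y : U y ->
  Num.sqrt (\det (induced_metric local_warped local_graph y)) =
  lam (u y) ^+ d / lam (u y) * qfac y * vol_density y.
Proof.
move=> Uy; rewrite induced_metricE//; set L := lam (u y).
have L0 : 0 < L by exact: lam0.
have -> : (gradrow y)^T *m gradrow y + L ^+ 2 *: h y =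
    L ^+ 2 *: (h y *m (1%:M + (L ^- 2 *: (grad y)^T) *m gradrow y)).
  rewrite mulmxDr mulmx1 scalerDr addrC; congr (_ + _).
  rewrite -!scalemxAl -scalemxAr scalerA mulfV ?scale1r ?expf_neq0 ?gt_eqF//.
  by rewrite mulmxA grad_h.
rewrite detZ det_mulmx det_1_add_col_row -scalemxAr gradrow_grad// !mxE eqxx mulr1n.
rewrite exprAC sqrtrM ?sqr_ge0// sqrtr_sqr ger0_norm ?exprn_ge0 ?ltW//.
rewrite sqrtrM ?(ltW (posdef_det_gt0 (ph Uy)))// -/(vol_density y).
have -> : 1 + L ^- 2 * normsq y = (qfac y / L) ^+ 2.
  by rewrite exprMn qfac_sqr// -/L; field; rewrite gt_eqF.
rewrite sqrtr_sqr ger0_norm; last by rewrite divr_ge0 ?ltW// qfac_gt0.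
by rewrite mulrA mulrAC; field; rewrite gt_eqF.
Qed.

Definition local_normal (y : 'rV[R]_d) : 'rV[R]_(1 + d) :=
  (lam (u y) / qfac y) *: row_mx (1%:M : 'M[R]_1) (- (lam (u y) ^- 2 *: grad y)).

Lemma local_warped_normal y : U y ->
  local_warped (local_graph y) *m (local_normal y)^T =
  (lam (u y) / qfac y) *: col_mx (1%:M : 'M[R]_1) (- (gradrow y)^T).
Proof.
move=> Uy; rewrite local_warped_graph /local_normal linearZ /= -scalemxAr.
congr (_ *: _); rewrite tr_row_mx mul_block_col !mul0mx addr0 add0r trmx1 mulmx1.
congr col_mx; rewrite linearN linearZ /= mulmxN -scalemxAl -scalemxAr grad_h//.
by rewrite scalerA mulfV ?scale1r// expf_neq0// gt_eqF// lam0.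
Qed.

Lemma local_unit_normal y : U y ->
  unit_normal local_warped local_graph y (local_normal y).
Proof.
move=> Uy; have L0 := lam0 Uy; have q0 := qfac_gt0 Uy; split=> [i|].
  rewrite /inner -mulmxA local_warped_normal// -row_mul local_graph_jacobian//.
  rewrite -scalemxAr mul_row_col mulmx1 mul1mx subrr scaler0.
  by rewrite row0 mxE.
rewrite /inner -mulmxA local_warped_normal// /local_normal -scalemxAl -scalemxAr.
rewrite mul_row_col mul1mx mulNmx mulmxN opprK -scalemxAl !mxE eqxx.
rewrite -/(normsq y).
have := qfac_sqr Uy; rewrite /normsq mxE => E.
set w := \sum_j _ in E *; have -> : w = qfac y ^+ 2 - lam (u y) ^+ 2 by rewrite E addrC addKr.
by rewrite /= mulr1n; field; rewrite !gt_eqF.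
Qed.

Lemma local_normal_gt0 y : U y -> 0 < lsubmx (local_normal y) 0 0.
Proof.
move=> Uy; rewrite /local_normal linearZ /= row_mxKl !mxE eqxx mulr1.
by rewrite divr_gt0 ?lam0 ?qfac_gt0.
Qed.

Lemma invmx_induced_metric y : U y ->
  invmx (induced_metric local_warped local_graph y) =
  lam (u y) ^- 2 *: (invmx (h y) - qfac y ^- 2 *: ((grad y)^T *m grad y)).
Proof.
move=> Uy; have L0 := lam0 Uy; have q0 := qfac_gt0 Uy.
have E : induced_metric local_warped local_graph y *m
  (lam (u y) ^- 2 *: (invmx (h y) - qfac y ^- 2 *: ((grad y)^T *m grad y))) = 1%:M.
  have e1 : (gradrow y)^T *m gradrow y *m invmx (h y) = (gradrow y)^T *m grad y.
    by rewrite -mulmxA.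
  have e2 : (gradrow y)^T *m gradrow y *m ((grad y)^T *m grad y) =
      normsq y *: ((gradrow y)^T *m grad y).
    by rewrite mulmxA -[_ *m gradrow y *m _]mulmxA gradrow_grad// mul_mx_scalar -scalemxAl.
  have e3 : h y *m ((grad y)^T *m grad y) = (gradrow y)^T *m grad y.
    by rewrite mulmxA grad_h.
  rewrite induced_metricE// -scalemxAr mulmxBr !mulmxDl -!scalemxAl mulmxV ?h_unit//.
  rewrite e1 -!scalemxAr e2 e3.
  have -> : normsq y = qfac y ^+ 2 - lam (u y) ^+ 2 by rewrite qfac_sqr// addrC addKr.
  move: (_ *m grad y) => M; apply/matrixP => i j; rewrite !mxE.
  by move: (M i j) (_ %:R) => m e; field; rewrite !gt_eqF.
have [u1 _] := mulmx1_unit E.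
by rewrite -[LHS]mulmx1 -E mulmxA mulVmx// mul1mx.
Qed.

Let lshift0 : 'I_(1 + d) := lshift d (ord0 : 'I_1).
Let rshift1 (a : 'I_d) : 'I_(1 + d) := rshift 1 a.

Lemma sum_ord_1D (f : 'I_(1 + d) -> R) :
  \sum_a f a = f lshift0 + \sum_a f (rshift1 a).
Proof. by rewrite big_split_ord big_ord1. Qed.

Lemma partial_local_warped0l b k y :
  partial b (fun z => local_warped z lshift0 k) (local_graph y) = 0.
Proof.
have E : (fun z => local_warped z lshift0 k) = fun=> (1%:M : 'M[R]_(1 + d)) lshift0 k.
  apply/funext => z; rewrite /local_warped (@scalar_mx_block _ 1 d).
  case: (fintype.splitP k) => l kl.
    have -> : k = lshift d l by exact: val_inj.
    by rewrite !block_mxEul.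
  have -> : k = rshift 1 l by exact: val_inj.
  by rewrite !block_mxEur.
rewrite E; exact: derive_cst.
Qed.

Lemma partial_local_warped0r b k y :
  partial b (fun z => local_warped z k lshift0) (local_graph y) = 0.
Proof.
have E : (fun z => local_warped z k lshift0) = fun=> (1%:M : 'M[R]_(1 + d)) k lshift0.
  apply/funext => z; rewrite /local_warped (@scalar_mx_block _ 1 d).
  case: (fintype.splitP k) => l kl.
    have -> : k = lshift d l by exact: val_inj.
    by rewrite !block_mxEul.
  have -> : k = rshift 1 l by exact: val_inj.
  by rewrite !block_mxEdl.
rewrite E; exact: derive_cst.
Qed.

Lemma local_warped_row_cons t z a b :
  local_warped (row_cons (t, z)) (rshift1 a) (rshift1 b) = lam t ^+ 2 * h z a b.
Proof.
rewrite /local_warped /row_cons row_mxKl row_mxKr block_mxEdr [LHS]mxE.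
by rewrite [t%:M _ _]mxE eqxx.
Qed.

Lemma partial_local_warpedS b a c y : U y ->
  partial (rshift1 b) (fun z => local_warped z (rshift1 a) (rshift1 c)) (local_graph y) =
  lam (u y) ^+ 2 * partial b (fun z => h z a c) y.
Proof.
move=> Uy; rewrite [LHS](partial_row_consS _ (u y) y b).
under [X in partial b X]eq_fun do rewrite local_warped_row_cons.
rewrite (partialM _ Uy); [|exact: C1_cst|exact: ch].
by rewrite partial_cst mulr0 addr0.
Qed.

Lemma partial_local_warped0 a c y : U y ->
  partial lshift0 (fun z => local_warped z (rshift1 a) (rshift1 c)) (local_graph y) =
  2 * lam (u y) * derive1 lam (u y) * h y a c.
Proof.
move=> Uy; rewrite [LHS](partial_row_cons0 _ (u y) y).
under [X in derive1 X]eq_fun do rewrite local_warped_row_cons.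
rewrite derive1E.
have dl := derivableP (dlam Uy).
have dh : is_derive (u y) 1 (cst (h y a c) : R -> R) 0 by exact: is_derive_cst.
have := is_deriveM (is_deriveX 2 dl) dh.
rewrite (_ : (lam ^+ 2 * cst (h y a c)) = (fun t => lam t ^+ 2 * h y a c)); last first.
  by apply/funext => t.
by case=> _ ->; rewrite scaler0 add0r -derive1E /GRing.scale /= expr1; ring.
Qed.

Lemma sum_local_warped y (V Y Z : 'I_(1 + d) -> R) : U y ->
  \sum_b \sum_c \sum_k V b * Y c * Z k *
     partial b (fun z => local_warped z c k) (local_graph y) =
  2 * lam (u y) * derive1 lam (u y) * V lshift0 *
    (\sum_c \sum_k Y (rshift1 c) * Z (rshift1 k) * h y c k) +
  lam (u y) ^+ 2 * (\sum_b \sum_c \sum_k V (rshift1 b) * Y (rshift1 c) * Z (rshift1 k) *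
     partial b (fun z => h z c k) y).
Proof.
move=> Uy.
have E b : \sum_c \sum_k V b * Y c * Z k *
     partial b (fun z => local_warped z c k) (local_graph y) =
   \sum_c \sum_k V b * Y (rshift1 c) * Z (rshift1 k) *
     partial b (fun z => local_warped z (rshift1 c) (rshift1 k)) (local_graph y).
  rewrite sum_ord_1D big1 ?add0r; last by move=> k _; rewrite partial_local_warped0l mulr0.
  by apply: eq_bigr => c _; rewrite sum_ord_1D partial_local_warped0r mulr0 add0r.
under eq_bigr do rewrite E.
rewrite sum_ord_1D; congr (_ + _).
  rewrite mulr_sumr; apply: eq_bigr => c _; rewrite mulr_sumr; apply: eq_bigr => k _.
  by rewrite partial_local_warped0//; ring.
rewrite mulr_sumr; apply: eq_bigr => b _.
rewrite mulr_sumr; apply: eq_bigr => c _; rewrite mulr_sumr; apply: eq_bigr => k _.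
by rewrite partial_local_warpedS//; ring.
Qed.

Let D y a i j : R := partial a (fun z => h z i j) y.
Let U2 y i j : R := partial i (partial j u) y.
Let X y (i : 'I_d) : R := grad y 0 i.
Let du y (i : 'I_d) : R := partial i u y.

Lemma D_sym y a i j : U y -> D y a i j = D y a j i.
Proof.
move=> Uy; rewrite /D; apply: partial_eq oU _ Uy => z Uz.
by have [hT _] := ph Uz; rewrite -[in LHS]hT mxE.
Qed.

Lemma local_warped_sym y : U y ->
  (local_warped (local_graph y))^T = local_warped (local_graph y).
Proof.
move=> Uy; rewrite local_warped_graph tr_block_mx !trmx0 trmx1 linearZ /=.
by have [-> _] := ph Uy.
Qed.

Lemma local_warped_unit y : U y -> local_warped (local_graph y) \in unitmx.
Proof.
move=> Uy; rewrite local_warped_graph unitmxE det_ublock det1 mul1r detZ.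
by rewrite unitrM unitfE expf_neq0 ?expf_neq0 ?gt_eqF ?lam0// -unitmxE h_unit.
Qed.

Lemma sum_grad_h y i : U y -> \sum_j X y j * h y i j = du y i.
Proof.
move=> Uy; transitivity ((gradrow y)^T i 0); last by rewrite !mxE.
by rewrite -grad_h// mxE; apply: eq_bigr => j _; rewrite [in RHS]mxE mulrC.
Qed.

Lemma sum_delta (f : 'I_d -> R) i : \sum_j (1%:M : 'M[R]_d) i j * f j = f i.
Proof.
rewrite (bigD1 i)//= big1 ?addr0 ?mxE ?eqxx ?mul1r// => j ji.
by rewrite mxE eq_sym (negbTE ji) mul0r.
Qed.

Lemma local_second_fundamental_form y i j : U y ->
  second_fundamental_form local_warped local_graph y (local_normal y) i j =
  - (lam (u y) / qfac y) *
  (U2 y i j - 2 * (derive1 lam (u y) / lam (u y)) * du y i * du y j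
   - 2^-1 * (\sum_k X y k * D y i j k + \sum_k X y k * D y j i k
             - \sum_a X y a * D y a i j)
   - lam (u y) * derive1 lam (u y) * h y i j).
Proof.
move=> Uy; have L0 := lam0 Uy; have q0 := qfac_gt0 Uy.
set n0 := lam (u y) / qfac y.
set J := 'J local_graph y; set N := local_normal y.
have JE : J = row_mx (gradrow y)^T 1%:M by exact: local_graph_jacobian.
have J0 k : J k lshift0 = du y k by rewrite JE row_mxEl !mxE.
have JS k a : J k (rshift1 a) = (1%:M : 'M[R]_d) k a by rewrite JE row_mxEr.
have N0 : N 0 lshift0 = n0.
  by rewrite mxE row_mxEl mxE eqxx mulr1.
have NS a : N 0 (rshift1 a) = - (n0 * lam (u y) ^- 2) * X y a.
  by rewrite /N mxE row_mxEr mxE [X in - X]mxE -/n0 mulrN mulrA mulNr.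
rewrite mxE /inner -mulmxA local_warped_normal// -/n0 mulNr; congr (- _).
rewrite mxE sum_ord_1D -/J.
have GN a : (n0 *: col_mx (1%:M : 'M[R]_1) (- (gradrow y)^T)) a 0 =
    \sum_k local_warped (local_graph y) a k * N 0 k.
  have := local_warped_normal Uy => /matrixP/(_ a 0) <-.
  by rewrite mxE; apply: eq_bigr => k _; congr (_ * _); rewrite mxE.
have christ a b c : christoffel local_warped a b c (local_graph y) =
  2^-1 * \sum_k invmx (local_warped (local_graph y)) a k *
   (partial b (fun z => local_warped z c k) (local_graph y)
    + partial c (fun z => local_warped z b k) (local_graph y)
    - partial k (fun z => local_warped z b c) (local_graph y)) by [].
set T := fun b c k => partial b (fun z => local_warped z c k) (local_graph y).
pose G := local_warped (local_graph y).
pose nn a := \sum_k G a k * N 0 k.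
have invG k : \sum_a invmx G a k * nn a = N 0 k.
  transitivity ((invmx G *m (G *m N^T)) k 0).
    rewrite mxE; apply: eq_bigr => a _; congr (_ * _).
      have Es : (invmx G)^T = invmx G by rewrite trmx_inv local_warped_sym.
      by rewrite -[in LHS]Es mxE.
    by rewrite [RHS]mxE; apply: eq_bigr => l _; congr (_ * _); rewrite [in RHS]mxE.
  by rewrite mulmxA mulVmx ?mul1mx ?mxE//; exact: local_warped_unit.
transitivity (\sum_a partial i (fun z => 'J local_graph z j a) y * nn a +
   \sum_a (\sum_b \sum_c christoffel local_warped a b c (local_graph y) * J i b * J j c) * nn a).
  rewrite -big_split/= sum_ord_1D; congr (_ + _).
    by rewrite mxE GN mulrDl.
  by apply: eq_bigr => a _; rewrite mxE GN mulrDl.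
have -> : \sum_a partial i (fun z => 'J local_graph z j a) y * nn a = n0 * U2 y i j.
  have nn0 : nn lshift0 = n0 by rewrite /nn -GN mxE col_mxEu mxE eqxx mulr1.
  have J'0 z : U z -> 'J local_graph z j lshift0 = partial j u z.
    by move=> Uz; rewrite (local_graph_jacobian Uz) row_mxEl [LHS]mxE [LHS]mxE.
  have J'S a z : U z -> 'J local_graph z j (rshift1 a) = (1%:M : 'M[R]_d) j a.
    by move=> Uz; rewrite (local_graph_jacobian Uz); exact: row_mxEr.
  have e0 : partial i (fun z => 'J local_graph z j lshift0) y = U2 y i j.
    exact: (partial_eq i oU J'0 Uy).
  have eS a : partial i (fun z => 'J local_graph z j (rshift1 a)) y = 0.
    by rewrite (partial_eq i oU (J'S a) Uy); exact: partial_cst.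
  rewrite sum_ord_1D e0 nn0 big1 => [|a _]; last by rewrite eS mul0r.
  by rewrite addr0 mulrC.
have -> : \sum_a (\sum_b \sum_c christoffel local_warped a b c (local_graph y) * J i b * J j c) * nn a =
   2^-1 * (\sum_b \sum_c \sum_k J i b * J j c * N 0 k * T b c k
         + \sum_b \sum_c \sum_k J j b * J i c * N 0 k * T b c k
         - \sum_b \sum_c \sum_k N 0 b * J i c * J j k * T b c k).
  transitivity (2^-1 * \sum_b \sum_c \sum_k J i b * J j c * N 0 k * (T b c k + T c b k - T k b c)).
    rewrite mulr_sumr; under eq_bigr do rewrite mulr_suml.
    rewrite exchange_big/=; apply: eq_bigr => b _.
    rewrite mulr_sumr; under eq_bigr do rewrite mulr_suml.
    rewrite exchange_big/=; apply: eq_bigr => c _.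
    under eq_bigr => a _.
      rewrite christ -!mulrA mulr_suml mulr_sumr.
      over.
    rewrite exchange_big/= mulr_sumr; apply: eq_bigr => k _.
    rewrite -invG !mulr_sumr mulr_suml mulr_sumr; apply: eq_bigr => a _.
    by rewrite /T /G; ring.
  congr (_ * _).
  have -> : \sum_b \sum_c \sum_k J j b * J i c * N 0 k * T b c k =
      \sum_b \sum_c \sum_k J i b * J j c * N 0 k * T c b k.
    rewrite exchange_big/=; apply: eq_bigr => b _; apply: eq_bigr => c _.
    by apply: eq_bigr => k _; ring.
  have -> : \sum_b \sum_c \sum_k N 0 b * J i c * J j k * T b c k =
      \sum_b \sum_c \sum_k J i b * J j c * N 0 k * T k b c.
    rewrite exchange_big/=; apply: eq_bigr => b _.
    rewrite exchange_big/=; apply: eq_bigr => c _.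
    by apply: eq_bigr => k _; ring.
  rewrite -sumrN -!big_split/=; apply: eq_bigr => b _.
  rewrite -sumrN -!big_split/=; apply: eq_bigr => c _.
  rewrite -sumrN -!big_split/=; apply: eq_bigr => k _.
  ring.
rewrite /T !sum_local_warped// !J0 N0.
have s1 (p r : 'I_d) : \sum_c \sum_k J p (rshift1 c) * N 0 (rshift1 k) * h y c k =
    - (n0 * lam (u y) ^- 2) * du y p.
  under eq_bigr => c _.
    under eq_bigr => k _ do rewrite JS NS -mulrA.
    rewrite -mulr_sumr.
    over.
  rewrite sum_delta -(sum_grad_h p Uy) mulr_sumr.
  by apply: eq_bigr => k _; rewrite mulrA.
have s2 (p r : 'I_d) : \sum_b \sum_c \sum_k J p (rshift1 b) * J r (rshift1 c) *
    N 0 (rshift1 k) * partial b (fun z => h z c k) y =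
    - (n0 * lam (u y) ^- 2) * \sum_k X y k * D y p r k.
  under eq_bigr => b _.
    under eq_bigr => c _.
      under eq_bigr => k _ do rewrite JS -!mulrA.
      rewrite -mulr_sumr.
      over.
    rewrite -mulr_sumr.
    over.
  rewrite sum_delta.
  under eq_bigr => c _.
    under eq_bigr => k _ do rewrite JS.
    rewrite -mulr_sumr.
    over.
  rewrite sum_delta mulr_sumr; apply: eq_bigr => k _.
  by rewrite NS mulrA.
have s3 : \sum_c \sum_k J i (rshift1 c) * J j (rshift1 k) * h y c k = h y i j.
  under eq_bigr => c _.
    under eq_bigr => k _ do rewrite JS -mulrA.
    rewrite -mulr_sumr.
    over.
  rewrite sum_delta; under eq_bigr do rewrite JS.
  by rewrite sum_delta.
have s4 : \sum_b \sum_c \sum_k N 0 (rshift1 b) * J i (rshift1 c) * J j (rshift1 k) *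
    partial b (fun z => h z c k) y = - (n0 * lam (u y) ^- 2) * \sum_a X y a * D y a i j.
  rewrite mulr_sumr; apply: eq_bigr => b _.
  transitivity (N 0 (rshift1 b) * \sum_c (1%:M : 'M[R]_d) i c *
      \sum_k (1%:M : 'M[R]_d) j k * D y b c k).
    rewrite mulr_sumr; apply: eq_bigr => c _; rewrite !mulr_sumr.
    by apply: eq_bigr => k _; rewrite !JS /D; ring.
  by rewrite sum_delta sum_delta NS mulrA.
rewrite !s1// !s2 s3 s4.
by field; rewrite gt_eqF.
Qed.

Lemma local_mean_curvature y : U y ->
  mean_curvature local_warped local_graph y (local_normal y) =
  \sum_i \sum_j lam (u y) ^- 2 * (invmx (h y) i j - qfac y ^- 2 * (X y i * X y j)) *
  (- (lam (u y) / qfac y) *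
  (U2 y j i - 2 * (derive1 lam (u y) / lam (u y)) * du y j * du y i
   - 2^-1 * (\sum_k X y k * D y j i k + \sum_k X y k * D y i j k
             - \sum_a X y a * D y a j i)
   - lam (u y) * derive1 lam (u y) * h y j i)).
Proof.
move=> Uy; rewrite /mean_curvature /mxtrace; apply: eq_bigr => i _.
rewrite mxE; apply: eq_bigr => j _; rewrite local_second_fundamental_form//.
congr (_ * _); rewrite invmx_induced_metric// mxE; congr (_ * _).
rewrite mxE; congr (_ + _); rewrite mxE; congr (- _); rewrite mxE; congr (_ * _).
by rewrite mxE big_ord1 mxE.
Qed.

Lemma C1_grad a : C1 U (fun y => grad y 0 a).
Proof.
apply: (C1_eq oU (f := fun y => \sum_j partial j u y * invmx (h y) j a)).
  by move=> y Uy; rewrite /grad mxE; apply: eq_bigr => j _; rewrite mxE.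
exact: (C1_sum _ oU (fun j _ => C1M oU (cdu j) (C1_invmx oU j a h_unit ch))).
Qed.

Lemma normsqE y : normsq y = \sum_i grad y 0 i * partial i u y.
Proof. by rewrite /normsq mxE; apply: eq_bigr => i _; congr (_ * _); rewrite 2!mxE. Qed.

Lemma C1_normsq : C1 U normsq.
Proof.
apply: (C1_eq oU (f := fun y => \sum_i grad y 0 i * partial i u y)).
  by move=> y _; rewrite normsqE.
exact: (C1_sum _ oU (fun i _ => C1M oU (C1_grad i) (cdu i))).
Qed.

Lemma C1_lam : C1 U (fun y => lam (u y)).
Proof. exact: (C1_comp1 oU cu dlam clam). Qed.

Lemma C1_qfac_sqr : C1 U (fun y => lam (u y) ^+ 2 + normsq y).
Proof. exact: (C1D oU (C1M oU C1_lam C1_lam) C1_normsq). Qed.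

Lemma qfac_sqr_gt0 y : U y -> 0 < lam (u y) ^+ 2 + normsq y.
Proof. by move=> Uy; rewrite -(qfac_sqr Uy) exprn_gt0// qfac_gt0. Qed.

Lemma qfac_neq0 y : U y -> qfac y != 0.
Proof. by move=> Uy; rewrite (gt_eqF (qfac_gt0 Uy)). Qed.

Lemma C1_qfac : C1 U qfac.
Proof. exact: (C1_sqrt oU qfac_sqr_gt0 C1_qfac_sqr). Qed.

Lemma C1_qfacV : C1 U (fun y => (qfac y)^-1).
Proof. exact: (C1V oU qfac_neq0 C1_qfac). Qed.

Lemma C1_vol_density : C1 U vol_density.
Proof. exact: (C1_sqrt oU (fun y Uy => posdef_det_gt0 (ph Uy)) (C1_det oU ch)). Qed.

Definition flux i (y : 'rV[R]_d) : R := vol_density y * (grad y 0 i * (qfac y)^-1).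

Lemma C1_flux i : C1 U (flux i).
Proof. exact: (C1M oU C1_vol_density (C1M oU (C1_grad i) C1_qfacV)). Qed.

Lemma partial_grad y i a : U y -> partial i (fun z => grad z 0 a) y =
  \sum_j (invmx (h y) j a * U2 y i j) -
  \sum_k \sum_l X y k * D y i k l * invmx (h y) l a.
Proof.
move=> Uy.
rewrite (partial_eq (U := U) (g := fun z => \sum_j partial j u z * invmx (h z) j a))//; last first.
  by move=> z Uz; rewrite /grad mxE; apply: eq_bigr => j _; rewrite mxE.
have cK k l : C1 U (fun z => invmx (h z) k l) := C1_invmx oU k l h_unit ch.
rewrite (partial_sum _ oU Uy); last exact: (fun j _ => C1M oU (cdu j) (cK j a)).
under eq_bigr => j _.
  rewrite (partialM i Uy (cdu j) (cK j a)) (partial_invmx oU i j a Uy h_unit ch).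
  over.
rewrite big_split/= addrC; congr (_ + _).
rewrite -sumrN; under eq_bigr do rewrite mulrN.
rewrite !sumrN; congr (- _).
transitivity ((gradrow y *m (invmx (h y) *m
   (\matrix_(k, l) partial i (fun z => h z k l) y) *m invmx (h y))) 0 a).
  by rewrite mxE; apply: eq_bigr => j _; rewrite [in RHS]mxE.
rewrite !mulmxA -/(grad y) mxE.
under eq_bigr do rewrite mxE mulr_suml.
rewrite exchange_big/=; apply: eq_bigr => k _; apply: eq_bigr => l _.
by rewrite mxE.
Qed.

Lemma partial_normsq y i : U y -> partial i normsq y =
  2 * (\sum_a X y a * U2 y i a) - \sum_k \sum_l X y k * D y i k l * X y l.
Proof.
move=> Uy.
rewrite (partial_eq (U := U) (g := fun z => \sum_a grad z 0 a * partial a u z))//; last first.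
  by move=> z Uz; rewrite normsqE.
rewrite (partial_sum _ oU Uy); last exact: (fun a _ => C1M oU (C1_grad a) (cdu a)).
under eq_bigr => a _.
  rewrite (partialM i Uy (C1_grad a) (cdu a)) partial_grad//.
  over.
rewrite big_split/=.
under [X in _ + X]eq_bigr do rewrite mulrBr.
have uK j : \sum_a du y a * invmx (h y) j a = X y j.
  rewrite /X /grad mxE; apply: eq_bigr => a _; rewrite [gradrow _ _ _]mxE.
  by rewrite -[in RHS](invmx_sym Uy) mxE.
have e1 : \sum_a partial a u y * (\sum_j invmx (h y) j a * U2 y i j) =
    \sum_a X y a * U2 y i a.
  under eq_bigr do rewrite mulr_sumr.
  rewrite exchange_big/=; apply: eq_bigr => j _; rewrite -uK mulr_suml.
  by apply: eq_bigr => a _; rewrite mulrA.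
have e2 : \sum_a partial a u y * (\sum_k \sum_l X y k * D y i k l * invmx (h y) l a) =
    \sum_k \sum_l X y k * D y i k l * X y l.
  under eq_bigr do rewrite mulr_sumr.
  rewrite exchange_big/=; apply: eq_bigr => k _.
  under eq_bigr do rewrite mulr_sumr.
  rewrite exchange_big/=; apply: eq_bigr => l _; rewrite -[X y l]uK mulr_sumr.
  by apply: eq_bigr => a _; rewrite /du; ring.
rewrite big_split/= sumrN e1 e2 addrA; congr (_ - _).
by rewrite -mulr2n mulr_natl.
Qed.

Lemma partial_flux y i : U y -> partial i (flux i) y =
  vol_density y *
  (2^-1 * (\sum_a \sum_b invmx (h y) b a * D y i a b) * X y i / qfac y
   + (\sum_j (invmx (h y) j i * U2 y i j)
      - \sum_k \sum_l X y k * D y i k l * invmx (h y) l i) / qfac y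
   - X y i * (lam (u y) * derive1 lam (u y) * du y i + \sum_a X y a * U2 y i a
       - 2^-1 * \sum_k \sum_l X y k * D y i k l * X y l) / qfac y ^+ 3).
Proof.
move=> Uy; have q0 := qfac_gt0 Uy.
have cgq := C1M oU (C1_grad i) C1_qfacV.
rewrite /flux (partialM i Uy C1_vol_density cgq).
rewrite (partialM i Uy (C1_grad i) C1_qfacV).
rewrite (partialV i Uy C1_qfac (qfac_neq0 Uy)) (partial_grad _ _ Uy).
rewrite (partial_sqrt_det oU i Uy (fun z Uz => posdef_det_gt0 (ph Uz)) ch).
have -> : partial i qfac y =
    (lam (u y) * derive1 lam (u y) * du y i + \sum_a X y a * U2 y i a
       - 2^-1 * \sum_k \sum_l X y k * D y i k l * X y l) / qfac y.
  have [dq _] := C1_is_derive i C1_qfac_sqr Uy.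
  rewrite /qfac (partial_sqrt dq (qfac_sqr_gt0 Uy)).
  rewrite (partialD i Uy (C1M oU C1_lam C1_lam) C1_normsq).
  rewrite (partialM i Uy C1_lam C1_lam) (partial_normsq _ Uy).
  have -> : partial i (fun z => lam (u z)) y = derive1 lam (u y) * du y i.
    have dl : is_derive (u y) 1 lam (derive1 lam (u y)).
      by rewrite derive1E; apply/derivableP; exact: dlam.
    by have [_ <-] := is_derive_comp1 (C1_is_derive i cu Uy) dl.
  by rewrite -/(qfac y); field; rewrite gt_eqF.
rewrite -/(vol_density y) -/(X y i).
have -> : \sum_a \sum_b invmx (h y) b a * partial i (fun z => h z a b) y =
  \sum_a \sum_b invmx (h y) b a * D y i a b by [].
by field; rewrite gt_eqF.
Qed.

Lemma mean_curvature_divergence y : U y ->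
  vol_density y * lam (u y) *
    mean_curvature local_warped local_graph y (local_normal y) =
  vol_density y * (d%:R * derive1 lam (u y) * lam (u y) / qfac y) -
  \sum_i partial i (flux i) y.
Proof.
move=> Uy; have L0 := lam0 Uy; have q0 := qfac_gt0 Uy; have qE := qfac_sqr Uy.
rewrite local_mean_curvature//.
under [X in _ - X]eq_bigr do rewrite partial_flux//.
set K := invmx (h y); set L := lam (u y) in L0 qE *; set L' := derive1 lam (u y).
set q := qfac y in q0 qE *; set s := vol_density y.
have Ksym a b : K a b = K b a by rewrite /K -[in LHS](invmx_sym Uy) mxE.
pose T1 := \sum_i (\sum_a \sum_b K b a * D y i a b) * X y i.
pose TU := \sum_i \sum_j K j i * U2 y i j.
pose T2 := \sum_i \sum_k \sum_l X y k * D y i k l * K l i.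
pose TX := \sum_i X y i * \sum_a X y a * U2 y i a.
pose T3 := \sum_i X y i * \sum_k \sum_l X y k * D y i k l * X y l.
pose w := normsq y.
have wE : \sum_i X y i * du y i = w by rewrite /w normsqE.
have -> : \sum_i s *
  (2^-1 * (\sum_a \sum_b K b a * D y i a b) * X y i / q
   + (\sum_j (K j i * U2 y i j) - \sum_k \sum_l X y k * D y i k l * K l i) / q
   - X y i * (L * L' * du y i + \sum_a X y a * U2 y i a
       - 2^-1 * \sum_k \sum_l X y k * D y i k l * X y l) / q ^+ 3) =
  s * (2^-1 * T1 / q + (TU - T2) / q - (L * L' * w + TX - 2^-1 * T3) / q ^+ 3).
  rewrite -mulr_sumr; congr (_ * _).
  rewrite sumrB big_split/= -!mulr_suml sumrB -/TU -/T2.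
  congr (_ + _ - _ / _).
    congr (_ / _); rewrite /T1 mulr_sumr; apply: eq_bigr => i _; by rewrite mulrA.
  rewrite /TX /T3 -wE !mulr_sumr -big_split/= -sumrB; apply: eq_bigr => i _; ring.
pose B i j := U2 y j i - 2 * (L' / L) * du y j * du y i
   - 2^-1 * (\sum_k X y k * D y j i k + \sum_k X y k * D y i j k
             - \sum_a X y a * D y a j i) - L * L' * h y j i.
have -> : \sum_i \sum_j L ^- 2 * (K i j - q ^- 2 * (X y i * X y j)) * (- (L / q) * B i j)
   = - (L ^- 2 * (L / q)) * (\sum_i \sum_j K i j * B i j - q ^- 2 * \sum_i \sum_j X y i * X y j * B i j).
  rewrite mulr_sumr -sumrB mulr_sumr; apply: eq_bigr => i _.
  rewrite mulr_sumr -sumrB mulr_sumr; apply: eq_bigr => j _; ring.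
have sumB (P : 'I_d -> 'I_d -> R) : \sum_i \sum_j P i j * B i j =
   \sum_i \sum_j P i j * U2 y j i
   - 2 * (L' / L) * (\sum_i \sum_j P i j * (du y j * du y i))
   - 2^-1 * (\sum_i \sum_j P i j * (\sum_k X y k * D y j i k)
            + \sum_i \sum_j P i j * (\sum_k X y k * D y i j k)
            - \sum_i \sum_j P i j * (\sum_k X y k * D y k j i))
   - L * L' * \sum_i \sum_j P i j * h y j i.
  rewrite -big_split/= -sumrB !mulr_sumr -!sumrB; apply: eq_bigr => i _.
  rewrite -big_split/= -sumrB !mulr_sumr -!sumrB; apply: eq_bigr => j _.
  rewrite /B; ring.
rewrite !sumB.
have Kdu i : \sum_j K i j * du y j = X y i.
  rewrite /X /grad mxE; apply: eq_bigr => a _; rewrite [gradrow _ _ _]mxE mulrC.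
  by rewrite Ksym.
have k1 : \sum_i \sum_j K i j * U2 y j i = TU by rewrite exchange_big.
have k2 : \sum_i \sum_j K i j * (du y j * du y i) = w.
  rewrite -wE; apply: eq_bigr => i _; rewrite -Kdu mulr_suml.
  by apply: eq_bigr => j _; rewrite mulrA.
have k3 : \sum_i \sum_j K i j * (\sum_k X y k * D y j i k) = T2.
  rewrite exchange_big/=; apply: eq_bigr => i _.
  under eq_bigr do rewrite mulr_sumr.
  rewrite exchange_big/=; apply: eq_bigr => k _; apply: eq_bigr => l _.
  by rewrite (D_sym _ l k Uy); ring.
have k4 : \sum_i \sum_j K i j * (\sum_k X y k * D y i j k) = T2.
  apply: eq_bigr => i _; under eq_bigr do rewrite mulr_sumr.
  rewrite exchange_big/=; apply: eq_bigr => k _; apply: eq_bigr => l _.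
  by rewrite (D_sym _ l k Uy) Ksym; ring.
have k5 : \sum_i \sum_j K i j * (\sum_k X y k * D y k j i) = T1.
  rewrite /T1; under [RHS]eq_bigr do rewrite mulr_suml.
  rewrite [RHS]exchange_big/= exchange_big/=; apply: eq_bigr => j _.
  under [RHS]eq_bigr do rewrite mulr_suml.
  rewrite [RHS]exchange_big/=; apply: eq_bigr => i _.
  by rewrite mulr_sumr; apply: eq_bigr => k _; ring.
have k6 : \sum_i \sum_j K i j * h y j i = d%:R.
  transitivity (\tr (1%:M : 'M[R]_d)); last by rewrite mxtrace1.
  by rewrite -(mulVmx (h_unit Uy)) -/K; apply: eq_bigr => i _; rewrite mxE.
have x1 : \sum_i \sum_j X y i * X y j * U2 y j i = TX.
  rewrite exchange_big/=; apply: eq_bigr => i _; rewrite mulr_sumr.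
  by apply: eq_bigr => j _; ring.
have x2 : \sum_i \sum_j X y i * X y j * (du y j * du y i) = w ^+ 2.
  rewrite expr2 -{1}wE mulr_suml; apply: eq_bigr => i _; rewrite -wE mulr_sumr.
  by apply: eq_bigr => j _; ring.
have x3 : \sum_i \sum_j X y i * X y j * (\sum_k X y k * D y j i k) = T3.
  rewrite exchange_big/=; apply: eq_bigr => i _; rewrite mulr_sumr.
  apply: eq_bigr => j _; rewrite !mulr_sumr; apply: eq_bigr => k _; ring.
have x4 : \sum_i \sum_j X y i * X y j * (\sum_k X y k * D y i j k) = T3.
  apply: eq_bigr => i _; rewrite mulr_sumr.
  apply: eq_bigr => j _; rewrite !mulr_sumr; apply: eq_bigr => k _; ring.
have x5 : \sum_i \sum_j X y i * X y j * (\sum_k X y k * D y k j i) = T3.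
  rewrite /T3; under [RHS]eq_bigr do rewrite mulr_sumr.
  rewrite [RHS]exchange_big/= exchange_big/=; apply: eq_bigr => i _.
  under [RHS]eq_bigr do rewrite mulr_sumr.
  rewrite [RHS]exchange_big/=; apply: eq_bigr => j _.
  rewrite mulr_sumr; apply: eq_bigr => k _; ring.
have x6 : \sum_i \sum_j X y i * X y j * h y j i = w.
  rewrite exchange_big/= -wE; apply: eq_bigr => i _; rewrite -(sum_grad_h _ Uy) mulr_sumr.
  by apply: eq_bigr => j _; ring.
rewrite k1 k2 k3 k4 k5 k6 x1 x2 x3 x4 x5 x6.
have -> : w = q ^+ 2 - L ^+ 2 by rewrite qE addrC addKr.
by field; rewrite !gt_eqF.
Qed.

End graph_geometry.

(** * Functions on a manifold *)

Section C1_local.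
Context {R : realType} {d : nat}.

Lemma C1_local (U : set 'rV[R]_d) (f : 'rV[R]_d -> R) :
  (forall x, U x -> exists V : set 'rV[R]_d, [/\ open V, V x & C1 V f]) -> C1 U f.
Proof. by move=> H; apply/C1P => x /H[V [_ Vx cf]]; exact: C1_at cf Vx. Qed.

Lemma C1_extend0 (U K : set 'rV[R]_d) (f : 'rV[R]_d -> R) :
  open U -> closed K -> K `<=` U -> C1 U f ->
  (forall x, U x -> ~ K x -> f x = 0) -> C1 setT (f \_ U).
Proof.
move=> oU cK KU cf f0; apply: C1_local => x _.
have [Ux|Ux] := pselect (U x).
  exists U; split => //; apply: (C1_eq oU _ cf) => y Uy.
  by rewrite patchE mem_set.
exists (~` K); split; first exact: closed_openC.
  by move/KU.
apply: (C1_eq (closed_openC cK) _ (C1_cst 0 (closed_openC cK))) => y Ky.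
rewrite patchE; case: ifPn => // /set_mem Uy.
by rewrite f0.
Qed.

Lemma continuous_extend0 (U K : set 'rV[R]_d) (f : 'rV[R]_d -> R) :
  open U -> closed K -> K `<=` U -> (forall x, U x -> {for x, continuous f}) ->
  (forall x, U x -> ~ K x -> f x = 0) -> continuous (f \_ U).
Proof.
move=> oU cK KU cf f0 x.
have [Ux|Ux] := pselect (U x).
  apply: near_eq_continuous (cf x Ux).
  apply: filterS (open_nbhs_nbhs (conj oU Ux)) => y Uy.
  by rewrite patchE mem_set.
have Kx : (~` K) x by move/KU.
apply: (@near_eq_continuous _ _ (fun=> 0)); last exact: cst_continuous.
apply: filterS (open_nbhs_nbhs (conj (closed_openC cK) Kx)) => y Ky.
by rewrite patchE; case: ifPn => // /set_mem Uy; rewrite f0.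
Qed.

End C1_local.

Section charts.
Context {R : realType} {d : nat} {S : ptopologicalType} (A : atlas R d S).
Hypothesis sA : smooth_atlas A.
Implicit Types (i j : chart A) (t : S) (x : 'rV[R]_d) (f g : S -> R).

Lemma chart_cover t : exists i : chart A, chart_dom i t.
Proof. by have [/seteqP[_ /(_ t I)[i _ it]] _] := sA; exists i. Qed.

Definition chart_at t : chart A := projT1 (cid (chart_cover t)).

Lemma chart_atP t : chart_dom (chart_at t) t.
Proof. by rewrite /chart_at; case: cid. Qed.

Lemma open_chart_dom i : open (chart_dom i).
Proof. by have [_ [/(_ i)[]]] := sA. Qed.

Lemma open_chart_image i : open (chart_image i).
Proof. by have [_ [/(_ i)[]]] := sA. Qed.

Arguments open_chart_image : clear implicits.

Lemma chart_mapK i t : chart_dom i t -> chart_inv i (chart_map i t) = t.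
Proof. by have [_ [/(_ i)[_ _ _ _ H] _]] := sA; exact: H. Qed.

Lemma chart_map_image i t : chart_dom i t -> chart_image i (chart_map i t).
Proof. by exists t. Qed.

Lemma chart_inv_dom i x : chart_image i x -> chart_dom i (chart_inv i x).
Proof. by case=> t it <-; rewrite chart_mapK. Qed.

Lemma chart_invK i x : chart_image i x -> chart_map i (chart_inv i x) = x.
Proof. by case=> t it <-; rewrite chart_mapK. Qed.

Lemma chart_map_continuous i t : chart_dom i t -> {for t, continuous (chart_map i)}.
Proof.
have [_ [/(_ i)[oD _ cm _ _] _]] := sA.
by move: cm; rewrite continuous_open_subspace// => cm it; apply: cm; rewrite inE.
Qed.

Lemma chart_inv_continuous i x : chart_image i x -> {for x, continuous (chart_inv i)}.
Proof.
have [_ [/(_ i)[_ oD _ cm _] _]] := sA.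
by move: cm; rewrite continuous_open_subspace// => cm it; apply: cm; rewrite inE.
Qed.

Lemma open_preimage_chart_inv i (V : set S) : open V ->
  open (chart_image i `&` chart_inv i @^-1` V).
Proof.
move=> oV; rewrite openE => x [ix Vx]; rewrite /interior; apply: filterI.
  by apply: open_nbhs_nbhs; split=> //; exact: open_chart_image.
by apply: (chart_inv_continuous ix); apply: open_nbhs_nbhs.
Qed.

Lemma open_preimage_chart_map i (V : set 'rV[R]_d) : open V ->
  open (chart_dom i `&` chart_map i @^-1` V).
Proof.
move=> oV; rewrite openE => x [ix Vx]; rewrite /interior; apply: filterI.
  by apply: open_nbhs_nbhs; split=> //; exact: open_chart_dom.
by apply: (chart_map_continuous ix); apply: open_nbhs_nbhs.
Qed.

Lemma overlapP i j x :
  overlap i j x <-> chart_image i x /\ chart_dom j (chart_inv i x).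
Proof.
split=> [[t [it jt] <-]|[ix jx]].
  by rewrite chart_mapK//; split=> //; exact: chart_map_image.
by exists (chart_inv i x); [split=> //; exact: chart_inv_dom|exact: chart_invK].
Qed.

Lemma open_overlap i j : open (overlap i j).
Proof.
rewrite (_ : overlap i j = chart_image i `&` chart_inv i @^-1` chart_dom j).
  by apply: open_preimage_chart_inv; exact: open_chart_dom.
by apply/seteqP; split=> x; move/overlapP.
Qed.

Arguments open_overlap : clear implicits.

Lemma transition_inv i j x : overlap i j x ->
  chart_inv j (transition i j x) = chart_inv i x.
Proof. by move=> /overlapP[ix jx]; rewrite /transition chart_mapK. Qed.

Lemma transition_overlap i j x : overlap i j x -> overlap j i (transition i j x).
Proof.
move=> ijx; have /overlapP[ix jx] := ijx; apply/overlapP; split.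
  exact: chart_map_image.
by rewrite transition_inv//; exact: chart_inv_dom.
Qed.

Lemma C1_transition i j (a : 'I_d) :
  C1 (overlap i j) (fun x => transition i j x 0 a).
Proof. by have [_ [_ /(_ i j a)]] := sA; exact: smooth_C1. Qed.

Arguments C1_transition : clear implicits.

Definition C1_manifold f := forall i, C1 (chart_image i) (fun x => f (chart_inv i x)).

Lemma chart_continuous f :
  (forall i x, chart_image i x -> {for x, continuous (fun x => f (chart_inv i x))}) ->
  continuous f.
Proof.
move=> cf t; pose i := chart_at t; have it := chart_atP t.
apply: (@near_eq_continuous _ _ ((fun x => f (chart_inv i x)) \o chart_map i)).
  apply: filterS (open_nbhs_nbhs (conj (open_chart_dom i) it)) => s si /=.
  by rewrite chart_mapK.
apply: continuous_comp; first exact: chart_map_continuous.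
by apply: cf; exact: chart_map_image.
Qed.

Lemma C1_manifold_continuous f : C1_manifold f -> continuous f.
Proof. by move=> cf; apply: chart_continuous => i x ix; exact: C1_continuous (cf i) ix. Qed.

Lemma C1_manifoldM f g : C1_manifold f -> C1_manifold g ->
  C1_manifold (fun t => f t * g t).
Proof. by move=> cf cg i; exact: (C1M (open_chart_image i) (cf i) (cg i)). Qed.

Lemma C1_manifoldB f g : C1_manifold f -> C1_manifold g ->
  C1_manifold (fun t => f t - g t).
Proof.
move=> cf cg i.
exact: (C1D (open_chart_image i) (cf i) (C1N (open_chart_image i) (cg i))).
Qed.

Lemma C1_manifold_cst (a : R) : C1_manifold (fun=> a).
Proof. by move=> i; exact: (C1_cst a (open_chart_image i)). Qed.

Lemma C1_manifold_extend i (K : set 'rV[R]_d) (b : 'rV[R]_d -> R) :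
  hausdorff_space S -> compact K -> K `<=` chart_image i -> C1 setT b ->
  (forall x, ~ K x -> b x = 0) ->
  C1_manifold ((fun t => b (chart_map i t)) \_ (chart_dom i)).
Proof.
move=> hS cK KU cb b0 j; apply: C1_local => x jx.
have [it|it] := pselect (chart_dom i (chart_inv j x)).
  exists (overlap j i); split; first exact: open_overlap.
    exact/overlapP.
  apply: (C1_eq (f := b \o transition j i)); first exact: open_overlap.
    by move=> y /overlapP[jy iy] /=; rewrite patchE mem_set.
  apply: (C1_comp (open_overlap j i) openT (C1_transition j i) cb).
  by [].
pose V := chart_image j `&` chart_inv j @^-1` (~` (chart_inv i @` K)).
have cl : closed (chart_inv i @` K).
  apply: compact_closed => //; apply: continuous_compact => //.
  apply: continuous_in_subspaceT => y /set_mem Ky.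
  by apply: chart_inv_continuous; exact: KU.
have oV : open V by apply: open_preimage_chart_inv; exact: closed_openC.
exists V; split=> //.
  split=> //= -[y Ky yx]; apply: it; rewrite -yx; apply: chart_inv_dom.
  exact: KU.
apply: (C1_eq oV _ (C1_cst 0 oV)) => y [jy Ky]; rewrite patchE.
case: ifPn => // /set_mem iy; rewrite b0// => Kb; apply: Ky => /=.
by exists (chart_map i (chart_inv j y)) => //; rewrite chart_mapK.
Qed.

End charts.
Arguments open_chart_image {R d S A} sA i.
Arguments open_overlap {R d S A} sA i j.
Arguments C1_transition {R d S A} sA i j a.

Section gradient_product.
Context {R : realType} {d : nat} {S : ptopologicalType} (A : atlas R d S).
Variable h : chart A -> 'rV[R]_d -> 'M[R]_d.
Hypotheses (sA : smooth_atlas A) (rh : riemannian_metric h).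
Implicit Types (i j : chart A) (t : S) (x : 'rV[R]_d) (f g : S -> R).

Lemma C1_metric i a b : C1 (chart_image i) (fun x => h i x a b).
Proof. by have [/(_ i)[/(_ a b)/smooth_C1]] := rh. Qed.

Lemma metric_posdef i x : chart_image i x -> posdef (h i x).
Proof.
move=> ix; have [/(_ i)[_ hT h0] _] := rh; split; first exact: hT.
by move=> X X0; exact: h0.
Qed.

Definition local_gdot i f g x : R :=
  (grad (h i) (fun x => g (chart_inv i x)) x
   *m (gradrow (fun x => f (chart_inv i x)) x)^T) 0 0.

Definition gdot f g t : R := local_gdot (chart_at sA t) f g (chart_map (chart_at sA t) t).

Lemma gradrow_transition f i j x : C1_manifold A f -> overlap i j x ->
  gradrow (fun x => f (chart_inv i x)) x =
  gradrow (fun x => f (chart_inv j x)) (transition i j x) *m ('J (transition i j) x)^T.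
Proof.
move=> cf ijx; apply/rowP => a; rewrite [LHS]mxE.
have oij := open_overlap sA i j.
have jT : chart_image j (transition i j x).
  by have /(overlapP sA)[] := transition_overlap sA ijx.
rewrite (partial_eq (U := overlap i j)
   (g := (fun x => f (chart_inv j x)) \o transition i j) a oij _ ijx); last first.
  by move=> y ijy /=; rewrite transition_inv.
rewrite (partial_comp oij (open_chart_image sA j) (C1_transition sA i j) a (cf j) ijx jT).
rewrite mxE; apply: eq_bigr => b _.
by rewrite [gradrow _ _ _ _]mxE [_^T _ _]mxE mulrC.
Qed.

Lemma local_gdot_transition f g i j x : C1_manifold A f -> C1_manifold A g ->
  overlap i j x -> local_gdot i f g x = local_gdot j f g (transition i j x).
Proof.
move=> cf cg ijx; rewrite /local_gdot /grad !(gradrow_transition _ ijx)//.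
have /(overlapP sA)[ix _] := ijx.
have /(overlapP sA)[jx _] := transition_overlap sA ijx.
have ui := posdef_unit (metric_posdef ix).
have [_ /(_ i j x ijx) hE] := rh.
set J := 'J _ x in hE *; set H := h j _ in hE *.
have uJ : J \in unitmx.
  by move: ui; rewrite hE !unitmxE !det_mulmx !unitrM => /andP[/andP[]].
have uJT : J^T \in unitmx by rewrite unitmx_tr.
have uH : H \in unitmx by exact: posdef_unit (metric_posdef jx).
have -> : invmx (h i x) = invmx J^T *m invmx H *m invmx J.
  rewrite hE; set B := _ *m _ *m _; set C := _ *m _ *m invmx J.
  have BC : B *m C = 1%:M.
    rewrite /B /C !mulmxA mulmxK// mulmxK//.
    by rewrite mulmxV.
  have uB : B \in unitmx by have [] := mulmx1_unit BC.
  by rewrite -[LHS]mulmx1 -BC mulKmx.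
congr (_ 0 0); rewrite trmx_mul trmxK !mulmxA mulmxK//.
by rewrite mulmxKV.
Qed.

Lemma gdotE f g i t : C1_manifold A f -> C1_manifold A g -> chart_dom i t ->
  gdot f g t = local_gdot i f g (chart_map i t).
Proof.
move=> cf cg it; rewrite /gdot; set j := chart_at sA t.
have jt : chart_dom j t by exact: chart_atP.
rewrite (@local_gdot_transition f g j i)//; last by exists t.
by rewrite /transition chart_mapK.
Qed.

Lemma gdot_inv f g i x : C1_manifold A f -> C1_manifold A g -> chart_image i x ->
  gdot f g (chart_inv i x) = local_gdot i f g x.
Proof.
move=> cf cg ix; rewrite (gdotE cf cg (chart_inv_dom sA ix)).
by rewrite chart_invK.
Qed.

Lemma local_gdotE f g i x :
  local_gdot i f g x = \sum_a grad (h i) (fun x => g (chart_inv i x)) x 0 a *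
    partial a (fun x => f (chart_inv i x)) x.
Proof.
by rewrite /local_gdot mxE; apply: eq_bigr => a _; congr (_ * _); rewrite 2!mxE.
Qed.

Lemma gdotDl f1 f2 g t : C1_manifold A f1 -> C1_manifold A f2 ->
  gdot (fun t => f1 t + f2 t) g t = gdot f1 g t + gdot f2 g t.
Proof.
move=> c1 c2; rewrite /gdot !local_gdotE -big_split/=; apply: eq_bigr => a _.
set i := chart_at sA t; have it : chart_image i (chart_map i t).
  by apply: chart_map_image; exact: chart_atP.
by rewrite (partialD a it (c1 i) (c2 i)) mulrDr.
Qed.

Lemma gdot_continuous f g : C1_manifold A f -> C1_manifold A g -> continuous (gdot f g).
Proof.
move=> cf cg; apply: (chart_continuous sA) => i x ix.
have oi := open_chart_image sA i.
apply: (@near_eq_continuous _ _ (local_gdot i f g)).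
  apply: filterS (open_nbhs_nbhs (conj oi ix)) => y iy.
  by rewrite gdot_inv.
rewrite (_ : local_gdot i f g = fun x => \sum_a grad (h i) (fun x => g (chart_inv i x)) x 0 a *
    partial a (fun x => f (chart_inv i x)) x); last first.
  by apply/funext => y; rewrite local_gdotE.
apply: continuous_bigsum => a _; apply: continuousM; last first.
  by have [_ _] := C1_at (cf i) ix; exact.
apply: (@near_eq_continuous _ _ (fun y => \sum_b partial b (fun x => g (chart_inv i x)) y * invmx (h i y) b a)).
  apply: filterS (open_nbhs_nbhs (conj oi ix)) => y iy.
  by rewrite /grad mxE; apply: eq_bigr => b _; congr (_ * _); rewrite mxE.
apply: continuous_bigsum => b _; apply: continuousM.
  by have [_ _] := C1_at (cg i) ix; exact.
have uh y : chart_image i y -> h i y \in unitmx by move=> /metric_posdef/posdef_unit.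
have cK := C1_invmx oi b a uh (@C1_metric i).
by have [+ _ _] := C1_at cK ix; exact.
Qed.

End gradient_product.

(** * Riemannian volume in charts *)

Lemma compact_nat_cover {S : ptopologicalType} (V : S -> set S) :
  compact [set: S] -> (forall t, open (V t)) -> (forall t, V t t) ->
  exists (c : nat -> S) (N : nat), forall t, exists2 k, (k < N)%N & V (c k) t.
Proof.
rewrite compact_cover => cS oV Vt.
have [//||D _ DS] := cS _ setT V; first by move=> t _; exists t.
exists (nth point (finmap.enum_fset D)), (size (finmap.enum_fset D)) => t; have [s sD Vst] := DS t I.
exists (index s (finmap.enum_fset D)); first by rewrite index_mem.
by rewrite nth_index.
Qed.

Lemma compact_continuous_bounded {S : ptopologicalType} {R : realType} (f : S -> R) :
  compact [set: S] -> continuous f -> exists M, forall t, `|f t| <= M.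
Proof.
move=> cS cf.
have cn : {within [set: S], continuous (fun t => `|f t|)}.
  apply: continuous_subspaceT => t; apply: continuous_comp; first exact: cf.
  exact: norm_continuous.
have [c _ cM] := compact_EVT_max (ex_intro _ point I) cS cn.
by exists `|f c| => t; apply: cM; rewrite inE.
Qed.

Lemma integral_indic_ball {R : realType} d (x : 'rV[R]_d) (e c : R) : 0 < e -> 0 <= c ->
  (\int[lebesgue_rV d]_y (c * \1_(ball x e) y)%:E = (c * (e *+ 2) ^+ d)%:E)%E.
Proof.
move=> e0 c0; have mB : measurable (ball x e : set (borel 'rV[R]_d)).
  by apply: borel_open; exact: ball_open.
under eq_integral do rewrite EFinM.
rewrite ge0_integralZl//; last exact/measurable_EFinP/measurable_indic.
rewrite integral_indic//.
by rewrite EFinM; congr (_ * _)%E; rewrite setIT; exact: lebesgue_rV_ball.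
Qed.

Section chart_integral.
Context {R : realType} {d : nat} {S : ptopologicalType} (A : atlas R d S).
Hypothesis sA : smooth_atlas A.
Variables (mu : {measure set (borel S) -> \bar R}).
Variables (g : chart A -> 'rV[R]_d -> 'M[R]_d).
Hypothesis vmu : riemannian_volume mu g.
Hypothesis cg : forall i x, chart_image i x ->
  {for x, continuous (fun x => Num.sqrt (\det (g i x)))}.

Definition chart_density i : 'rV[R]_d -> R :=
  (fun x => Num.sqrt (\det (g i x))) \_ (chart_image i).

(* Unlike [chart_inv i], a Borel function on the whole of R^d. *)
Definition chart_inv0 (i : chart A) (x : 'rV[R]_d) : S :=
  if x \in chart_image i then chart_inv i x else point.

Lemma measurable_chart_inv0 i :
  measurable_fun setT (chart_inv0 i : borel 'rV[R]_d -> borel S).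
Proof.
apply: measurable_fun_to_borel => O oO; rewrite setTI.
have m1 : measurable (chart_image i : set (borel 'rV[R]_d)).
  exact: (borel_open (open_chart_image sA i)).
have m2 := borel_open (@open_preimage_chart_inv _ _ _ _ sA i _ oO).
have [pO|pO] := pselect (O point).
  rewrite (_ : _ @^-1` _ = (chart_image i `&` chart_inv i @^-1` O) `|` ~` chart_image i).
    by apply: measurableU => //; exact: measurableC.
  apply/seteqP; split=> x /=; rewrite /chart_inv0; case: ifPn => [/set_mem|/negP]; rewrite ?inE; tauto.
rewrite (_ : _ @^-1` _ = (chart_image i `&` chart_inv i @^-1` O))//.
apply/seteqP; split=> x /=; rewrite /chart_inv0; case: ifPn => [/set_mem|/negP]; rewrite ?inE; tauto.
Qed.

Lemma measurable_chart_density i :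
  measurable_fun setT (chart_density i : borel 'rV[R]_d -> R).
Proof.
have oi := open_chart_image sA i.
apply/(measurable_restrictT _ _).1; first exact: borel_open.
exact: (borel_continuous_on oi (@cg i)).
Qed.

Lemma chart_density_ge0 i x : 0 <= chart_density i x.
Proof. by rewrite /chart_density patchE; case: ifPn => // _; exact: sqrtr_ge0. Qed.

Lemma chart_measureE i (B : set S) : measurable (B : set (borel S)) ->
  B `<=` chart_dom i ->
  mu B = (\int[lebesgue_rV d]_x
    ((chart_density i x)%:E * (\1_B (chart_inv0 i x))%:E))%E.
Proof.
move=> mB Bi; rewrite (vmu mB Bi) -lebesgue_intE.
- congr lebesgue_int; apply/funext => x; rewrite /chart_density /chart_inv0 !patchE.
  case: ifPn => [/set_mem[t Bt <-]|xB].
    by rewrite chart_mapK//; [rewrite !mem_set//; [rewrite indicE mem_set// mule1|exists t => //; exact: Bi]|exact: Bi].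
  case: ifPn => [/set_mem ix|_]; last by rewrite mul0e.
  rewrite indicE (_ : _ \in B = false) ?mule0//; apply/negbTE; apply: contra xB.
  rewrite !inE => Bx; exists (chart_inv i x) => //; exact: chart_invK.
- apply: emeasurable_funM; apply/measurable_EFinP.
    exact: measurable_chart_density.
  apply: (measurableT_comp _ (measurable_chart_inv0 i)); exact: measurable_indic.
- by move=> x; rewrite mule_ge0// lee_fin ?chart_density_ge0.
Qed.

Lemma ge0_chart_integral i (f : S -> \bar R) :
  measurable_fun setT (f : borel S -> \bar R) -> (forall t, 0 <= f t)%E ->
  (\int[mu]_(t in chart_dom i) f t =
   \int[lebesgue_rV d]_x ((chart_density i x)%:E * f (chart_inv0 i x)))%E.
Proof.
move=> mf f0.
rewrite (ge0_integral_density (measurable_chart_inv0 i) (measurable_chart_density i)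
  (chart_density_ge0 i) (borel_open (open_chart_dom sA i)) (@chart_measureE i) mf f0).
apply: eq_integral => x _; rewrite /chart_density /chart_inv0 patchE.
case: ifPn => [/set_mem ix|]; last by rewrite !mul0e.
by rewrite indicE mem_set ?mule1//; exact: chart_inv_dom.
Qed.

Lemma chart_integral i (f : S -> R) :
  measurable_fun setT (f : borel S -> R) -> (forall t, ~ chart_dom i t -> f t = 0) ->
  (\int[mu]_t (f t)%:E = \int[lebesgue_rV d]_x
   (((fun x => Num.sqrt (\det (g i x)) * f (chart_inv i x)) \_ (chart_image i)) x)%:E)%E.
Proof.
move=> mf f0; have mi := borel_open (open_chart_dom sA i).
have E (k : S -> \bar R) : measurable_fun setT (k : borel S -> \bar R) ->
    (forall t, 0 <= k t)%E -> (forall t, ~ chart_dom i t -> k t = 0)%E ->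
    (\int[mu]_t k t =
     \int[lebesgue_rV d]_x ((chart_density i x)%:E * k (chart_inv0 i x)))%E.
  move=> mk k0 ki; rewrite -ge0_chart_integral// [RHS]integral_mkcond.
  apply: eq_integral => t _; rewrite patchE; case: ifPn => // /negP ti.
  by apply: ki => it; apply: ti; rewrite inE.
rewrite integralE [RHS]integralE; congr (_ - _)%E; rewrite E.
- apply: eq_integral => x _; rewrite /chart_density /chart_inv0 !funeposE !patchE.
  case: ifPn => _; last by rewrite mul0e maxxx.
  by rewrite EFinM maxe_pMr ?mule0// lee_fin sqrtr_ge0.
- exact/measurable_funepos/measurable_EFinP.
- by move=> t; exact: funepos_ge0.
- by move=> t /f0 ft; rewrite funeposE ft maxxx.
- apply: eq_integral => x _; rewrite /chart_density /chart_inv0 !funenegE !patchE.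
  case: ifPn => _; last by rewrite mul0e oppe0 maxxx.
  by rewrite EFinM -muleN maxe_pMr ?mule0// lee_fin sqrtr_ge0.
- exact/measurable_funeneg/measurable_EFinP.
- by move=> t; exact: funeneg_ge0.
- by move=> t /f0 ft; rewrite funenegE ft oppe0 maxxx.
Qed.

Lemma locally_finite_volume t : exists V : set S, [/\ open V, V t & (mu V < +oo)%E].
Proof.
pose i := chart_at sA t; have it : chart_dom i t := chart_atP sA t.
pose x := chart_map i t; have ix : chart_image i x by exact: chart_map_image.
pose D x := Num.sqrt (\det (g i x)).
have : \forall y \near x, D y < D x + 1.
  by have /cvgrPdist_lt/(_ 1 ltr01) := cg ix; apply: filterS => y; rewrite ltr_distlC => /andP[].
move/nbhs_ballP => [e /= e0 eD].
pose V := chart_dom i `&` chart_map i @^-1` ball x e.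
have oV : open V by apply: open_preimage_chart_map => //; exact: ball_open.
exists V; split=> //; first by split=> //; exact: ballxx.
rewrite (chart_measureE (borel_open oV) (@subIsetl _ _ _)).
apply: (@le_lt_trans _ _ (\int[lebesgue_rV d]_y ((D x + 1) * \1_(ball x e) y)%:E)%E).
  have mB : measurable (ball x e : set (borel 'rV[R]_d)) by apply: borel_open; exact: ball_open.
  apply: ge0_le_integral => //.
  - by move=> y _; rewrite mule_ge0// lee_fin ?chart_density_ge0.
  - apply: emeasurable_funM; apply/measurable_EFinP.
      exact: measurable_chart_density.
    apply: (measurableT_comp _ (measurable_chart_inv0 i)).
    by apply: measurable_indic; exact: borel_open.
  - apply/measurable_EFinP/measurable_funM => //.
  - move=> y _; rewrite -EFinM lee_fin /chart_density /chart_inv0 patchE.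
    have D0 : 0 <= D x + 1 by rewrite addr_ge0// sqrtr_ge0.
    case: ifPn => [/set_mem iy|_]; last by rewrite mul0r mulr_ge0.
    rewrite !indicE; have [/set_mem[_ /=]|_] := boolP (chart_inv i y \in V).
      rewrite chart_invK// => xy; rewrite mem_set// !mulr1; apply: ltW.
      exact: eD.
    by rewrite mulr0 mulr_ge0.
by rewrite integral_indic_ball// ?ltry// addr_ge0// sqrtr_ge0.
Qed.

Hypothesis cS : compact [set: S].

Lemma volume_finite : (mu setT < +oo)%E.
Proof.
pose V t := projT1 (cid (locally_finite_volume t)).
have VP t : [/\ open (V t), V t t & (mu (V t) < +oo)%E] by rewrite /V; case: cid.
have [||c [N cN]] := @compact_nat_cover S V cS; try by move=> t; have [] := VP t.
have mV k : measurable (V k : set (borel S)) by apply: borel_open; have [] := VP k.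
apply: (@le_lt_trans _ _ (\sum_(k < N) mu (V (c k)))%E).
  apply: (@content_subadditive _ _ _ mu setT (fun k => V (c k)) N) => //.
  by move=> t _ /=; have [k kN Vk] := cN t; rewrite -(bigcup_mkord _ (fun k => V (c k))); exists k.
by apply: lte_sum_pinfty => k _; have [] := VP (c k).
Qed.

Lemma integrable_continuous (f : S -> R) : continuous f ->
  mu.-integrable setT (EFin \o f : borel S -> \bar R).
Proof.
move=> cf; apply: measurable_bounded_integrable => //.
- exact: volume_finite.
- exact: borel_continuous.
have [M fM] := compact_continuous_bounded cS cf.
by exists M; split; [exact: num_real|move=> N MN t _; exact: le_trans (fM t) (ltW MN)].
Qed.

Hypothesis g0 : forall i x, chart_image i x -> 0 < \det (g i x).

Lemma volume_open_gt0 (V : set S) t : open V -> V t -> (0 < mu V)%E.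
Proof.
move=> oV Vt.
pose i := chart_at sA t; have it : chart_dom i t := chart_atP sA t.
pose x := chart_map i t; have ix : chart_image i x by exact: chart_map_image.
pose D x := Num.sqrt (\det (g i x)).
have Dx : 0 < D x by rewrite sqrtr_gt0 g0.
pose W := chart_image i `&` chart_inv i @^-1` V.
have oW : open W by exact: open_preimage_chart_inv.
have Wx : W x by split=> //=; rewrite /x chart_mapK.
have D2 : 0 < D x / 2 by rewrite divr_gt0.
have : \forall y \near x, W y /\ D x / 2 < D y.
  apply: filterI; first exact: open_nbhs_nbhs.
  have /cvgrPdist_lt/(_ _ D2) := cg ix; apply: filterS => y.
  by rewrite ltr_distlC => /andP[+ _]; apply: le_lt_trans; rewrite [X in _ <= X - _]splitr addrK.
move/nbhs_ballP => [e /= e0 eD].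
have oi := open_chart_dom sA i.
have mV : measurable (V `&` chart_dom i : set (borel S)) by apply: borel_open; exact: openI.
apply: (@lt_le_trans _ _ (mu (V `&` chart_dom i))); last first.
  apply: le_measure; rewrite ?inE; [exact: mV|exact: borel_open|exact: subIsetl].
rewrite (chart_measureE mV (@subIsetr _ _ _)).
apply: (@lt_le_trans _ _ (\int[lebesgue_rV d]_y (D x / 2 * \1_(ball x e) y)%:E)%E).
  rewrite (integral_indic_ball x e0 (ltW D2)).
  by rewrite lte_fin mulr_gt0// exprn_gt0// pmulrn_lgt0.
apply: ge0_le_integral => //.
- by move=> y _; rewrite lee_fin mulr_ge0// divr_ge0// ltW.
- apply/measurable_EFinP/measurable_funM => //.
  by apply: measurable_indic; apply: borel_open; exact: ball_open.
- apply: emeasurable_funM; apply/measurable_EFinP.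
    exact: measurable_chart_density.
  apply: (measurableT_comp _ (measurable_chart_inv0 i)).
  exact: measurable_indic.
move=> y _; rewrite -EFinM lee_fin /chart_density /chart_inv0 patchE.
have [xy|xy] := pselect (ball x e y); last first.
  rewrite [in leLHS]indicE memNset// mulr0 mulr_ge0//.
  by case: ifPn => // _; exact: sqrtr_ge0.
have [[iy Vy] Dy] := eD y xy.
rewrite mem_set// !indicE !mem_set ?mulr1//; first exact: ltW.
by split=> //; exact: chart_inv_dom.
Qed.

Lemma integral_continuous_gt0 (f : S -> R) t : continuous f ->
  (forall s, 0 <= f s) -> 0 < f t -> (0 < \int[mu]_s (f s)%:E)%E.
Proof.
move=> cf f0 ft.
pose V := [set s | f t / 2 < f s].
have oV : open V.
  rewrite (_ : V = f @^-1` [set x | f t / 2 < x])//.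
  by move/continuousP : cf; apply; exact: open_gt.
have mV : measurable (V : set (borel S)) by exact: borel_open.
have Vt : V t by rewrite /V /= ltr_pdivrMr// ltr_pMr// ltr1n.
apply: (@lt_le_trans _ _ (\int[mu]_s (f t / 2 * \1_V s)%:E)%E).
  under eq_integral do rewrite EFinM.
  rewrite ge0_integralZl//; last by rewrite lee_fin divr_ge0// ltW.
    rewrite integral_indic// setIT mule_gt0//; first by rewrite lte_fin divr_gt0.
    exact: volume_open_gt0 Vt.
  exact/measurable_EFinP.
apply: ge0_le_integral => //.
- by move=> s _; rewrite lee_fin mulr_ge0// divr_ge0// ltW.
- by apply/measurable_EFinP/measurable_funM.
- by apply/measurable_EFinP; exact: borel_continuous.
move=> s _; rewrite lee_fin indicE; have [/set_mem Vs|_] := boolP (s \in V).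
  by rewrite mulr1 ltW.
by rewrite mulr0.
Qed.

End chart_integral.

(** * Bump functions *)

Section bump.
Context {R : realType}.
Implicit Types y : R.

Definition pos_sqr y : R := Num.max y 0 ^+ 2.

Lemma pos_sqr_taylor y s :
  `|pos_sqr (y + s) - pos_sqr y - s * (2 * Num.max y 0)| <= s ^+ 2.
Proof.
rewrite /pos_sqr ler_norml /Num.max.
by case: ltP => h1; case: ltP => h2; apply/andP; split; nra.
Qed.

Global Instance is_derive_pos_sqr y : is_derive y 1 pos_sqr (2 * Num.max y 0).
Proof.
suff cv : (fun s : R => s^-1 *: ((pos_sqr \o shift y) (s *: 1) - pos_sqr y)) @ 0^' -->
    (2 * Num.max y 0 : R).
  by apply: DeriveDef; [apply/cvg_ex; eexists; exact: cv|exact: cvg_lim cv].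
apply/cvgrPdist_le => e e0; near=> s.
have s0 : s != 0 by near: s; exact: nbhs_dnbhs_neq.
rewrite distrC /= /GRing.scale /= mulr1 [s + y]addrC.
rewrite (_ : _ - _ = s^-1 * (pos_sqr (y + s) - pos_sqr y - s * (2 * Num.max y 0))); last first.
  by rewrite [in RHS]mulrBr mulKf.
rewrite normrM normfV mulrC ler_pdivrMr ?normr_gt0//.
apply: (le_trans (pos_sqr_taylor y s)).
rewrite -real_normK ?num_real// expr2 ler_wpM2r//.
near: s; apply: dnbhs0_le; exact: e0.
Unshelve. all: by end_near. Qed.

Lemma C1_pos_sqr d (U : set 'rV[R]_d) (f : 'rV[R]_d -> R) : open U -> C1 U f ->
  C1 U (fun x => pos_sqr (f x)).
Proof.
have E : derive1 pos_sqr = fun y => 2 * Num.max y 0.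
  by apply/funext => y; rewrite derive1E (@derive_val _ _ _ _ _ _ _ (is_derive_pos_sqr y)).
move=> oU cf; apply: (C1_comp1 oU cf) => x _.
  exact: (@ex_derive _ _ _ _ _ _ _ (is_derive_pos_sqr (f x))).
rewrite E; apply: continuousM; first exact: cst_continuous.
by apply: (@continuous_max R R idfun (fun=> 0)); [exact: cvg_id|exact: cst_continuous].
Qed.

Lemma bump_function d (U : set 'rV[R]_d) (x0 : 'rV[R]_d) : open U -> U x0 ->
  exists (b : 'rV[R]_d -> R) (K V : set 'rV[R]_d),
  [/\ C1 setT b, compact K, K `<=` U & forall x, ~ K x -> b x = 0] /\
  [/\ open V, V x0, forall x, V x -> b x = 1 & forall x, 0 <= b x <= 1].
Proof.
move=> oU Ux0.
have /nbhs_ballP[e /= e0 eU] : nbhs x0 U by exact: open_nbhs_nbhs.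
pose r := e / 2; have r0 : 0 < r by rewrite divr_gt0.
pose p (x : 'rV[R]_d) := \prod_(a < d) pos_sqr (r ^+ 2 - (x 0 a - x0 0 a) ^+ 2).
have cp : C1 setT p.
  apply: (C1_prod _ openT) => a _.
  have cc : C1 setT (fun x : 'rV[R]_d => x 0 a - x0 0 a).
    exact: (C1D openT (C1_coord a openT) (C1N openT (C1_cst (x0 0 a) openT))).
  apply: C1_pos_sqr openT _.
  exact: (C1D openT (C1_cst (r ^+ 2) openT) (C1N openT (C1M openT cc cc))).
have p_ge0 x : 0 <= p x by apply: prodr_ge0 => a _; exact: sqr_ge0.
have p0 : 0 < p x0.
  apply: prodr_gt0 => a _; rewrite subrr expr0n subr0 /pos_sqr max_l ?sqr_ge0//.
  by rewrite !exprn_gt0.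
pose b x := 1 - pos_sqr (1 - 2 / p x0 * p x).
have cb : C1 setT b.
  apply: (C1D openT (C1_cst 1 openT) (C1N openT (C1_pos_sqr openT _))).
  exact: (C1D openT (C1_cst 1 openT) (C1N openT (C1M openT (C1_cst (2 / p x0) openT) cp))).
pose K := [set x : 'rV[R]_d | `|x - x0| <= r].
exists b, K, [set x | p x0 / 2 < p x]; split; split.
- exact: cb.
- apply: bounded_closed_compact.
    exists (r + `|x0|); split; first exact: num_real.
    move=> N MN x /= xr; apply: le_trans (ltW MN).
    rewrite -[x in leLHS](subrK x0); apply: le_trans (ler_normD _ _) _.
    by rewrite lerD2r.
  rewrite (_ : K = (fun x : 'rV[R]_d => `|x - x0|) @^-1` [set y | y <= r])//.
  apply: closed_comp; last exact: closed_le.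
  move=> x _; apply: (@continuous_comp _ _ _ (fun x : 'rV[R]_d => x - x0) (fun x => `|x|)).
    by apply: continuousB; [exact: id|exact: cst_continuous].
  exact: norm_continuous.
- move=> x xr; apply: eU; rewrite -ball_normE /= distrC.
  by apply: (le_lt_trans xr); rewrite /r ltr_pdivrMr// ltr_pMr// ltr1n.
- move=> x xr.
  have [a xa] : exists a, r <= `|x 0 a - x0 0 a|.
    apply: contrapT => H; apply: xr.
    have : ball x0 r x.
      split=> // k a; rewrite ord1 -ball_normE /= distrC ltNge; apply/negP => ?.
      by apply: H; exists a.
    by rewrite -ball_normE /K /= distrC => /ltW.
  have px : p x = 0.
    rewrite /p (bigD1 a)//= /pos_sqr max_r ?expr0n ?mul0r//.
    by rewrite subr_le0 -[leRHS]real_normK ?num_real// lerXn2r// ?nnegrE// ltW.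
  by rewrite /b px mulr0 subr0 /pos_sqr max_l// expr1n subrr.
- rewrite (_ : [set _ | _] = p @^-1` [set y | p x0 / 2 < y])//.
  have /continuousP : continuous p by move=> x; exact: (C1_continuous cp I).
  by apply; exact: open_gt.
- by rewrite /= ltr_pdivrMr// ltr_pMr// ltr1n.
- move=> x /= px; rewrite /b /pos_sqr max_r ?expr0n ?subr0//.
  rewrite subr_le0 mulrAC ler_pdivlMr// mul1r.
  by rewrite mulrC -ler_pdivrMr// ltW.
- move=> x; rewrite /b subr_ge0 lerBlDr lerDl sqr_ge0 andbT.
  have h : 0 <= 2 / p x0 * p x by rewrite mulr_ge0// divr_ge0// ltW.
  rewrite /pos_sqr /Num.max; case: ltP => h2; first by rewrite expr0n ler01.
  by rewrite expr_le1// gerBl.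
Qed.

End bump.

Lemma manifold_bump {R : realType} {d : nat} {S : ptopologicalType} (A : atlas R d S) t :
  smooth_atlas A -> hausdorff_space S ->
  exists V : set S, [/\ open V, V t &
    exists (i : chart A) (K : set 'rV[R]_d) (b : S -> R),
    [/\ C1_manifold A b, compact K, K `<=` chart_image i &
        forall t, b t != 0 -> chart_dom i t /\ K (chart_map i t)] /\
    (forall t, V t -> b t = 1) /\ (forall t, 0 <= b t <= 1)].
Proof.
move=> sA hS; pose i := chart_at sA t; have it : chart_dom i t := chart_atP sA t.
have [b [K [V [[cb cK KU bK] [oV Vx bV b01]]]]] :=
  bump_function (open_chart_image sA i) (chart_map_image it).
exists (chart_dom i `&` chart_map i @^-1` V); split.
- exact: (open_preimage_chart_map sA).
- by [].
exists i, K, ((fun t => b (chart_map i t)) \_ (chart_dom i)); do 2?split.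
- exact: (@C1_manifold_extend _ _ _ _ sA i K b hS cK KU cb bK).
- exact: cK.
- exact: KU.
- move=> s; rewrite patchE; case: ifPn => [/set_mem si|]; last by rewrite eqxx.
  move=> bs; split=> //; apply: contrapT => /bK bs0; by rewrite bs0 eqxx in bs.
- by move=> s [si Vs]; rewrite patchE mem_set// bV.
- move=> s; rewrite patchE; case: ifPn => // _.
  by rewrite lexx ler01.
Qed.

Lemma integral_rV_continuous_gt0 {R : realType} {d : nat} (f : 'rV[R]_d -> R) x :
  continuous f -> (forall y, 0 <= f y) -> 0 < f x ->
  (0 < \int[lebesgue_rV d]_y (f y)%:E)%E.
Proof.
move=> cf f0 fx; have f2 : 0 < f x / 2 by rewrite divr_gt0.
have : \forall y \near x, f x / 2 < f y.
  have /cvgrPdist_lt/(_ _ f2) := cf x; apply: filterS => y.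
  by rewrite ltr_distlC => /andP[+ _]; apply: le_lt_trans; rewrite [X in _ <= X - _]splitr addrK.
move/nbhs_ballP => [e /= e0 eD].
apply: (@lt_le_trans _ _ (\int[lebesgue_rV d]_y (f x / 2 * \1_(ball x e) y)%:E)%E).
  rewrite (integral_indic_ball x e0 (ltW f2)).
  by rewrite lte_fin mulr_gt0// exprn_gt0// pmulrn_lgt0.
apply: ge0_le_integral => //.
- by move=> y _; rewrite lee_fin mulr_ge0// ltW.
- apply/measurable_EFinP/measurable_funM => //.
  apply: measurable_indic; apply: borel_open; exact: ball_open.
- by apply/measurable_EFinP; exact: borel_continuous.
move=> y _; rewrite lee_fin; have [xy|xy] := pselect (ball x e y); last first.
  by rewrite indicE memNset// mulr0.
by rewrite indicE mem_set// mulr1 ltW// eD.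
Qed.

(** * The integral inequality given by mean convexity *)

Section mean_convexity.
Context {R : realType} {d : nat} {S : ptopologicalType} {A : atlas R d S}.
Variable h : chart A -> 'rV[R]_d -> 'M[R]_d.
Hypotheses (sA : smooth_atlas A) (rh : riemannian_metric h).
Hypotheses (hS : hausdorff_space S) (cS : compact [set: S]).
Variable volS : {measure set (borel S) -> \bar R}.
Hypothesis vh : riemannian_volume volS h.
Variables (lam : R -> R) (u : S -> R).
Hypotheses (cu : C1_manifold A u)
  (cdu : forall (i : chart A) a,
    C1 (chart_image i) (partial a (fun x => u (chart_inv i x)))).
Hypotheses (lam0 : forall t, 0 < lam (u t)) (dlam : forall t, derivable lam (u t) 1)
  (clam : forall t, {for u t, continuous (derive1 lam)}).
Hypothesis mc : strictly_mean_convex h lam u.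

Local Notation gdotS := (gdot h sA).
Local Notation ui i := (fun x => u (chart_inv i x)).

Definition qfacS t : R := Num.sqrt (lam (u t) ^+ 2 + gdotS u u t).

Lemma qfacS_inv (i : chart A) x : chart_image i x ->
  qfacS (chart_inv i x) = qfac (h i) (ui i) lam x.
Proof. by move=> ix; rewrite /qfacS (gdot_inv sA rh cu cu ix). Qed.

Lemma gdotS_ge0 t : 0 <= gdotS u u t.
Proof.
have it := chart_atP sA t; rewrite (gdotE sA rh cu cu it).
exact: (@normsq_ge0 _ _ _ _ _ (@metric_posdef _ _ _ _ h rh (chart_at sA t)) _ (chart_map_image it)).
Qed.

Lemma qfacS_sqr t : qfacS t ^+ 2 = lam (u t) ^+ 2 + gdotS u u t.
Proof. by rewrite sqr_sqrtr// addr_ge0 ?sqr_ge0// gdotS_ge0. Qed.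

Lemma lam_le_qfacS t : lam (u t) <= qfacS t.
Proof.
rewrite -[leLHS](ger0_norm (ltW (lam0 t))) -sqrtr_sqr ler_wsqrtr// lerDl.
exact: gdotS_ge0.
Qed.

Lemma qfacS_gt0 t : 0 < qfacS t.
Proof. exact: lt_le_trans (lam0 t) (lam_le_qfacS t). Qed.

Lemma lam_u_continuous : continuous (fun t => lam (u t)).
Proof.
move=> t; apply: continuous_comp; first exact: (C1_manifold_continuous sA cu).
apply: differentiable_continuous; apply/derivable1_diffP; exact: dlam.
Qed.

Lemma dlam_u_continuous : continuous (fun t => derive1 lam (u t)).
Proof.
move=> t; apply: continuous_comp; last exact: clam.
exact: (C1_manifold_continuous sA cu).
Qed.

Lemma qfacS_continuous : continuous qfacS.
Proof.
move=> t; apply: (@continuous_comp _ _ _ (fun t => lam (u t) ^+ 2 + gdotS u u t) Num.sqrt).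
  apply: (@continuousD R R^o S (fun t => lam (u t) ^+ 2) (gdotS u u) t); last exact: (@gdot_continuous _ _ _ _ h sA rh u u cu cu).
  by apply: continuousM; exact: lam_u_continuous.
exact: sqrt_continuous.
Qed.

Lemma gdot_near0 f t (V : set S) : C1_manifold A f -> open V -> V t ->
  (forall s, V s -> f s = 0) -> gdotS f u t = 0.
Proof.
move=> cf oV Vt f0; have it := chart_atP sA t; set i := chart_at sA t in it.
rewrite (gdotE sA rh cf cu it) local_gdotE big1// => a _.
have oW := @open_preimage_chart_inv _ _ _ _ sA i _ oV.
rewrite (partial_eq (U := chart_image i `&` chart_inv i @^-1` V) (g := fun=> 0) a oW).
- by rewrite partial_cst mulr0.
- by move=> x [_ /f0].
- by split; [exact: chart_map_image|rewrite /preimage /= chart_mapK].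
Qed.

(* [volS] integrates it to [int_S psi lam H], by the divergence theorem. *)
Definition mean_integrand (psi : S -> R) t : R :=
  (psi t * (d%:R * derive1 lam (u t) * lam (u t)) + gdotS psi u t) / qfacS t.

Lemma mean_integrand_continuous psi : C1_manifold A psi -> continuous (mean_integrand psi).
Proof.
move=> cp t; rewrite /mean_integrand.
apply: (@continuousM _ _ (fun t => psi t * (d%:R * derive1 lam (u t) * lam (u t)) + gdotS psi u t) (fun t => (qfacS t)^-1) t); last first.
  apply: (@continuous_comp _ _ _ qfacS (fun y => y^-1)); first exact: qfacS_continuous.
  by apply: inv_continuous; rewrite gt_eqF// qfacS_gt0.
apply: (@continuousD R R^o S (fun t => psi t * (d%:R * derive1 lam (u t) * lam (u t))) (gdotS psi u) t); last exact: (@gdot_continuous _ _ _ _ h sA rh psi u cp cu).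
apply: continuousM; first exact: (C1_manifold_continuous sA cp).
apply: continuousM; last exact: lam_u_continuous.
apply: continuousM; [exact: cst_continuous|exact: dlam_u_continuous].
Qed.

Lemma mean_integrandD f g t : C1_manifold A f -> C1_manifold A g ->
  mean_integrand (fun t => f t + g t) t = mean_integrand f t + mean_integrand g t.
Proof.
move=> cf cg; rewrite /mean_integrand gdotDl// -mulrDl; congr (_ / _).
by rewrite mulrDl addrACA.
Qed.

Lemma vol_density_continuous i x : chart_image i x ->
  {for x, continuous (fun x => Num.sqrt (\det (h i x)))}.
Proof.
move=> ix; apply: (C1_continuous _ ix).
exact: (C1_vol_density (open_chart_image sA i) (@C1_metric _ _ _ _ h rh i)
  (@metric_posdef _ _ _ _ h rh i)).
Qed.

Section one_chart.
Variables (i : chart A) (K : set 'rV[R]_d) (psi : S -> R).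
Hypotheses (cK : compact K) (KU : K `<=` chart_image i) (cp : C1_manifold A psi).
Hypothesis psiK : forall t, psi t != 0 -> chart_dom i t /\ K (chart_map i t).
Hypothesis psi0 : forall t, 0 <= psi t.

Let U := chart_image i.
Let psi_i x := psi (chart_inv i x).
Let oU : open U := open_chart_image sA i.
Let ch := @C1_metric _ _ _ _ h rh i.
Let ph := @metric_posdef _ _ _ _ h rh i.
Let l0 y : U y -> 0 < lam (ui i y) := fun _ => lam0 _.
Let dl y : U y -> derivable lam (ui i y) 1 .
Proof. by move=> _; exact: (@dlam (chart_inv i y)). Qed.
Let cl y : U y -> {for ui i y, continuous (derive1 lam)} .
Proof. by move=> _; exact: (@clam (chart_inv i y)). Qed.
Let fl a := flux (h i) (ui i) lam a.
Let cfl a : C1 U (fl a) := C1_flux oU ch ph (@cu i) (@cdu i) l0 dl cl a.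
Let W a : 'rV[R]_d -> R := (fun x => psi_i x * fl a x) \_ U.
Let G : 'rV[R]_d -> R :=
  (fun x => Num.sqrt (\det (h i x)) * mean_integrand psi (chart_inv i x)) \_ U.
Let P x := G x - \sum_a partial a (W a) x.

Let closedK : closed K.
Proof. by apply: compact_closed => //; exact: norm_hausdorff. Qed.

Let psi_i0 x : U x -> ~ K x -> psi_i x = 0.
Proof.
move=> ix Kx; apply: contrapT => /eqP/psiK[_]; rewrite chart_invK//.
Qed.

Let mean_integrand0 t : ~ (chart_inv i @` K) t -> mean_integrand psi t = 0.
Proof.
move=> Kt.
have cl' : closed (chart_inv i @` K).
  apply: compact_closed => //; apply: continuous_compact => //.
  apply: continuous_in_subspaceT => y /set_mem Ky.
  by apply: (chart_inv_continuous sA); exact: KU.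
have z s : (~` (chart_inv i @` K)) s -> psi s = 0.
  move=> Ks; apply: contrapT => /eqP/psiK[si Ksi]; apply: Ks.
  by exists (chart_map i s) => //; rewrite chart_mapK.
rewrite /mean_integrand (gdot_near0 cp (closed_openC cl') Kt z) z//.
by rewrite mul0r addr0 mul0r.
Qed.

Let cW a : C1 setT (W a).
Proof.
apply: (C1_extend0 oU closedK KU (C1M oU (@cp i) (cfl a))).
by move=> x ix Kx; rewrite (_ : psi _ = 0) ?mul0r//; exact: psi_i0.
Qed.

Let W0 a x : ~ K x -> W a x = 0.
Proof.
by move=> Kx; rewrite /W patchE; case: ifPn => // /set_mem ix; rewrite psi_i0// mul0r.
Qed.

Let G0 x : ~ K x -> G x = 0.
Proof.
move=> Kx; rewrite /G patchE; case: ifPn => // /set_mem ix.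
rewrite mean_integrand0 ?mulr0// => -[y Ky yx]; apply: Kx.
by rewrite -(chart_invK sA ix) -yx chart_invK//; exact: KU.
Qed.

Let cG : continuous G.
Proof.
apply: (continuous_extend0 oU closedK KU) => x ix.
  apply: continuousM; first exact: vol_density_continuous.
  apply: (@continuous_comp _ _ _ (chart_inv i) (mean_integrand psi)).
    exact: (chart_inv_continuous sA).
  exact: mean_integrand_continuous.
by move=> /G0; rewrite /G patchE mem_set.
Qed.

Let partialW0 a x : ~ K x -> partial a (W a) x = 0.
Proof.
move=> Kx; rewrite (partial_eq (g := fun=> 0) a (closed_openC closedK) (@W0 a) Kx).
exact: partial_cst.
Qed.

Let cP : continuous P.
Proof.
move=> x; apply: continuousB; first exact: cG.
apply: continuous_bigsum => a _.
by have [_ _] := C1_at (cW a) (I : setT x); exact.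
Qed.

Let P0 x : ~ K x -> P x = 0.
Proof. by move=> Kx; rewrite /P G0// big1 ?subr0// => a _; exact: partialW0. Qed.

Let PE x : U x -> P x = psi_i x * (vol_density (h i) x * lam (ui i x) *
  mean_curvature (local_warped (h i) lam) (local_graph (ui i)) x
    (local_normal (h i) (ui i) lam x)).
Proof.
move=> ix; rewrite (mean_curvature_divergence oU ch ph (@cu i) (@cdu i) l0 dl cl ix).
rewrite /P /G patchE mem_set// /mean_integrand qfacS_inv//.
rewrite (gdot_inv sA rh cp cu ix) local_gdotE.
have E a : partial a (W a) x = psi_i x * partial a (fl a) x + fl a x * partial a psi_i x.
  rewrite -(partialM a ix (@cp i) (cfl a)).
  by apply: (partial_eq a oU _ ix) => y iy; rewrite /W patchE mem_set.
rewrite [X in _ - X = _](eq_bigr _ (fun a _ => E a)).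
rewrite big_split /= -mulr_sumr -/(psi_i x) -/(vol_density (h i) x).
have <- : vol_density (h i) x * ((\sum_a grad (h i) (ui i) x 0 a *
    partial a (fun x => psi (chart_inv i x)) x) / qfac (h i) (ui i) lam x) =
    \sum_a fl a x * partial a psi_i x.
  rewrite mulr_suml mulr_sumr.
  apply: eq_bigr => a _; rewrite /fl /flux /psi_i.
  by ring.
rewrite /fl; set s1 := \sum_a grad _ _ _ _ _ * _; set s2 := \sum_a partial a _ _.
ring.
Qed.

Let H0 x : U x -> 0 < vol_density (h i) x * lam (ui i x) *
  mean_curvature (local_warped (h i) lam) (local_graph (ui i)) x
    (local_normal (h i) (ui i) lam x).
Proof.
move=> ix; apply: mulr_gt0; first exact: (mulr_gt0 (vol_density_gt0 ph ix) (lam0 _)).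
apply: (mc ix); first exact: (local_unit_normal oU ph (@cu i) l0 ix).
exact: (local_normal_gt0 ph l0 ix).
Qed.

Let P_ge0 x : 0 <= P x.
Proof.
have [Kx|Kx] := pselect (K x); last by rewrite P0.
rewrite (PE (KU Kx)) mulr_ge0//; first exact: psi0.
exact: (ltW (H0 (KU Kx))).
Qed.

Let integral_mean_integrand :
  (\int[volS]_t (mean_integrand psi t)%:E = \int[lebesgue_rV d]_x (P x)%:E)%E.
Proof.
have [M MK] : exists M, forall x, M <= `|x| -> ~ K x.
  have [M [_ MK]] := compact_bounded cK.
  exists (M + 2) => x Mx Kx.
  have M1 : M < M + 1 by rewrite ltrDl.
  have := le_trans Mx (MK _ M1 _ Kx).
  by rewrite lerD2l lern1.
rewrite (chart_integral sA vh vol_density_continuous (i := i)).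
- rewrite -/G.
  transitivity (\int[lebesgue_rV d]_x ((P x)%:E + \sum_a (partial a (W a) x)%:E))%E.
    by apply: eq_integral => x _; rewrite sumEFin -EFinD subrK.
  have ip a : (lebesgue_rV d).-integrable setT (EFin \o partial a (W a)).
    apply: (vanish_integrable (M := M)); last by move=> x /MK; exact: partialW0.
    by move=> x; have [_ _] := C1_at (cW a) (I : setT x); exact.
  rewrite integralD//; last 2 first.
  - by apply: (vanish_integrable cP (M := M)) => x /MK; exact: P0.
  - apply: (integrable_sum measurableT) => a _; exact: ip.
  rewrite [X in (_ + X)%E](_ : _ = 0%E) ?adde0//.
  rewrite (integral_sum measurableT ip).
  rewrite big1// => a _; apply: (integral_partial_eq0 a (cW a) (M := M)) => x /MK.
  exact: W0.
- by apply: borel_continuous; exact: mean_integrand_continuous.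
- move=> t it; apply: mean_integrand0 => -[x Kx xt]; apply: it; rewrite -xt.
  by apply: (chart_inv_dom sA); exact: KU.
Qed.

Lemma chart_mean_integral_ge0 : (0 <= \int[volS]_t (mean_integrand psi t)%:E)%E.
Proof.
by rewrite integral_mean_integrand; apply: integral_ge0 => x _; rewrite lee_fin.
Qed.

Lemma chart_mean_integral_gt0 t : 0 < psi t ->
  (0 < \int[volS]_t (mean_integrand psi t)%:E)%E.
Proof.
move=> pt; have [it _] : chart_dom i t /\ K (chart_map i t).
  by apply: psiK; rewrite gt_eqF.
rewrite integral_mean_integrand.
apply: (integral_rV_continuous_gt0 (x := chart_map i t) cP P_ge0).
have ix := chart_map_image it.
by rewrite (PE ix) mulr_gt0 ?H0// /psi_i chart_mapK.
Qed.

End one_chart.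

Let integrable_mean_integrand psi : C1_manifold A psi ->
  volS.-integrable setT (EFin \o mean_integrand psi : borel S -> \bar R).
Proof.
move=> cp; apply: (integrable_continuous sA vh vol_density_continuous cS).
exact: mean_integrand_continuous.
Qed.

Let mean_integral_split b psi : C1_manifold A b -> C1_manifold A psi ->
  (\int[volS]_t (mean_integrand psi t)%:E =
   \int[volS]_t (mean_integrand (fun t => psi t * b t) t)%:E +
   \int[volS]_t (mean_integrand (fun t => psi t * (1 - b t)) t)%:E)%E.
Proof.
move=> cb cp.
have c1 := C1_manifoldM sA cp cb.
have c2 := C1_manifoldM sA cp (C1_manifoldB sA (C1_manifold_cst sA 1) cb).
rewrite -integralD//; try exact: integrable_mean_integrand.
apply: eq_integral => t _; rewrite -EFinD -mean_integrandD//; congr (mean_integrand _ t)%:E.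
by apply/funext => s; rewrite -mulrDr addrC subrK mulr1.
Qed.

Lemma mean_integral_ge0 psi : C1_manifold A psi -> (forall t, 0 <= psi t) ->
  (0 <= \int[volS]_t (mean_integrand psi t)%:E)%E.
Proof.
pose V t := projT1 (cid (manifold_bump t sA hS)).
have VP t := projT2 (cid (manifold_bump t sA hS)); rewrite -/(V _) in VP.
have [t|t|c [N cN]] := compact_nat_cover (V := V) cS; try by have [] := VP t.
move=> cp p0.
have : forall t, psi t != 0 -> exists2 k, (k < N)%N & V (c k) t by move=> t _; exact: cN.
elim: N {cN} psi cp p0 => [|N IH] psi cp p0 pV.
  have -> : psi = fun=> 0.
    by apply/funext => t; apply: contrapT => /eqP/pV[].
  rewrite integral0_eq// => t _; congr EFin.
  rewrite /mean_integrand (gdot_near0 (C1_manifold_cst sA 0) openT I)//.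
  by rewrite mul0r addr0 mul0r.
have [_ _ [i [K [b [[cb cK KU bK] [bV b01]]]]]] := VP (c N).
rewrite (mean_integral_split cb cp); apply: adde_ge0.
  apply: (chart_mean_integral_ge0 cK KU (C1_manifoldM sA cp cb)).
    by move=> t; rewrite mulf_eq0 negb_or => /andP[_ /bK].
  by move=> t; rewrite mulr_ge0//; have /andP[] := b01 t.
apply: IH.
- exact: (C1_manifoldM sA cp (C1_manifoldB sA (C1_manifold_cst sA 1) cb)).
- by move=> t; rewrite mulr_ge0// subr_ge0; have /andP[] := b01 t.
- move=> t; rewrite mulf_eq0 negb_or subr_eq0 => /andP[/pV[k]].
  rewrite ltnS leq_eqVlt => /orP[/eqP->|kN Vk _]; last by exists k.
  by move=> /bV ->; rewrite eqxx.
Qed.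

Lemma mean_integral_gt0 psi t : C1_manifold A psi -> (forall t, 0 <= psi t) ->
  0 < psi t -> (0 < \int[volS]_t (mean_integrand psi t)%:E)%E.
Proof.
move=> cp p0 pt.
have [V [_ Vt [i [K [b [[cb cK KU bK] [bV b01]]]]]]] := manifold_bump t sA hS.
rewrite (mean_integral_split cb cp); apply: lte_paddr.
  apply: mean_integral_ge0.
    exact: (C1_manifoldM sA cp (C1_manifoldB sA (C1_manifold_cst sA 1) cb)).
  by move=> s; rewrite mulr_ge0// subr_ge0; have /andP[] := b01 s.
apply: (@chart_mean_integral_gt0 i K _ cK KU (C1_manifoldM sA cp cb) _ _ t).
- by move=> s; rewrite mulf_eq0 negb_or => /andP[_ /bK].
- by move=> s; rewrite mulr_ge0//; have /andP[] := b01 s.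
- by rewrite bV// mulr1.
Qed.

End mean_convexity.

(** * Area of a graph *)

Lemma chart_partition {R : realType} {d : nat} {S : ptopologicalType} (A : atlas R d S) :
  smooth_atlas A -> compact [set: S] ->
  exists (c : nat -> chart A) (E : nat -> set S),
  [/\ forall k, measurable (E k : set (borel S)), trivIset setT E,
      \bigcup_k E k = setT & forall k, E k `<=` chart_dom (c k)].
Proof.
move=> sA cS.
have [t|t|c [N cN]] := compact_nat_cover (V := fun t => chart_dom (chart_at sA t)) cS.
- exact: open_chart_dom.
- exact: chart_atP.
pose D k := chart_dom (chart_at sA (c k)).
exists (fun k => chart_at sA (c k)), (seqDU D); split.
- move=> k; apply: measurableD; first by apply: borel_open; exact: (open_chart_dom sA).
  apply: bigsetU_measurable => j _; by apply: borel_open; exact: (open_chart_dom sA).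
- exact: trivIset_seqDU.
- rewrite -seqDU_bigcup_eq; apply/seteqP; split=> // t _.
  by have [k _ Dk] := cN t; exists k.
- by move=> k t []; rewrite /D.
Qed.

Lemma ge0_integral_partition {dT : measure_display} {T : measurableType dT} {R : realType}
    (mu : {measure set T -> \bar R}) (E : nat -> set T) (f : T -> \bar R) :
  (forall k, measurable (E k)) -> trivIset setT E -> \bigcup_k E k = setT ->
  measurable_fun setT f -> (forall t, 0 <= f t)%E ->
  (\int[mu]_t f t = \sum_(k <oo) \int[mu]_(t in E k) f t)%E.
Proof.
move=> mE tE UE mf f0; rewrite -UE ge0_integral_bigcup//.
by apply: (measurable_funS _ _ mf) => //; rewrite UE.
Qed.

Section area.
Context {R : realType} {d : nat} {S : ptopologicalType} {A : atlas R d S}.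
Variable h : chart A -> 'rV[R]_d -> 'M[R]_d.
Hypotheses (sA : smooth_atlas A) (rh : riemannian_metric h).
Hypotheses (cS : compact [set: S]).
Variable volS area : {measure set (borel S) -> \bar R}.
Hypothesis vh : riemannian_volume volS h.
Variables (lam : R -> R) (u : S -> R).
Hypothesis va : riemannian_volume area (graph_metric h lam u).
Hypotheses (cu : C1_manifold A u).
Hypotheses (lam0 : forall t, 0 < lam (u t)) (dlam : forall t, derivable lam (u t) 1).

Definition area_density t : R := lam (u t) ^+ d / lam (u t) * qfacS h sA lam u t.

Let qf : forall t, 0 < qfacS h sA lam u t := qfacS_gt0 sA rh cu lam0.

Lemma area_density_ge0 t : 0 <= area_density t.
Proof. by rewrite mulr_ge0// ?divr_ge0 ?exprn_ge0// ltW. Qed.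

Lemma area_density_continuous : continuous area_density.
Proof.
have cl := @lam_u_continuous _ _ _ _ sA lam u cu dlam.
move=> t; rewrite /area_density.
apply: (@continuousM _ _ (fun t => lam (u t) ^+ d / lam (u t)) (qfacS h sA lam u) t).
  apply: (@continuousM _ _ (fun t => lam (u t) ^+ d) (fun t => (lam (u t))^-1) t).
    apply: (@continuous_comp _ _ _ (fun t => lam (u t)) (fun y => y ^+ d)); first exact: cl.
    exact: exprn_continuous.
  apply: (@continuous_comp _ _ _ (fun t => lam (u t)) (fun y => y^-1)); first exact: cl.
  by apply: inv_continuous; rewrite gt_eqF.
exact: (@qfacS_continuous _ _ _ _ h sA rh lam u cu dlam).
Qed.

Lemma graph_density i x : chart_image i x ->
  Num.sqrt (\det (graph_metric h lam u i x)) =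
  Num.sqrt (\det (h i x)) * area_density (chart_inv i x).
Proof.
move=> ix; rewrite /graph_metric /area_density (qfacS_inv sA rh _ cu ix) mulrC.
exact: (sqrt_det_induced_metric (open_chart_image sA i) (@metric_posdef _ _ _ _ h rh i)
  (@cu i) (fun y _ => lam0 _) ix).
Qed.

Let vdc := @vol_density_continuous _ _ _ _ h sA rh.

Lemma graph_density_continuous i x : chart_image i x ->
  {for x, continuous (fun x => Num.sqrt (\det (graph_metric h lam u i x)))}.
Proof.
move=> ix.
apply: (@near_eq_continuous _ _ (fun x => Num.sqrt (\det (h i x)) * area_density (chart_inv i x))).
  apply: filterS (open_nbhs_nbhs (conj (open_chart_image sA i) ix)) => y iy.
  by rewrite graph_density.
apply: continuousM; first exact: vdc.
apply: (@continuous_comp _ _ _ (chart_inv i) area_density).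
  exact: (chart_inv_continuous sA).
exact: area_density_continuous.
Qed.

Lemma area_measureE (B : set S) : measurable (B : set (borel S)) ->
  area B = (\int[volS]_t ((area_density t)%:E * (\1_B t)%:E))%E.
Proof.
move=> mB; have [c [E [mE tE UE Ec]]] := chart_partition sA cS.
have mf C : measurable (C : set (borel S)) ->
    measurable_fun setT (fun t : borel S => (area_density t)%:E * (\1_C t)%:E : \bar R)%E.
  move=> mC; apply: emeasurable_funM; apply/measurable_EFinP.
    by apply: borel_continuous; exact: area_density_continuous.
  exact: measurable_indic.
have f0 C t : (0 <= (area_density t)%:E * (\1_C t)%:E)%E.
  by rewrite -EFinM lee_fin mulr_ge0// area_density_ge0.
rewrite (ge0_integral_partition volS mE tE UE (mf B mB) (f0 B)).
transitivity (\sum_(k <oo) area (B `&` E k))%E.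
  rewrite -[in LHS](setIT B) -UE setI_bigcupr measure_bigcup//=.
  - by apply: eq_eseriesl => k; rewrite in_setT.
  - by move=> k _; exact: measurableI.
  - exact: trivIset_setIl.
apply: eq_eseriesr => k _.
have mBk : measurable (B `&` E k : set (borel S)) by exact: measurableI.
have BD : B `&` E k `<=` chart_dom (c k) by move=> t [_ /Ec].
rewrite (chart_measureE sA va graph_density_continuous mBk BD).
transitivity (\int[volS]_(t in chart_dom (c k)) ((area_density t)%:E * (\1_(B `&` E k) t)%:E))%E.
  rewrite (ge0_chart_integral sA vh vdc (c k) (mf _ mBk) (f0 _)).
  apply: eq_integral => x _; rewrite /chart_density /chart_inv0 !patchE.
  case: ifPn => [/set_mem ix|_]; last by rewrite !mul0e.
  by rewrite graph_density// EFinM muleA.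
rewrite [LHS]integral_mkcond [RHS]integral_mkcond; apply: eq_integral => t _.
rewrite !patchE indicE in_setI indicE; have [tE'|tE'] := boolP (t \in E k).
  by rewrite andbT mem_set//; apply: Ec; exact: set_mem.
by rewrite andbF mule0; case: ifP.
Qed.

Lemma integral_area (f : S -> \bar R) : measurable_fun setT (f : borel S -> \bar R) ->
  (forall t, 0 <= f t)%E ->
  (\int[area]_t f t = \int[volS]_t ((area_density t)%:E * f t))%E.
Proof.
move=> mf f0; have mid : measurable_fun setT (idfun : borel S -> borel S) by exact: measurable_id.
have md := borel_continuous area_density_continuous.
rewrite (ge0_integral_density mid md area_density_ge0 measurableT (fun B mB _ => area_measureE mB) mf f0).
by apply: eq_integral => t _; rewrite indicT mule1.
Qed.

End area.

(** * The potential *)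

Section elementary.
Context {R : realFieldType}.
Implicit Types a k s x : R.

Lemma pow_tangent_ge0 (N : nat) k : 0 <= k ->
  0 <= N%:R * k ^+ N.+2 - N.+2%:R * k ^+ N + 2.
Proof.
move=> k0; elim: N => [|N IH]; first by rewrite mul0r expr0; lra.
have kN : 0 <= k ^+ N.+1 by exact: exprn_ge0.
have h : 0 <= (k - 1) * (k ^+ N.+1 * (k + 1) - 2).
  have [k1|k1] := leP 1 k.
    have k2 : 1 <= k ^+ N.+1 by exact: exprn_ege1.
    rewrite mulr_ge0 ?subr_ge0// -[2]mul1r ler_pM//.
    by rewrite -[2]/(1 + 1) lerD2r.
  have k2 : k ^+ N.+1 <= 1 by apply: exprn_ile1 => //; exact: ltW.
  rewrite mulr_le0 ?subr_le0 ?(ltW k1)// -[2]mul1r ler_pM ?addr_ge0//.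
  by rewrite -[2]/(1 + 1) lerD2r ltW.
have -> : N.+1%:R * k ^+ N.+3 - N.+3%:R * k ^+ N.+1 + 2 =
    k * (N%:R * k ^+ N.+2 - N.+2%:R * k ^+ N + 2) + (k - 1) * (k ^+ N.+1 * (k + 1) - 2).
  rewrite -[N.+3%:R]natr1 -[N.+2%:R]natr1 -[N.+1%:R]natr1 !exprS; ring.
by rewrite addr_ge0// mulr_ge0.
Qed.

Lemma young_gt0 (d : nat) a s : 0 <= a -> 0 <= s -> a != s ->
  0 < a ^+ d.+2 + d.+1%:R * s ^+ d.+2 - d.+2%:R * a * s ^+ d.+1.
Proof.
move=> a0 s0 as'; elim: d => [|d IH].
  have : 0 < (a - s) ^+ 2 by rewrite exprn_even_gt0//= subr_eq0.
  by rewrite !exprS !expr0; nra.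
have [a00|a1] := eqVneq a 0.
  have s1 : 0 < s by rewrite lt_def s0 andbT eq_sym -a00.
  rewrite a00 mulr0 mul0r subr0 expr0n add0r mulr_gt0//; exact: exprn_gt0.
have -> : a ^+ d.+3 + d.+2%:R * s ^+ d.+3 - d.+3%:R * a * s ^+ d.+2 =
    a * (a ^+ d.+2 + d.+1%:R * s ^+ d.+2 - d.+2%:R * a * s ^+ d.+1)
    + d.+2%:R * s ^+ d.+1 * (s - a) ^+ 2.
  by rewrite -[d.+3%:R]natr1 -[d.+2%:R]natr1 !exprS; ring.
apply: ltr_pwDl; last first.
  by apply: mulr_ge0; [apply: mulr_ge0; [exact: ler0n|exact: exprn_ge0]|exact: sqr_ge0].
by rewrite mulr_gt0// lt_def a1.
Qed.

Lemma young_ge0 (d : nat) a s : 0 <= a -> 0 <= s ->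
  0 <= a ^+ d.+2 + d.+1%:R * s ^+ d.+2 - d.+2%:R * a * s ^+ d.+1.
Proof.
move=> a0 s0; have [->|/(young_gt0 d a0 s0)/ltW//] := eqVneq a s.
by rewrite -[d.+2%:R]natr1 !exprS; lra.
Qed.

End elementary.

Section potential.
Context {R : realType}.
Variables (N : nat) (eps m q kappa s0 : R).

Local Notation V := (adsRN_potential N.+3 eps m q kappa).
Let z (s : R) := (s ^+ N.+1)^-1.

Lemma adsRN_potentialE s : 0 < s ->
  V s = eps + kappa ^+ 2 * s ^+ 2 - 2 * m * z s + q ^+ 2 * z s ^+ 2.
Proof.
move=> s_gt0; rewrite /adsRN_potential.
have -> : 2%:Z - N.+3%:Z = - N.+1%:Z by lia.
have -> : 4%:Z - 2%:Z * N.+3%:Z = - (N.+1 * 2)%N%:Z by lia.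
by rewrite -!exprnN /z exprVn exprM.
Qed.

Lemma adsRN_potential_continuous (s : R) : 0 < s -> {for s, continuous V}.
Proof.
move=> s_gt0.
apply: (@near_eq_continuous R R (fun s => eps + kappa ^+ 2 * s ^+ 2 - 2 * m * z s + q ^+ 2 * z s ^+ 2)).
  have os : open_nbhs s [set y : R | 0 < y] by split => //; exact: open_gt.
  by apply: filterS (open_nbhs_nbhs os) => y y0; rewrite adsRN_potentialE.
have cz : {for s, continuous z}.
  apply: (@continuous_comp _ _ _ (fun s : R => s ^+ N.+1) (fun y => y^-1)).
    exact: exprn_continuous.
  by apply: inv_continuous; rewrite gt_eqF// exprn_gt0.
apply: cvgD; last first.
  apply: cvgM; first exact: cvg_cst.
  by apply: (@continuous_comp _ _ _ z (fun y => y ^+ 2)) => //; exact: exprn_continuous.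
apply: cvgB; last by apply: cvgM => //; exact: cvg_cst.
apply: cvgD; first exact: cvg_cst.
by apply: cvgM; [exact: cvg_cst|exact: exprn_continuous].
Qed.

(* [V] is a convex function of [s ^- (n - 2)]; this is its tangent inequality. *)
Lemma adsRN_potential_tangent x s : 0 < x -> 0 < s ->
  V x + (- (2 / N.+1%:R) * kappa ^+ 2 * x ^+ N.+3 - 2 * m + 2 * q ^+ 2 * z x) * (z s - z x)
  <= V s.
Proof.
move=> x0 s_gt0; rewrite !adsRN_potentialE//.
have N0 : 0 < N.+1%:R :> R by rewrite ltr0n.
have h : 0 <= s ^+ 2 - x ^+ 2 + 2 / N.+1%:R * x ^+ N.+3 * (z s - z x).
  pose k := s / x; have k0 : 0 < k by rewrite divr_gt0.
  have sE : s = k * x by rewrite divfK// gt_eqF.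
  have := pow_tangent_ge0 N.+1 (ltW k0).
  have -> : s ^+ 2 - x ^+ 2 + 2 / N.+1%:R * x ^+ N.+3 * (z s - z x) =
     x ^+ 2 / (N.+1%:R * k ^+ N.+1) *
       (N.+1%:R * k ^+ N.+3 - N.+3%:R * k ^+ N.+1 + 2).
    rewrite /z sE exprMn [x ^+ N.+3](_ : _ = x ^+ 2 * x ^+ N.+1); last by rewrite -exprD.
    rewrite [k ^+ N.+3](_ : _ = k ^+ 2 * k ^+ N.+1); last by rewrite -exprD.
    rewrite -[N.+3%:R]natr1 -[N.+2%:R]natr1.
    have kN : k ^+ N.+1 != 0 by rewrite gt_eqF// exprn_gt0.
    have xN : x ^+ N.+1 != 0 by rewrite gt_eqF// exprn_gt0.
    rewrite [(k * x) ^+ N.+1]exprMn; field.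
    by rewrite kN xN addrC natr1 gt_eqF.
  move=> p; apply: mulr_ge0 => //; rewrite divr_ge0 ?exprn_ge0 ?mulr_ge0 ?exprn_ge0//; exact: ltW.
have hk : 0 <= kappa ^+ 2 * (s ^+ 2 - x ^+ 2 + 2 / N.+1%:R * x ^+ N.+3 * (z s - z x)).
  by rewrite mulr_ge0// sqr_ge0.
have hq : 0 <= q ^+ 2 * (z s - z x) ^+ 2 by rewrite mulr_ge0 ?sqr_ge0.
rewrite -subr_ge0; apply: le_trans (addr_ge0 hk hq) _.
by rewrite le_eqVlt; apply/orP; left; apply/eqP; ring.
Qed.

Hypothesis k_gt0 : 0 < kappa.
Hypothesis root : largest_positive_root V s0.

Lemma adsRN_potential_unbounded s1 : 0 < s1 -> exists2 s, s1 <= s & 0 < V s.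
Proof.
move=> s1_gt0; pose c := `|eps| + 2 * `|m| + 1.
have c1 : 1 <= c by rewrite lerDr addr_ge0// mulr_ge0.
have k2 : 0 < kappa ^+ 2 by rewrite exprn_gt0.
exists (Num.max s1 (Num.max 1 (c / kappa ^+ 2))); first by rewrite le_max lexx.
set s := Num.max s1 _.
have s_gt0 : 0 < s by rewrite lt_max s1_gt0.
have s1' : 1 <= s by rewrite !le_max lexx orbT.
have sc : c <= kappa ^+ 2 * s by rewrite mulrC -ler_pdivrMr// !le_max lexx !orbT.
have z0 : 0 < z s by rewrite invr_gt0 exprn_gt0.
have z1 : z s <= 1 by rewrite invf_le1 ?exprn_gt0// exprn_ege1.
rewrite adsRN_potentialE//.
have h1 : c <= kappa ^+ 2 * s ^+ 2.
  apply: le_trans sc _; rewrite expr2 mulrA ler_peMr// mulr_ge0//; exact: ltW.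
have h2 : 2 * m * z s <= 2 * `|m|.
  rewrite -mulrA ler_pM2l//; apply: le_trans (ler_norm _) _.
  by rewrite normrM ler_piMr// ger0_norm// ltW.
have h3 : - `|eps| <= eps by rewrite lerNl -normrN ler_norm.
have h4 : 0 <= q ^+ 2 * z s ^+ 2 by rewrite mulr_ge0 ?sqr_ge0.
by move: h1; rewrite /c; lra.
Qed.

Lemma adsRN_potential_ge0 s : s0 <= s -> 0 <= V s.
Proof.
have [s0_gt0 V0 last] := root.
rewrite le_eqVlt => /predU1P[<-|ss]; first by rewrite V0.
have s_gt0 := lt_trans s0_gt0 ss.
rewrite leNgt; apply/negP => Vs.
have [s2 ss2 Vs2] := adsRN_potential_unbounded s_gt0.
have cV : {within `[s, s2], continuous V}.
  apply: continuous_in_subspaceT => x /set_mem /=; rewrite in_itv /= => /andP[sx _].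
  by apply: adsRN_potential_continuous; exact: lt_le_trans sx.
have [|c cs Vc] := IVT ss2 cV (v := 0).
  by rewrite ge_min le_max (ltW Vs) (ltW Vs2) orbT.
move: cs; rewrite in_itv /= => /andP[sc _].
have := last c (lt_le_trans s_gt0 sc) Vc.
by rewrite leNgt (lt_le_trans ss sc).
Qed.

Lemma adsRN_potential_nondecreasing x y : s0 <= x -> x <= y -> V x <= V y.
Proof.
have [s0_gt0 V0 _] := root.
rewrite le_eqVlt => /predU1P[<- xy|sx xy]; first by rewrite V0 adsRN_potential_ge0.
have x0 := lt_trans s0_gt0 sx; have y0 := lt_le_trans x0 xy.
have t0 := adsRN_potential_tangent x0 s0_gt0.
have ty := adsRN_potential_tangent x0 y0.
set sg := (X in V x + X * _ <= _) in t0; rewrite -/sg in ty.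
have zs : z x < z s0 by rewrite ltf_pV2 ?posrE ?exprn_gt0// ltrXn2r// ltW.
have zy : z y <= z x by rewrite lef_pV2 ?posrE ?exprn_gt0// lerXn2r// nnegrE ltW.
have sg0 : sg <= 0.
  rewrite leNgt; apply/negP => sg0.
  have : 0 < sg * (z s0 - z x) by rewrite mulr_gt0// subr_gt0.
  by have := adsRN_potential_ge0 (ltW sx); move: t0; rewrite V0; lra.
have : 0 <= sg * (z y - z x) by rewrite mulr_le0// subr_le0.
by move: ty; lra.
Qed.

End potential.

(** * The test function *)

Lemma antiderivative {R : realType} (g : R -> R) : continuous g ->
  exists G : R -> R, forall r : R, -1 < r -> is_derive r 1 G (g r).
Proof.
move=> cg; exists (fun x => \int[lebesgue_measure]_(t in [set` `[(-1 : R), x]]) (g t)) => r r1.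
have ig : lebesgue_measure.-integrable `[(-1 : R), (r + 1)] (EFin \o g).
  by apply: continuous_compact_integrable; [exact: segment_compact|exact: continuous_subspaceT].
have r2 : r < r + 1 by rewrite ltrDl.
have [dG GE] := @continuous_FTC1_closed R g (-1) r (r + 1) r2 ig r1 (cg r).
apply: (DeriveDef dG); rewrite -derive1E; exact: GE.
Qed.

Section test_function.
Context {R : realType}.
Variables (e : nat) (lam phi : R -> R) (a b : R).
Hypothesis clam : {within `[0, +oo[, continuous lam}.
Hypothesis dlam : forall r : R, 0 < r -> is_derive r 1 lam (phi r).
Hypothesis phi0 : forall r : R, 0 < r -> 0 <= phi r.
Hypothesis phi_mono : forall r s : R, 0 < r -> r <= s -> phi r <= phi s.
Hypothesis lam0 : forall r : R, 0 <= r -> 0 < lam r.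
Hypothesis lam_mono : forall r s : R, 0 <= r -> r < s -> lam r < lam s.
Hypotheses (b0 : 0 <= b) (lamb : lam b = a).

Lemma continuous_max0 : continuous (fun r : R => lam (Num.max r 0)).
Proof.
move=> r; have cm : {for r, continuous (fun r : R => Num.max r 0)}.
  by apply: (@continuous_max R R idfun (fun=> 0)); [exact: cvg_id|exact: cst_continuous].
have /subspace_continuousP/(_ (Num.max r 0)) := clam.
rewrite /= in_itv /= andbT le_max lexx orbT => /(_ isT) cl U /cl.
rewrite /= /within /= => UN.
have h : nbhs r [set s : R | Num.max s 0 \in `[0, +oo[ -> U (lam (Num.max s 0))] := cm _ UN.
change (nbhs r [set s : R | U (lam (Num.max s 0))]).
apply: filterS h => s /=; apply; rewrite in_itv /= andbT le_max lexx orbT//.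
Qed.

Let g (r : R) : R := Num.max (a - lam (Num.max r 0)) 0 * lam (Num.max r 0) ^+ e.

Let cg : continuous g.
Proof.
move=> r; apply: (@continuousM _ _ (fun r : R => Num.max (a - lam (Num.max r 0)) 0) (fun r : R => lam (Num.max r 0) ^+ e)).
  apply: (@continuous_max R R (fun r : R => a - lam (Num.max r 0)) (fun=> 0)); last exact: cst_continuous.
  by apply: cvgB; [exact: cvg_cst|exact: continuous_max0].
apply: (@continuous_comp _ _ _ (fun r : R => lam (Num.max r 0)) (fun y => y ^+ e)).
  exact: continuous_max0.
exact: exprn_continuous.
Qed.

Let lam_le r s : 0 <= r -> r <= s -> lam r <= lam s.
Proof. by move=> r0; rewrite le_eqVlt => /predU1P[->//|/(lam_mono r0)/ltW]. Qed.

Let gE r : 0 <= r -> r <= b -> g r = (a - lam r) * lam r ^+ e.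
Proof.
move=> r0 rb; rewrite /g [Num.max r 0]max_l// max_l// subr_ge0 -lamb.
exact: lam_le.
Qed.

Let g0 r : b <= r -> g r = 0.
Proof.
move=> br; have r0 := le_trans b0 br.
rewrite /g [Num.max r 0]max_l// max_r ?mul0r// subr_le0 -lamb; exact: lam_le.
Qed.

Lemma test_function : exists F : R -> R,
  [/\ forall r : R, 0 < r -> is_derive r 1 F (- (Num.max (a - lam r) 0 * lam r ^+ e)),
      forall r : R, 0 < r -> 0 <= F r,
      forall r : R, 0 < r -> lam r < a -> 0 < F r,
      forall r : R, 0 < r -> a <= lam r -> F r = 0 &
      forall r : R, 0 < r -> lam r < a -> e.+1%:R * F r * phi r <=
        (a ^+ e.+2 - lam r ^+ e.+2) / e.+2%:R - (a - lam r) * lam r ^+ e.+1].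
Proof.
have [G dG] := antiderivative cg.
have dG0 (r : R) : 0 < r -> is_derive r 1 G (g r).
  by move=> r0; apply: dG; exact: lt_trans r0.
have cG r s : 0 < r -> {within `[r, s], continuous G}.
  move=> r0; apply: derivable_within_continuous => x; rewrite in_itv /= => /andP[rx _].
  exact: (@ex_derive _ _ _ _ _ _ _ (dG0 x (lt_le_trans r0 rx))).
have dGi (r s : R) : 0 < r -> forall x : R, x \in `]r, s[ -> is_derive x 1 G (g x).
  by move=> r0 x; rewrite in_itv /= => /andP[rx _]; apply: dG0; exact: lt_trans rx.
have Fpos r : 0 < r -> lam r < a -> 0 < G b - G r.
  move=> r0 ra; have rb : r < b.
    by rewrite ltNge; apply/negP => /(lam_le b0); rewrite lamb leNgt ra.
  have [c] := MVT rb (dGi r b r0) (cG r b r0).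
  rewrite in_itv /= => /andP[rc cb] ->; have c0 := ltW (lt_trans r0 rc).
  rewrite mulr_gt0 ?subr_gt0// gE ?(ltW cb)// mulr_gt0 ?exprn_gt0 ?lam0//.
  by rewrite subr_gt0 -lamb lam_mono.
have Fz r : 0 < r -> a <= lam r -> G b - G r = 0.
  move=> r0 ar; have br : b <= r.
    by rewrite leNgt; apply/negP => /(lam_mono (ltW r0)); rewrite lamb ltNge ar.
  move: br; rewrite le_eqVlt => /predU1P[->|br]; first by rewrite subrr.
  have cGb : {within `[b, r], continuous G}.
    apply: derivable_within_continuous => x; rewrite in_itv /= => /andP[rx _].
    apply: (@ex_derive _ _ _ _ _ _ _ (dG x _)); apply: lt_le_trans rx.
    by rewrite (lt_le_trans _ b0)// ltrN10.
  have dGb (x : R) : x \in `]b, r[ -> is_derive x 1 G (g x).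
    by rewrite in_itv /= => /andP[rx _]; apply: dG0; exact: le_lt_trans rx.
  have [c] := MVT br dGb cGb.
  rewrite in_itv /= => /andP[bc _]; rewrite (g0 (ltW bc)) mul0r => h.
  by rewrite -opprB h oppr0.
exists (fun r => G b - G r); split.
- move=> r r0; have dr := dG0 r r0.
  have -> : - (Num.max (a - lam r) 0 * lam r ^+ e) = 0 - g r.
    by rewrite sub0r /g [Num.max r 0]max_l// ltW.
  exact: is_deriveB (is_derive_cst (G b) r 1) dr.
- move=> r r0; have [ra|ar] := ltP (lam r) a; first exact: ltW (Fpos r r0 ra).
  by rewrite Fz.
- exact: Fpos.
- exact: Fz.
move=> r r0 ra; have rb : r < b.
  by rewrite ltNge; apply/negP => /(lam_le b0); rewrite lamb leNgt ra.
pose K (s : R) : R := a * lam s ^+ e.+1 - (e.+1%:R / e.+2%:R) * lam s ^+ e.+2 - e.+1%:R * phi r * G s.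
pose K' (s : R) : R := e.+1%:R * lam s ^+ e * (a - lam s) * phi s - e.+1%:R * phi r * g s.
have n0 : e.+2%:R != 0 :> R by rewrite pnatr_eq0.
have dK (x : R) : 0 < x -> is_derive x 1 K (K' x).
  move=> x0; have dGx := dG0 x x0; have dlx := dlam x0.
  have dp := is_deriveB (is_deriveB (is_deriveZ a (is_deriveX e.+1 dlx))
    (is_deriveZ (e.+1%:R / e.+2%:R) (is_deriveX e.+2 dlx))) (is_deriveZ (e.+1%:R * phi r) dGx).
  rewrite !exprfctE in dp; apply: (is_derive_eq dp); rewrite /K' /GRing.scale /=.
  by rewrite exprS; field; rewrite -natr1 addrC natr1.
have cK : {within `[r, b], continuous K}.
  apply: derivable_within_continuous => x; rewrite in_itv /= => /andP[rx _].
  exact: (@ex_derive _ _ _ _ _ _ _ (dK x (lt_le_trans r0 rx))).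
have dKi (x : R) : x \in `]r, b[ -> is_derive x 1 K (K' x).
  by rewrite in_itv /= => /andP[rx _]; apply: dK; exact: lt_trans rx.
have [c] := MVT rb dKi cK; rewrite in_itv /= => /andP[rc cb] Kc.
have c0 := lt_trans r0 rc.
have : 0 <= K b - K r.
  rewrite Kc mulr_ge0//; last by rewrite subr_ge0 ltW.
  rewrite /K' (gE (ltW c0) (ltW cb)).
  have : 0 <= e.+1%:R * ((a - lam c) * (lam c ^+ e * (phi c - phi r))).
    rewrite !mulr_ge0 ?exprn_ge0 ?subr_ge0 ?phi_mono ?(ltW rc)//.
    - by rewrite -lamb lam_le// ltW.
    - by rewrite ltW// lam0// ltW.
  by congr (0 <= _); ring.
suff -> : K b - K r = (a ^+ e.+2 - lam r ^+ e.+2) / e.+2%:R - (a - lam r) * lam r ^+ e.+1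
    - e.+1%:R * (G b - G r) * phi r by rewrite subr_ge0.
rewrite /K lamb.
rewrite [a ^+ e.+2]exprS [lam r ^+ e.+2]exprS.
have -> : (e.+1%:R : R) = e.+2%:R - 1 by rewrite -[e.+2%:R]natr1 addrK.
by field.
Qed.

End test_function.

(** * Volume below a graph *)

HB.instance Definition _ (T U : ptopologicalType) := Pointed.on (T * U)%type.

Lemma ge0_integral_lebesgue_rVS_swap {R : realType} d (f : borel 'rV[R]_d.+1 -> \bar R) :
  measurable_fun setT f -> (forall x, 0 <= f x)%E ->
  (\int[lebesgue_rV d.+1]_x f x =
   \int[lebesgue_rV d]_y \int[lebesgue_measure]_t f (row_cons (t, y)))%E.
Proof.
move=> mf f0; rewrite [LHS]ge0_integral_lebesgue_step//.
apply: (@fubini_tonelli _ _ (measurableTypeR R) (borel 'rV[R]_d) R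
  lebesgue_measure (lebesgue_rV d) (f \o @row_cons R d)).
- by apply: measurableT_comp => //; exact: measurable_row_cons.
- by move=> x; exact: f0.
Qed.

Section radial.
Context {R : realType}.
Variables (lam phi : R -> R).
Hypothesis clam : {within `[0, +oo[, continuous lam}.
Hypothesis cphi : {within `[0, +oo[, continuous phi}.
Hypothesis dlam : forall r : R, 0 < r -> is_derive r 1 lam (phi r).

Lemma derive1_lam r : 0 < r -> derive1 lam r = phi r.
Proof. by move=> r0; rewrite derive1E; exact: (@derive_val _ _ _ _ _ _ _ (dlam r0)). Qed.

Lemma within_pos_continuous (f : R -> R) (r : R) :
  {within `[0, +oo[, continuous f} -> 0 < r -> {for r, continuous f}.
Proof.
move/continuous_within_itvcyP => [cf _] r0; apply: cf.
by rewrite in_itv /= r0.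
Qed.

Lemma derive1_lam_continuous r : 0 < r -> {for r, continuous (derive1 lam)}.
Proof.
move=> r0; apply: (@near_eq_continuous R R phi); last exact: within_pos_continuous.
have os : open_nbhs r [set y : R | 0 < y] by split => //; exact: open_gt.
by apply: filterS (open_nbhs_nbhs os) => y y0; rewrite derive1_lam.
Qed.

Lemma radial_integral (d : nat) (b : R) : 0 < b ->
  (\int[lebesgue_measure]_(r in `]0%R, b[) (lam r ^+ d * derive1 lam r)%:E =
   ((lam b ^+ d.+1 - lam 0 ^+ d.+1) / d.+1%:R)%:E)%E.
Proof.
move=> b0; have n0 : d.+1%:R != 0 :> R by rewrite pnatr_eq0.
have sub : `[0, b] `<=` `[(0 : R), +oo[.
  by move=> x /=; rewrite !in_itv /= => /andP[->].
have clb := continuous_subspaceW sub clam.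
have cpb := continuous_subspaceW sub cphi.
pose f r := lam r ^+ d * phi r.
pose F r := lam r ^+ d.+1 / d.+1%:R.
have cf : {within `[0, b], continuous f}.
  move=> x; apply: (@continuousM R (subspace `[0, b]) (fun r => lam r ^+ d) phi); last exact: cpb.
  apply: (@continuous_comp (subspace `[0, b]) R R lam (fun y => y ^+ d)); first exact: clb.
  exact: exprn_continuous.
have cF : {within `[0, b], continuous F}.
  move=> x; apply: (@continuousM R (subspace `[0, b]) (fun r => lam r ^+ d.+1) (fun=> d.+1%:R^-1)); last exact: cst_continuous.
  apply: (@continuous_comp (subspace `[0, b]) R R lam (fun y => y ^+ d.+1)); first exact: clb.
  exact: exprn_continuous.
have dF (r : R) : 0 < r -> is_derive r 1 F (f r).
  move=> r0; have dp := is_deriveZ (d.+1%:R^-1) (is_deriveX d.+1 (dlam r0)).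
  rewrite !exprfctE in dp.
  have -> : F = (d.+1%:R^-1 : R) \*: (fun x => lam x ^+ d.+1).
    by apply/funext => x; rewrite /F mulrC.
  apply: (is_derive_eq dp); rewrite /f /GRing.scale /=.
  by rewrite -!mulrA mulKf.
have [_ cF0 cFb] := (continuous_within_itvP F b0).1 cF.
transitivity (\int[lebesgue_measure]_(r in `[0%R, b]) (f r)%:E)%E.
  transitivity (\int[lebesgue_measure]_(r in `]0%R, b[) (f r)%:E)%E.
    apply: eq_integral => r; rewrite inE /= in_itv /= => /andP[r0 _].
    by rewrite derive1_lam.
  have mf : measurable_fun `]0, b[ (EFin \o f).
    apply/measurable_EFinP; apply: open_continuous_measurable_fun.
      exact: interval_open.
    move=> x /set_mem; rewrite /= in_itv /= => /andP[x0 _].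
    apply: (@continuousM R R (fun r => lam r ^+ d) phi); last exact: (within_pos_continuous cphi).
    apply: (@continuous_comp R R R lam (fun y => y ^+ d)); last exact: exprn_continuous.
    exact: (within_pos_continuous clam).
  rewrite (integral_itv_bndo_bndc mf) integral_itv_obnd_cbnd//.
  exact/emeasurable_fun_itv_bndo_bndcP.
rewrite (continuous_FTC2 b0 cf (F := F)).
- by rewrite -EFinB -mulrBl.
- split=> //.
  move=> x; rewrite in_itv /= => /andP[x0 _].
  exact: (@ex_derive _ _ _ _ _ _ _ (dF x x0)).
- move=> x; rewrite in_itv /= => /andP[x0 _].
  by rewrite derive1E (@derive_val _ _ _ _ _ _ _ (dF x x0)).
Qed.

End radial.

Section region_volume.
Context {R : realType} {d : nat} {S : ptopologicalType} {A : atlas R d S}.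
Variable h : chart A -> 'rV[R]_d -> 'M[R]_d.
Hypotheses (sA : smooth_atlas A) (rh : riemannian_metric h).
Hypotheses (cS : compact [set: S]).
Variable volS : {measure set (borel S) -> \bar R}.
Hypothesis vh : riemannian_volume volS h.
Variable volP : {measure set (borel (R * S)%type) -> \bar R}.
Variables (lam phi : R -> R) (u : S -> R).
Hypothesis vp : riemannian_volume volP (warped_metric h lam).
Hypothesis clam : {within `[0, +oo[, continuous lam}.
Hypothesis cphi : {within `[0, +oo[, continuous phi}.
Hypothesis dlam : forall r : R, 0 < r -> is_derive r 1 lam (phi r).
Hypothesis lam0 : forall r : R, 0 < r -> 0 < lam r.
Hypothesis phi0 : forall r : R, 0 < r -> 0 <= phi r.
Hypotheses (cu : continuous u) (u0 : forall t, 0 < u t).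

Let vdc := @vol_density_continuous _ _ _ _ h sA rh.

Let cyl_inv (i : chart A) (x : 'rV[R]_d.+1) : R * S :=
  ((row_uncons x).1, chart_inv0 i (row_uncons x).2).

Let pos_lam : R -> R := (fun r => lam r ^+ d) \_ `]0, +oo[.
Let pos_dlam : R -> R := (derive1 lam) \_ `]0, +oo[.

Let cyl_density (i : chart A) (x : 'rV[R]_d.+1) : R :=
  pos_lam (row_uncons x).1 * chart_density h i (row_uncons x).2.

Let pos_lam_ge0 r : 0 <= pos_lam r.
Proof.
rewrite /pos_lam patchE; case: ifPn => // /set_mem; rewrite /= in_itv /= andbT => r0.
by rewrite exprn_ge0// ltW// lam0.
Qed.

Let pos_dlam_ge0 r : 0 <= pos_dlam r.
Proof.
rewrite /pos_dlam patchE; case: ifPn => // /set_mem; rewrite /= in_itv /= andbT => r0.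
by rewrite (derive1_lam dlam r0) phi0.
Qed.

Let mpos_lam : measurable_fun setT pos_lam.
Proof.
apply/(measurable_restrictT _ _).1; first exact: measurable_itv.
apply: open_continuous_measurable_fun; first exact: interval_open.
move=> x /set_mem; rewrite /= in_itv /= andbT => x0.
apply: (@continuous_comp R R R lam (fun y => y ^+ d)); last exact: exprn_continuous.
exact: (within_pos_continuous clam).
Qed.

Let mpos_dlam : measurable_fun setT pos_dlam.
Proof.
apply/(measurable_restrictT _ _).1; first exact: measurable_itv.
apply: open_continuous_measurable_fun; first exact: interval_open.
move=> x /set_mem; rewrite /= in_itv /= andbT => x0.
exact: (derive1_lam_continuous cphi dlam).
Qed.

Let measurable_uncons1 : measurable_fun setT
  (fun x : borel 'rV[R]_d.+1 => (row_uncons x).1 : measurableTypeR R).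
Proof. by apply: measurableT_comp (@measurable_row_uncons R d); exact: measurable_fst. Qed.

Let measurable_uncons2 : measurable_fun setT
  (fun x : borel 'rV[R]_d.+1 => (row_uncons x).2 : borel 'rV[R]_d).
Proof. by apply: measurableT_comp (@measurable_row_uncons R d); exact: measurable_snd. Qed.

Let mcyl_density (i : chart A) :
  measurable_fun setT (cyl_density i : borel 'rV[R]_d.+1 -> R).
Proof.
apply: measurable_funM.
  exact: measurableT_comp mpos_lam measurable_uncons1.
exact: measurableT_comp (measurable_chart_density sA vdc i) measurable_uncons2.
Qed.

Let cyl_density_ge0 i x : 0 <= cyl_density i x.
Proof. by rewrite mulr_ge0// chart_density_ge0. Qed.

Let uncons1_continuous : continuous (fun x : 'rV[R]_d.+1 => (row_uncons x).1).
Proof.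
move=> x.
rewrite (_ : (fun x0 : 'rV_d.+1 => _) = fun x : 'rV_d.+1 => x 0 (lshift d (ord0 : 'I_1))).
  exact: coord_continuous.
by apply/funext=> y; rewrite /row_uncons mxE.
Qed.

Let uncons2_continuous : continuous (fun x : 'rV[R]_d.+1 => (row_uncons x).2).
Proof. exact: (@continuous_rsubmx _ 1 1 d). Qed.

Let mcyl_inv i :
  measurable_fun setT (cyl_inv i : borel 'rV[R]_d.+1 -> borel (R * S)%type).
Proof.
apply: (@measurable_fun_to_borel (R * S)%type) => O oO; rewrite setTI.
pose U : set 'rV[R]_d.+1 := (fun x => (row_uncons x).2) @^-1` chart_image i.
have oU : open U.
  by have /continuousP := uncons2_continuous; apply; exact: (open_chart_image sA).
have mU : measurable (U : set (borel 'rV[R]_d.+1)) by exact: borel_open.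
pose O1 := U `&` [set x : 'rV[R]_d.+1 | O ((row_uncons x).1, chart_inv i (row_uncons x).2)].
have oO1 : open O1.
  rewrite openE => x [Ux Ox]; rewrite /interior; apply: filterI.
    by apply: open_nbhs_nbhs; split.
  have cx : {for x, continuous (fun x : 'rV[R]_d.+1 =>
      ((row_uncons x).1, chart_inv i (row_uncons x).2) : R * S)}.
    have c2 : {for x, continuous (fun x : 'rV[R]_d.+1 => chart_inv i (row_uncons x).2)}.
      apply: (@continuous_comp _ _ _ (fun x : 'rV[R]_d.+1 => (row_uncons x).2) (chart_inv i)).
        exact: uncons2_continuous.
      exact: (chart_inv_continuous sA).
    exact: (cvg_pair (@uncons1_continuous x) c2).
  by apply: cx; apply: open_nbhs_nbhs; split.
pose O2 := [set x : 'rV[R]_d.+1 | O ((row_uncons x).1, point : S)].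
have oO2 : open O2.
  have /continuousP : continuous (fun x : 'rV[R]_d.+1 => ((row_uncons x).1, point : S)).
    by move=> x; exact: (cvg_pair (@uncons1_continuous x) (cvg_cst (point : S))).
  by move/(_ _ oO).
rewrite (_ : _ @^-1` _ = O1 `|` (~` U `&` O2)).
  apply: measurableU; first exact: borel_open.
  by apply: measurableI; [exact: measurableC|exact: borel_open].
apply/seteqP; split=> x; rewrite /O1 /O2 /U /cyl_inv /chart_inv0 /=.
  by case: ifPn => [/set_mem|/negP]; rewrite ?inE; tauto.
by case: ifPn => [/set_mem|/negP]; rewrite ?inE; tauto.
Qed.

Let warped_density (i : chart A) (x : 'rV[R]_d.+1) : 0 < (row_uncons x).1 ->
  Num.sqrt (\det (warped_metric h lam i x)) =
  lam (row_uncons x).1 ^+ d * Num.sqrt (\det (h i (row_uncons x).2)).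
Proof.
move=> x0; rewrite /warped_metric det_lblock det1 mul1r detZ -exprM mulnC exprM.
rewrite sqrtrM ?sqr_ge0// sqrtr_sqr ger0_norm//.
by rewrite exprn_ge0// ltW// lam0.
Qed.

Let volPE i (B : set (R * S)) : measurable (B : set (borel (R * S)%type)) ->
  B `<=` `]0, +oo[ `*` chart_dom i ->
  volP B = (\int[lebesgue_rV d.+1]_x
    ((cyl_density i x)%:E * (\1_B (cyl_inv i x))%:E))%E.
Proof.
move=> mB Bi; rewrite (vp (i := i) mB Bi).
rewrite -[RHS]lebesgue_intE.
- congr lebesgue_int; apply/funext => x.
  rewrite patchE; case: ifPn => [/set_mem[[r t] Brt <-]|xB].
    have [/=] := Bi _ Brt; rewrite in_itv /= andbT => r0 it.
    have E : row_uncons (row_mx (r%:M : 'rV[R]_1) (chart_map i t)) = (r, chart_map i t).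
      exact: (row_consK (r, chart_map i t)).
    rewrite warped_density ?E// /cyl_density /cyl_inv E /= /pos_lam /chart_density.
    rewrite /chart_inv0 !patchE !mem_set//.
    + rewrite chart_mapK// indicE mem_set//.
      by rewrite mule1.
    + exact: chart_map_image.
    + by rewrite /= in_itv /= r0.
  rewrite /cyl_density /cyl_inv /pos_lam /chart_density /chart_inv0 !patchE.
  case: ifPn => [/set_mem|_]; last by rewrite mul0r mul0e.
  case: ifPn => [/set_mem ix /= x0|_]; last by rewrite mulr0 mul0e.
  rewrite indicE (_ : _ \in B = false) ?mule0//; apply/negbTE; apply: contra xB.
  rewrite !inE => Bx; exists ((row_uncons x).1, chart_inv i (row_uncons x).2) => //=.
  by rewrite chart_invK//; exact: (row_unconsK x).
- apply: emeasurable_funM; apply/measurable_EFinP.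
    exact: mcyl_density.
  by apply: (measurableT_comp _ (mcyl_inv i)); exact: measurable_indic.
- by move=> x; rewrite mule_ge0// lee_fin cyl_density_ge0.
Qed.

Let f (p : R * S) : \bar R := (pos_dlam p.1 * \1_(inner_region u) p)%:E.

Let snd_measurable (E : set S) : measurable (E : set (borel S)) ->
  measurable (`]0, +oo[ `*` E : set (borel (R * S)%type)).
Proof.
move=> mE; apply: measurableI.
  have mfst : measurable_fun setT (fst : borel (R * S)%type -> R).
    by apply: (@borel_continuous (R * S)%type); move=> x; exact: cvg_fst.
  by have := mfst measurableT `]0, +oo[%classic (measurable_itv _); rewrite setTI.
have msnd : measurable_fun setT (snd : borel (R * S)%type -> borel S).
  by apply: (@borel_continuous_map (R * S)%type S); move=> x; exact: cvg_snd.
by have := msnd measurableT E mE; rewrite setTI.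
Qed.

Let open_inner_region : open (inner_region u).
Proof.
rewrite (_ : inner_region u = [set p : R * S | 0 < p.1] `&` [set p : R * S | 0 < u p.2 - p.1]).
  apply: openI.
    have /continuousP : continuous (fst : R * S -> R) by move=> x; exact: cvg_fst.
    by move/(_ [set y | 0 < y]); apply; exact: open_gt.
  have /continuousP : continuous (fun p : R * S => u p.2 - p.1).
    move=> x; apply: cvgB; last exact: cvg_fst.
    by apply: (@continuous_comp _ _ _ (snd : R * S -> S) u); [exact: cvg_snd|exact: cu].
  by move/(_ [set y | 0 < y]); apply; exact: open_gt.
by apply/seteqP; split=> p; rewrite /inner_region /= subr_gt0; [move=> /andP[]|move=> [-> ->]].
Qed.

Let mf : measurable_fun setT (f : borel (R * S)%type -> \bar R).
Proof.
apply/measurable_EFinP/measurable_funM.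
  apply: measurableT_comp mpos_dlam _.
  by apply: (@borel_continuous (R * S)%type); move=> x; exact: cvg_fst.
by apply: measurable_indic; apply: (@borel_open (R * S)%type); exact: open_inner_region.
Qed.

Let f_ge0 p : (0 <= f p)%E.
Proof. by rewrite lee_fin mulr_ge0. Qed.

Let Phi t : R := (lam (u t) ^+ d.+1 - lam 0 ^+ d.+1) / d.+1%:R.

Let Phi_continuous : continuous Phi.
Proof.
move=> t; apply: cvgM; last exact: cvg_cst.
apply: cvgB; last exact: cvg_cst.
apply: (@continuous_comp _ _ _ (fun t => lam (u t)) (fun y => y ^+ d.+1)).
  apply: (@continuous_comp _ _ _ u lam); first exact: cu.
  exact: (within_pos_continuous clam).
exact: exprn_continuous.
Qed.

Let radial t : (\int[lebesgue_measure]_r ((pos_lam r)%:E * f (r, t)) = (Phi t)%:E)%E.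
Proof.
rewrite -(radial_integral clam cphi dlam d (u0 t)) [RHS]integral_mkcond.
apply: eq_integral => r _; rewrite patchE /f /pos_lam /pos_dlam !patchE indicE /=.
case: ifPn => [/set_mem|]; last first.
  rewrite mul0e => /negP r0; rewrite memNset//= in_itv /= => /andP[r1 _].
  by apply: r0; rewrite inE /= in_itv /= r1.
rewrite /= in_itv /= andbT => r0.
rewrite (_ : ((r, t) \in inner_region u) = (r \in `]0, u t[)); last first.
  by rewrite in_itv; apply/idP/idP; rewrite inE.
rewrite (_ : (r \in [set` `]0, u t[]) = (r \in `]0, u t[)); last first.
  by apply/idP/idP => [/set_mem|/mem_set].
by case: ifPn => _; rewrite ?mulr1 ?mulr0 -EFinM ?mulr0.
Qed.

Let Phi_ge0 t : 0 <= Phi t.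
Proof.
rewrite -lee_fin -radial; apply: integral_ge0 => r _.
by rewrite mule_ge0// lee_fin.
Qed.

Let integral_region_chart (i : chart A) (E : set S) : measurable (E : set (borel S)) ->
  E `<=` chart_dom i ->
  (\int[volP]_(p in (`]0%R, +oo[%classic `*` E)%classic) f p = \int[volS]_(t in E) (Phi t)%:E)%E.
Proof.
move=> mE Ei; have mD := snd_measurable mE.
have muE B : measurable (B : set (borel (R * S)%type)) -> B `<=` `]0, +oo[ `*` E ->
    volP B = (\int[lebesgue_rV d.+1]_x
      ((cyl_density i x)%:E * (\1_B (cyl_inv i x))%:E))%E.
  by move=> mB BE; apply: volPE => // p /BE[p1 /Ei].
rewrite (ge0_integral_density (mcyl_inv i) (mcyl_density i) (cyl_density_ge0 i) mD muE mf f_ge0).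
rewrite ge0_integral_lebesgue_rVS_swap; last 2 first.
- apply: emeasurable_funM; first by apply/measurable_EFinP; exact: mcyl_density.
  apply: emeasurable_funM; first exact: measurableT_comp mf (mcyl_inv i).
  by apply/measurable_EFinP; apply: (measurableT_comp _ (mcyl_inv i)); exact: measurable_indic.
- by move=> x; rewrite !mule_ge0// lee_fin.
transitivity (\int[volS]_(t in chart_dom i) ((Phi t)%:E * (\1_E t)%:E))%E.
  rewrite (ge0_chart_integral sA vh vdc i); last 2 first.
  - apply: emeasurable_funM; apply/measurable_EFinP; last exact: measurable_indic.
    exact: borel_continuous.
  - by move=> t; rewrite mule_ge0// lee_fin.
  apply: eq_integral => y _.
  transitivity (\int[lebesgue_measure]_r ((chart_density h i y * \1_E (chart_inv0 i y))%:E *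
     ((pos_lam r)%:E * f (r, chart_inv0 i y))))%E.
    apply: eq_integral => r _; rewrite /cyl_density /cyl_inv row_consK /=.
    rewrite [X in (_ * (_ * X%:E))%E](_ : _ = \1_`]0, +oo[ r * \1_E (chart_inv0 i y)).
      rewrite /f -!EFinM; congr EFin; rewrite /pos_lam patchE.
      case: ifPn => [r0|_]; last by rewrite !(mul0r, mulr0).
      rewrite [\1_`]0, +oo[ r]indicE r0 mul1r.
      by rewrite -!mulrA; ring.
    by rewrite !indicE in_setX /= -natrM mulnb.
  rewrite ge0_integralZl//; last first.
  - by rewrite lee_fin mulr_ge0// chart_density_ge0.
  - by move=> r _; rewrite mule_ge0// lee_fin.
  - apply: emeasurable_funM; first exact/measurable_EFinP.
    rewrite /f /=; apply/measurable_EFinP/measurable_funM => //.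
    rewrite (_ : (fun x => \1_(inner_region u) (x, chart_inv0 i y)) = \1_(`]0, u (chart_inv0 i y)[ : set R))//.
  by rewrite radial EFinM -muleA; congr (_ * _)%E; rewrite muleC.
rewrite [LHS]integral_mkcond [RHS]integral_mkcond; apply: eq_integral => t _.
rewrite !patchE indicE; have [tE|tE] := boolP (t \in E).
  by rewrite mule1 mem_set//; apply: Ei; exact: set_mem.
by rewrite mule0; case: ifP.
Qed.

Lemma integral_inner_region :
  (\int[volP]_(p in inner_region u) (derive1 lam p.1)%:E =
   \int[volS]_t ((lam (u t) ^+ d.+1 - lam 0 ^+ d.+1) / d.+1%:R)%:E)%E.
Proof.
have [c [E [mE tE UE Ec]]] := chart_partition sA cS.
rewrite (ge0_integral_partition volS mE tE UE (f := fun t => (Phi t)%:E)); last 2 first.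
- by apply/measurable_EFinP; exact: borel_continuous.
- by move=> t; rewrite lee_fin.
have E2 : \bigcup_k (`]0%R, +oo[%classic `*` E k) = (`]0%R, +oo[%classic `*` [set: S])%classic :> set (R * S).
  rewrite -UE; apply/seteqP; split=> [[r t] [k _ [/= r0 kt]]|[r t] [/= r0 [k _ kt]]].
    by split=> //; exists k.
  by exists k.
transitivity (\int[volP]_(p in (`]0%R, +oo[%classic `*` [set: S])%classic) f p)%E.
  rewrite [LHS]integral_mkcond [RHS]integral_mkcond; apply: eq_integral => p _.
  rewrite !patchE /f /pos_dlam patchE indicE.
  have [/set_mem|_] := boolP (p \in inner_region u).
    rewrite /inner_region /= => /andP[p0 _].
    by rewrite !mem_set ?mulr1//=; [rewrite in_itv /= p0|split; rewrite //= in_itv /= p0].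
  by rewrite mulr0; case: ifP.
rewrite -E2 ge0_integral_bigcup//.
- by apply: eq_eseriesr => k _; apply: (integral_region_chart (mE k) (Ec k)).
- by move=> k; exact: snd_measurable.
- exact: (measurable_funS _ _ mf).
- move=> i j _ _ [[r t] [[/= _ it] [/= _ jt]]]; apply: tE => //.
  by exists t.
Qed.

End region_volume.

(** * The inequality *)

(* Here [L] is [lam], [Q] is [qfacS], [B] is [(a^n - lam^n) / n] and [X] is
   [(n - 1) F lam'] with [F] the test function; [w = Q^2 - L^2]. *)
Lemma pointwise_below {R : realFieldType} (e : nat) (a L Q X B : R) :
  0 < L -> L < a -> L <= Q -> 0 <= X ->
  X <= B - (a - L) * L ^+ e.+2 ->
  (X * L - (a - L) * L ^+ e.+1 * (Q ^+ 2 - L ^+ 2)) / Q <=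
  (L - a) * (L ^+ e.+1 * Q) + B.
Proof.
move=> L0 La LQ X0 XB; have Q0 : 0 < Q by exact: lt_le_trans LQ.
pose P := (a - L) * L ^+ e.+1.
have P0 : 0 <= P by rewrite mulr_ge0 ?exprn_ge0 ?subr_ge0 ?ltW.
have PL : (a - L) * L ^+ e.+2 = P * L by rewrite /P exprSr mulrA.
rewrite PL in XB; rewrite -/P.
have -> : (L - a) * (L ^+ e.+1 * Q) = - (P * Q) by rewrite /P; ring.
rewrite ler_pdivrMr//.
have h1 : X * L <= X * Q by rewrite ler_wpM2l.
have h2 : X * Q <= (B - P * L) * Q by rewrite ler_wpM2r// ltW.
have h3 : P * L * L <= P * L * Q by rewrite ler_wpM2l// mulr_ge0// ltW.
by rewrite !expr2; nra.
Qed.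

Lemma pointwise_above {R : realFieldType} (e : nat) (a L Q : R) :
  0 < L -> 0 <= a -> a <= L -> L <= Q ->
  (a ^+ e.+3 + e.+2%:R * L ^+ e.+3 - e.+3%:R * a * L ^+ e.+2) / e.+3%:R <=
  (L - a) * (L ^+ e.+1 * Q) + (a ^+ e.+3 - L ^+ e.+3) / e.+3%:R.
Proof.
move=> L0 a0 aL LQ; have n0 : e.+3%:R != 0 :> R by rewrite pnatr_eq0.
have h : (L - a) * (L ^+ e.+1 * L) <= (L - a) * (L ^+ e.+1 * Q).
  by rewrite ler_wpM2l ?subr_ge0// ler_wpM2l// exprn_ge0// ltW.
apply: le_trans (lerD h (lexx _)); rewrite le_eqVlt; apply/orP; left; apply/eqP.
have -> : (e.+2%:R : R) = e.+3%:R - 1 by rewrite -[e.+3%:R]natr1 addrK.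
by rewrite [L ^+ e.+3]exprSr [L ^+ e.+2]exprSr; field.
Qed.

Section graph_inequality.
Context {R : realType} {e : nat} {S : ptopologicalType} {A : atlas R e.+2 S}.
Variable h : chart A -> 'rV[R]_e.+2 -> 'M[R]_e.+2.
Hypotheses (sA : smooth_atlas A) (rh : riemannian_metric h).
Hypotheses (hS : hausdorff_space S) (cS : compact [set: S]).
Variables volS area : {measure set (borel S) -> \bar R}.
Variable volP : {measure set (borel (R * S)%type) -> \bar R}.
Variables (lam phi : R -> R) (u : S -> R).
Hypothesis vh : riemannian_volume volS h.
Hypothesis va : riemannian_volume area (graph_metric h lam u).
Hypothesis vp : riemannian_volume volP (warped_metric h lam).
Hypothesis clam : {within `[0, +oo[, continuous lam}.
Hypothesis cphi : {within `[0, +oo[, continuous phi}.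
Hypothesis dlam : forall r : R, 0 < r -> is_derive r 1 lam (phi r).
Hypothesis phi0 : forall r : R, 0 < r -> 0 <= phi r.
Hypothesis phi_mono : forall r s : R, 0 < r -> r <= s -> phi r <= phi s.
Hypothesis lam0 : forall r : R, 0 <= r -> 0 < lam r.
Hypothesis lam_mono : forall r s : R, 0 <= r -> r < s -> lam r < lam s.
Hypothesis lam_onto : forall y : R, lam 0 <= y -> exists2 r, 0 <= r & lam r = y.
Hypotheses (cu : C1_manifold A u)
  (cdu : forall (i : chart A) a,
    C1 (chart_image i) (partial a (fun x => u (chart_inv i x)))).
Hypothesis u0 : forall t, 0 < u t.
Hypothesis mc : strictly_mean_convex h lam u.

Local Notation vdc := (@vol_density_continuous _ _ _ _ h sA rh).
Local Notation L t := (lam (u t)).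
Local Notation Q := (qfacS h sA lam u).
Local Notation ad := (area_density h sA lam u).
Local Notation I f := (\int[volS]_t f t).

Let lam_u0 t : 0 < lam (u t). Proof. by apply: lam0; exact: ltW. Qed.
Let dlam_u t : derivable lam (u t) 1.
Proof. exact: (@ex_derive _ _ _ _ _ _ _ (dlam (u0 t))). Qed.
Let clam_u t : {for u t, continuous (derive1 lam)}.
Proof. exact: (derive1_lam_continuous cphi dlam). Qed.

Let cont_u : continuous u := C1_manifold_continuous sA cu.
Let cL : continuous (fun t => L t) := lam_u_continuous sA cu dlam_u.
Let cad : continuous ad := area_density_continuous rh cu lam_u0 dlam_u.

Let int (f : S -> R) : continuous f -> volS.-integrable setT (EFin \o f : borel S -> \bar R).
Proof. exact: (integrable_continuous sA vh vdc cS). Qed.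

Let ID (f g : S -> R) : continuous f -> continuous g -> I (fun t => f t + g t) = I f + I g.
Proof. by move=> cf cg; rewrite RintegralD//; exact: int. Qed.

Let IZ c (f : S -> R) : continuous f -> I (fun t => c * f t) = c * I f.
Proof. by move=> cf; rewrite RintegralZl//; exact: int. Qed.

Let theta := fine (volS setT).

Let IC c : I (fun=> c) = c * theta.
Proof. exact: Rintegral_cst. Qed.

Let Ile (f g : S -> R) : continuous f -> continuous g -> (forall t, f t <= g t) -> I f <= I g.
Proof. by move=> cf cg fg; apply: le_Rintegral => //; exact: int. Qed.

Let det0 (i : chart A) x : chart_image i x -> 0 < \det (h i x).
Proof. by move=> ix; apply: posdef_det_gt0; exact: (metric_posdef rh). Qed.

Let Igt0 (f : S -> R) t : continuous f -> (forall s, 0 <= f s) -> 0 < f t -> 0 < I f.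
Proof.
move=> cf f0 ft; apply: fine_gt0; rewrite (integral_continuous_gt0 sA vh vdc det0 cf f0 ft).
have /integrable_fin_num := int cf.
by move=> /(_ measurableT); rewrite fin_numElt => /andP[].
Qed.

Let theta_gt0 : 0 < theta.
Proof.
rewrite -[theta]mul1r -IC; apply: (Igt0 (t := point)) => //.
exact: cst_continuous.
Qed.

Lemma Rintegral_area (f : S -> R) : continuous f -> (forall t, 0 <= f t) ->
  \int[area]_t f t = I (fun t => ad t * f t).
Proof.
move=> cf f0; rewrite /Rintegral; congr fine.
rewrite (integral_area sA rh cS vh va cu lam_u0 dlam_u) //.
by apply/measurable_EFinP; exact: borel_continuous.
Qed.

Lemma area_total : fine (area setT) = I ad.
Proof.
rewrite -[LHS]mul1r -(Rintegral_cst area measurableT 1) Rintegral_area//.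
  by apply: eq_Rintegral => t _; rewrite mulr1.
exact: cst_continuous.
Qed.

Let d := e.+2.
Let a := (fine (area setT) / theta) `^ (d%:R^-1).

Let a_ge0 : 0 <= a. Proof. exact: powR_ge0. Qed.

Let aX : a ^+ d = fine (area setT) / theta.
Proof.
rewrite -powR_mulrn// /a -powRrM mulVf ?pnatr_eq0// powRr1//.
by rewrite divr_ge0 ?fine_ge0.
Qed.

Let Iad : I ad = theta * a ^+ d.
Proof. by rewrite aX area_total mulrC divfK// gt_eqF. Qed.

Let lamL t : lam 0 < L t. Proof. exact: lam_mono. Qed.
Let L_le_Q t : L t <= Q t := lam_le_qfacS sA rh cu lam_u0 t.

Let adE t : ad t = L t ^+ e.+1 * Q t.
Proof. by rewrite /area_density exprSr mulfK// gt_eqF. Qed.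

Let lam0a : lam 0 <= a.
Proof.
have l0 : 0 < lam 0 by exact: lam0.
rewrite -(@ler_pXn2r _ d)// ?nnegrE ?(ltW l0)//.
rewrite -(ler_pM2l theta_gt0) -Iad mulrC -IC; apply: Ile => //.
  exact: cst_continuous.
move=> t; rewrite adE {1}/d [lam 0 ^+ _]exprSr; apply: ler_pM; rewrite ?exprn_ge0 ?(ltW l0)//.
  by rewrite lerXn2r// ?nnegrE ?(ltW l0)// ltW.
exact: le_trans (ltW (lamL t)) (L_le_Q t).
Qed.

(* Its integral is the difference of the two sides of the inequality. *)
Definition deficit t := (L t - a) * ad t + (a ^+ d.+1 - L t ^+ d.+1) / d.+1%:R.

Let cLX k : continuous (fun t => L t ^+ k).
Proof.
move=> t; apply: (@continuous_comp _ _ _ (fun t => L t) (fun y => y ^+ k)); first exact: cL.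
exact: exprn_continuous.
Qed.

Let c_deficit : continuous deficit.
Proof.
move=> t; apply: cvgD.
  by apply: cvgM; [apply: cvgB; [exact: cL|exact: cvg_cst]|exact: cad].
by apply: cvgM; [apply: cvgB; [exact: cvg_cst|exact: cLX]|exact: cvg_cst].
Qed.

Lemma deficitE : I deficit =
  \int[area]_t lam (u t)
  - (\int[volP]_(p in inner_region u) derive1 lam p.1
     + d%:R / d.+1%:R * theta * (fine (area setT) / theta) `^ (d.+1%:R / d%:R)
     + lam 0 / d.+1%:R * (lam 0 ^+ d * theta)).
Proof.
have n0 : d.+1%:R != 0 :> R by rewrite pnatr_eq0.
have -> : (fine (area setT) / theta) `^ (d.+1%:R / d%:R) = a ^+ d.+1.
  by rewrite -powR_mulrn// /a -powRrM [d%:R^-1 * _]mulrC.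
have -> : \int[area]_t lam (u t) = I (fun t => ad t * L t).
  by rewrite Rintegral_area// => t; exact: ltW.
have -> : \int[volP]_(p in inner_region u) derive1 lam p.1 =
    I (fun t => d.+1%:R^-1 * L t ^+ d.+1 + - (lam 0 ^+ d.+1 / d.+1%:R)).
  rewrite /Rintegral (integral_inner_region sA rh cS vh vp clam cphi dlam _ phi0 cont_u u0).
    by congr fine; apply: eq_integral => t _; congr EFin; rewrite mulrBl mulrC.
  by move=> r /ltW; exact: lam0.
have cp k (f : S -> R) : continuous f -> continuous (fun t => k * f t).
  by move=> cf t; apply: cvgM; [exact: cvg_cst|exact: cf].
rewrite (ID (cp _ _ (@cLX d.+1)) (@cst_continuous _ _ _)) (IZ _ (@cLX d.+1)) IC.
transitivity (I (fun t => (ad t * L t + - a * ad t) + - d.+1%:R^-1 * L t ^+ d.+1 + a ^+ d.+1 / d.+1%:R)).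
  by apply: eq_Rintegral => t _; rewrite /deficit; ring.
have c1 : continuous (fun t => ad t * L t) by move=> t; apply: cvgM; [exact: cad|exact: cL].
have c2 : continuous (fun t => ad t * L t + - a * ad t).
  by move=> t; apply: cvgD; [exact: c1|exact: (cp _ _ (@cad))].
have c3 : continuous (fun t => ad t * L t + - a * ad t + - d.+1%:R^-1 * L t ^+ d.+1).
  by move=> t; apply: cvgD; [exact: c2|exact: (cp _ _ (@cLX _))].
rewrite (ID c3 (@cst_continuous _ _ _)) (ID c2 (cp _ _ (@cLX _))) (ID c1 (cp _ _ (@cad))).
rewrite (IZ _ (@cLX _)) (IZ _ (@cad)).
rewrite IC Iad [a ^+ d.+1]exprS [lam 0 ^+ d.+1]exprS.
have -> : (d%:R : R) = d.+1%:R - 1 by rewrite -[d.+1%:R]natr1 addrK.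
by field.
Qed.

Lemma gdot_comp1 (F : R -> R) (dF : S -> R) t :
  (forall t, is_derive (u t) 1 F (dF t)) ->
  gdot h sA (fun t => F (u t)) u t = dF t * gdot h sA u u t.
Proof.
move=> DF; rewrite /gdot !local_gdotE mulr_sumr; apply: eq_bigr => b _.
set i := chart_at sA t; have it : chart_image i (chart_map i t).
  by apply: chart_map_image; exact: chart_atP.
rewrite mulrCA; congr (_ * _).
have [_ du _] := C1_at (@cu i) it.
have := DF (chart_inv i (chart_map i t)).
rewrite chart_mapK//; last exact: chart_atP.
have tE : u t = u (chart_inv i (chart_map i t)) by rewrite chart_mapK//; exact: chart_atP.
rewrite tE => Ft.
have H := is_derive_comp1 (derivableP (du b)) Ft.
by rewrite /partial -(@derive_val _ _ _ _ _ _ _ H).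
Qed.

Lemma deficit_bound : exists M : S -> R,
  [/\ continuous M, forall t, M t <= deficit t, 0 <= I M,
      forall t, L t < a -> 0 < I M &
      forall t, a < L t -> M t < deficit t].
Proof.
have [b b0 lamb] := lam_onto lam0a.
have [F [dF F0 Fpos Fz Fle]] :=
  test_function e.+1 clam dlam phi_mono lam0 lam_mono b0 lamb.
pose psi t := F (u t).
pose F' (r : R) : R := - (Num.max (a - lam r) 0 * lam r ^+ e.+1).
have dFE r : 0 < r -> derive1 F r = F' r.
  by move=> r0; rewrite derive1E; exact: (@derive_val _ _ _ _ _ _ _ (dF r r0)).
have cF' (r : R) : 0 < r -> {for r, continuous F'}.
  move=> r0; have cl := within_pos_continuous clam r0.
  apply: cvgN; apply: cvgM.
    apply: (@continuous_max R R (fun r => a - lam r) (fun=> 0)); last exact: cst_continuous.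
    by apply: cvgB; [exact: cvg_cst|exact: cl].
  by apply: (@continuous_comp _ _ _ lam (fun y => y ^+ e.+1)); [exact: cl|exact: exprn_continuous].
have cdF (r : R) : 0 < r -> {for r, continuous (derive1 F)}.
  move=> r0; apply: (@near_eq_continuous R R F'); last exact: cF'.
  have os : open_nbhs r [set y : R | 0 < y] by split => //; exact: open_gt.
  by apply: filterS (open_nbhs_nbhs os) => y y0; rewrite dFE.
have cpsi : C1_manifold A psi.
  move=> i; apply: (C1_comp1 (open_chart_image sA i) (@cu i)) => x _; last exact: cdF.
  exact: (@ex_derive _ _ _ _ _ _ _ (dF _ (u0 _))).
have psi0 t : 0 <= psi t by exact: F0.
pose M := mean_integrand h sA lam u psi.
have cM : continuous M := mean_integrand_continuous rh cu lam_u0 dlam_u clam_u cpsi.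
have QE t : gdot h sA u u t = Q t ^+ 2 - L t ^+ 2.
  by rewrite (qfacS_sqr sA rh lam cu) addrC addKr.
have gpsi t : gdot h sA psi u t = F' (u t) * gdot h sA u u t.
  by apply: (@gdot_comp1 F (fun t => F' (u t))) => s; exact: dF.
have ME t : M t = (psi t * (d%:R * phi (u t) * L t) + F' (u t) * (Q t ^+ 2 - L t ^+ 2)) / Q t.
  by rewrite /M /mean_integrand (derive1_lam dlam (u0 t)) gpsi QE.
have Mabove t : a <= L t -> M t = 0.
  move=> aL; rewrite ME /psi Fz// /F' max_r ?subr_le0//.
  by rewrite !mul0r oppr0 mul0r addr0 mul0r.
exists M; split=> //.
- move=> t; have [La|aL] := ltP (L t) a; last first.
    rewrite Mabove// /deficit adE; apply: le_trans (pointwise_above e (lam_u0 t) a_ge0 aL (L_le_Q t)).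
    by rewrite divr_ge0// young_ge0// ltW.
  rewrite ME /deficit adE /F' max_l ?subr_ge0 ?(ltW La)//.
  have X0 : 0 <= d%:R * psi t * phi (u t) by rewrite !mulr_ge0// phi0.
  have := pointwise_below (lam_u0 t) La (L_le_Q t) X0 (Fle _ (u0 t) La).
  apply: le_trans; rewrite le_eqVlt; apply/orP; left; apply/eqP; congr (_ / _).
  by rewrite /psi; ring.
- apply: fine_ge0.
  exact: (mean_integral_ge0 sA rh hS cS vh cu cdu lam_u0 dlam_u clam_u mc cpsi psi0).
- move=> t La; apply: fine_gt0; apply/andP; split.
    apply: (mean_integral_gt0 sA rh hS cS vh cu cdu lam_u0 dlam_u clam_u mc cpsi psi0 (t := t)).
    exact: Fpos.
  have /integrable_fin_num := int cM.
  by move=> /(_ measurableT); rewrite fin_numElt => /andP[].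
- move=> t aL; rewrite Mabove ?ltW// /deficit adE.
  apply: lt_le_trans (pointwise_above e (lam_u0 t) a_ge0 (ltW aL) (L_le_Q t)).
  by rewrite divr_gt0 ?ltr0n// young_gt0 ?(ltW (lam_u0 t))// lt_eqF.
Qed.

Lemma deficit_ge0 : 0 <= I deficit.
Proof.
have [M [cM ME M0 _ _]] := deficit_bound.
exact: le_trans M0 (Ile cM c_deficit ME).
Qed.

Lemma deficit_eq0 : I deficit = 0 <-> exists s, forall t, L t = s.
Proof.
have [M [cM ME M0 Mlt Mgt]] := deficit_bound; split.
  move=> I0; exists a => t; apply: contrapT => /eqP; rewrite neq_lt => /orP[La|aL].
    have := lt_le_trans (Mlt t La) (Ile cM c_deficit ME).
    by rewrite I0 ltxx.
  have cDM : continuous (fun t => deficit t + - 1 * M t).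
    by move=> s; apply: cvgD; [exact: c_deficit|apply: cvgM; [exact: cvg_cst|exact: cM]].
  have : 0 < I (fun t => deficit t + - 1 * M t).
    apply: (Igt0 (t := t)) => //.
      by move=> s; rewrite mulN1r subr_ge0.
    by rewrite mulN1r subr_gt0 Mgt.
  rewrite ID//; last by move=> s; apply: cvgM; [exact: cvg_cst|exact: cM].
  rewrite IZ// I0 add0r mulN1r oppr_gt0.
  by rewrite ltNge M0.
move=> [s Ls].
have uC t : u t = u point.
  apply: contrapT => /eqP; rewrite neq_lt => /orP[] /(lam_mono (ltW (u0 _))).
    by rewrite !Ls ltxx.
  by rewrite !Ls ltxx.
have QE t : Q t = s.
  have -> : Q t = Num.sqrt (s ^+ 2).
    rewrite /qfacS Ls.
    rewrite (_ : gdot h sA u u t = 0) ?addr0//.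
    rewrite /gdot local_gdotE big1// => b _.
    rewrite (_ : (fun x => u (chart_inv (chart_at sA t) x)) = fun=> u point); last first.
      by apply/funext => x; rewrite uC.
    by rewrite partial_cst mulr0.
  by rewrite sqrtr_sqr ger0_norm// -(Ls point) ltW.
have s0 : 0 < s by rewrite -(Ls point).
have as' : a = s.
  have : a ^+ d = s ^+ d.
    apply: (mulfI (lt0r_neq0 theta_gt0)); rewrite -Iad [RHS]mulrC -IC.
    by apply: eq_Rintegral => t _; rewrite adE Ls QE -exprSr.
  by move/eqP; rewrite eqrXn2// ?(ltW s0)// => /eqP.
rewrite (_ : deficit = fun=> 0) ?IC ?mul0r//.
by apply/funext => t; rewrite /deficit Ls as' !subrr !mul0r addr0.
Qed.

End graph_inequality.

Theorem theorem1p4 (R : realType) (n : nat) (n_ge3 : (3 <= n)%N)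
    (* the closed space form (S, h_S) *)
    (S : ptopologicalType) (A : atlas R n.-1 S)
    (h : chart A -> 'rV[R]_n.-1 -> 'M[R]_n.-1) (eps : R)
    (eps_val : [\/ eps = -1, eps = 0 | eps = 1])
    (S_space_form : closed_space_form h eps)
    (* the adS-Reissner-Nordstroem manifold P *)
    (m q kappa s0 : R) (lt_qm : q < m) (lt_qk : q < kappa) (k_gt0 : 0 < kappa)
    (s0_root : largest_positive_root (adsRN_potential n eps m q kappa) s0)
    (lam : R -> R)
    (lam_warp : warping_function (adsRN_potential n eps m q kappa) s0 lam)
    (* the hypersurface Sigma *)
    (u : S -> R) (u_smooth : smooth_function A u) (u_gt0 : forall t, 0 < u t)
    (Sigma_convex : strictly_mean_convex h lam u)
    (* the Riemannian volume measures of S, Sigma and P *)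
    (volS areaSigma : {measure set (borel S) -> \bar R})
    (volP : {measure set (borel (R * S)%type) -> \bar R})
    (volS_h : riemannian_volume volS h)
    (areaSigma_g : riemannian_volume areaSigma (graph_metric h lam u))
    (volP_g : riemannian_volume volP (warped_metric h lam)) :
  let theta := fine (volS [set: S]) in
  let Sigma_area := fine (areaSigma [set: S]) in
  let horizon_area := s0 ^+ n.-1 * theta in
  let lhs := \int[areaSigma]_t lam (u t) in
  let rhs :=
    \int[volP]_(p in inner_region u) derive1 lam p.1
    + n.-1%:R / n%:R * theta * (Sigma_area / theta) `^ (n%:R / n.-1%:R)
    + s0 / n%:R * horizon_area in
  rhs <= lhs /\
  (lhs = rhs <-> exists s, s0 <= s /\ is_slice lam s (graph_of u)).
Proof.
case: n n_ge3 A h S_space_form s0_root lam_warp u_smooth Sigma_convex volS_h areaSigma_g volP_g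
  => [|[|[|e]]]// _ A h [[hS cS _] [sA rh _]] root [lam00 bij clam dlam] us mc vh va vp.
have [s0_gt0 V0 _] := root.
set V := adsRN_potential _ _ _ _ _ in root bij clam dlam V0.
have lam_ge r : 0 <= r -> s0 <= lam r.
  move=> r0; have [/(_ r) + _ _] := bij.
  by rewrite /= !in_itv /= !andbT; exact.
have lam_gt0 r : 0 <= r -> 0 < lam r by move=> /lam_ge; exact: lt_le_trans.
have lam_le r s : 0 <= r -> r <= s -> lam r <= lam s.
  move=> r0; rewrite le_eqVlt => /predU1P[->//|rs].
  have cl : {within `[r, s], continuous lam}.
    apply: continuous_subspaceW clam => x /=; rewrite !in_itv /= andbT => /andP[rx _].
    exact: le_trans rx.
  have di (x : R) : x \in `]r, s[ -> is_derive x 1 lam (Num.sqrt (V (lam x))).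
    by rewrite in_itv /= => /andP[rx _]; apply: dlam; exact: le_lt_trans rx.
  have [c _ E] := MVT rs di cl.
  by rewrite -subr_ge0 E mulr_ge0 ?sqrtr_ge0// subr_ge0 ltW.
have lam_lt r s : 0 <= r -> r < s -> lam r < lam s.
  move=> r0 rs; rewrite lt_neqAle lam_le ?(ltW rs)// andbT; apply/eqP => E.
  have [_ /(_ r s) inj _] := bij.
  have : r = s by apply: inj; rewrite // inE /= in_itv /= andbT // (le_trans r0 (ltW rs)).
  by move=> rsE; rewrite rsE ltxx in rs.
have onto y : lam 0 <= y -> exists2 r, 0 <= r & lam r = y.
  rewrite lam00 => sy; have [_ _ /(_ y)] := bij.
  rewrite /= in_itv /= andbT => /(_ sy) [r]; rewrite /= in_itv /= andbT => r0 ry.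
  by exists r.
pose phi r := Num.sqrt (V (lam r)).
have phi0 r : 0 < r -> 0 <= phi r by move=> _; exact: sqrtr_ge0.
have phi_mono r s : 0 < r -> r <= s -> phi r <= phi s.
  move=> r0 rs; rewrite ler_wsqrtr//.
  apply: (adsRN_potential_nondecreasing k_gt0 root); first by apply: lam_ge; exact: ltW.
  by apply: lam_le => //; exact: ltW.
have cphi : {within `[0, +oo[, continuous phi}.
  apply/subspace_continuousP => r; rewrite /= in_itv /= andbT => r0.
  have /subspace_continuousP/(_ r) := clam; rewrite /= in_itv /= andbT => /(_ r0) cl.
  apply: (@cvg_comp _ _ _ lam (fun y => Num.sqrt (V y)) _ _ _ cl).
  apply: (@continuous_comp _ _ _ V Num.sqrt); last exact: sqrt_continuous.
  by apply: adsRN_potential_continuous; exact: lam_gt0.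
have cu : C1_manifold A u by move=> i; exact: smooth_C1 (us i).
have cdu (i : chart A) b : C1 (chart_image i) (partial b (fun x => u (chart_inv i x))).
  exact: smooth_partial_C1 (us i).
have E := deficitE sA rh cS vh va vp clam cphi dlam phi0 lam_gt0 cu u_gt0.
pose D := deficit h sA volS areaSigma lam u.
have ge0 : 0 <= \int[volS]_t D t := deficit_ge0 sA rh hS cS vh va clam cphi dlam phi0 phi_mono lam_gt0 lam_lt onto cu cdu u_gt0 mc.
have eq0 : \int[volS]_t D t = 0 <-> exists s, forall t, lam (u t) = s := deficit_eq0 sA rh hS cS vh va clam cphi dlam phi0 phi_mono lam_gt0 lam_lt onto cu cdu u_gt0 mc.
move=> theta Sigma_area horizon_area lhs rhs; rewrite lam00 -/theta -/Sigma_area in E.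
have {}E : \int[volS]_t D t = lhs - rhs := E.
split; first by rewrite -subr_ge0 -E.
split=> [lr|[s [_ sl]]].
  have /eq0[s Ls] : \int[volS]_t D t = 0 by rewrite E lr subrr.
  exists s; split; first by rewrite -(Ls point); apply: lam_ge; exact: ltW.
  apply/seteqP; split=> [_ [_ [t _ <-] <-]|[x t] [/= -> _]]; first by split=> //=.
  by exists (u t, t); [exists t|rewrite /= Ls].
apply/eqP; rewrite -subr_eq0 -E; apply/eqP/eq0; exists s => t.
have : ([set s] `*` [set: S])%classic (lam (u t), t).
  by rewrite -sl; exists (u t, t) => //; exists t.
by case.
Qed.
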